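(* Let $\Phi$ be a tubular elliptic root system with elliptic Weyl system $(W,S)$, hyperbolic cover $(\tilde W,\tilde S)$, and Coxeter transformations $c\in W$ and $\tilde c\in\tilde W$. If $\Phi$ is of type $E_6^{(1,1)}$, $E_7^{(1,1)}$ or $E_8^{(1,1)}$, then $\varphi$ maps $\mathrm{Red}_{\tilde T}(\tilde c)$ bijectively onto $\mathrm{Red}_T(c)^{\mathrm{gen}}$. In type $D_4^{(1,1)}$ there are two Hurwitz orbits on $\mathrm{Red}_T(c)^{\mathrm{gen}}$, and the set $\mathrm{Red}_{\tilde T}(\tilde c)$ is mapped bijectively by $\varphi$ onto the Hurwitz orbit of $\mathrm{Red}_T(c)^{\mathrm{gen}}$ that contains $(s_1,s_3,s_4,s_0,s_2,s_{2^\star})$.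
   Context: Root systems. Let $V$ be a finite-dimensional real vector space with a symmetric bilinear form $(-\mid-)$ with radical $R$. For $(\alpha\mid\alpha)\ne0$ put $s_\alpha(v)=v-\frac{2(\alpha\mid v)}{(\alpha\mid\alpha)}\alpha$. A generalized root system is a non-empty set $\Phi\subseteq V$ of non-isotropic vectors with $\mathrm{span}_{\mathbb R}(\Phi)=V$, $s_\alpha(\Phi)\subseteq\Phi$ and $\frac{2(\alpha\mid\beta)}{(\beta\mid\beta)}\in\mathbb Z$ for all $\alpha,\beta\in\Phi$; $L(\Phi)=\mathrm{span}_{\mathbb Z}(\Phi)$ is a lattice in $V$ (generated by an $\mathbb R$-basis of $V$). It is reduced if $r\alpha\in\Phi$ implies $r=\pm1$, and irreducible if it is not a union of two mutually orthogonal generalized root systems. It is elliptic if it is irreducible and reduced and $(-\mid-)$ has signature $(n,0,2)$ (numbers of positive, negative, zero eigenvalues), $n+2=\dim V$. Standing assumption: $(\alpha\mid\alpha)=2$ for all $\alpha\in\Phi$. Fix a $1$-dimensional subspace $U\le R$ with $U\cap L(\Phi)\ne\{0\}$ and $a$ with $L(\Phi)\cap U=\mathbb Za$. The image $\Phi/U$ of $\Phi$ in $V/U$ is an irreducible affine root system; let $\beta_0,\dots,\beta_n$ be a root basis (simple system) of it such that $\beta_1,\dots,\beta_n$ is a root basis of a finite root system ($\beta_0$ being the affine node in the standard numbering), and let $m_1,\dots,m_n$ be the unique positive integers such that $\beta_0+\sum_{i=1}^n m_i\beta_i$ spans $L(\Phi/U)\cap R/U$; put $m_0=1$. Choose preimages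 $\alpha_i\in\Phi$ of $\beta_i$ and put $b=\sum_{i=0}^n m_i\alpha_i\in R$, $V_{\mathrm{fin}}=\sum_{i=1}^n\mathbb R\alpha_i$, $\Phi_{\mathrm{fin}}=\Phi\cap V_{\mathrm{fin}}$. $\Phi$ is tubular if exactly one index $t$ satisfies $m_t=\max_i m_i$; it is of type $X_n^{(1,1)}$ if $\Phi_{\mathrm{fin}}$ is of type $X_n$. Put $\alpha_{t^\star}=\alpha_t+a$, $M=\{0,\dots,n,t^\star\}$, $s_i=s_{\alpha_i}$, $S=\{s_i\mid i\in M\}$, $W=\langle s_\alpha\mid\alpha\in\Phi\rangle$. In type $D_4^{(1,1)}$ the labelling is such that $t=2$ is the branch vertex of the affine $D_4$-diagram on $\{0,1,2,3,4\}$. Hyperbolic cover. Let $\hat V=V_{\mathrm{fin}}\perp\langle a,a'\rangle\perp\langle b,b'\rangle\supseteq V$ with form extending that of $V$, $(a,a'),(b,b')$ hyperbolic pairs (isotropic vectors with product $1$), and $\tilde V=V\oplus\mathbb Rb'$. For $i\in M$ let $\tilde s_i$ be the reflection of $\tilde V$ with respect to $\alpha_i$; $\tilde S=\{\tilde s_i\mid i\in M\}$, $\tilde W=\langle\tilde S\rangle$. $\varphi:\tilde W\to W$, $w\mapsto w|_V$, is an epimorphism and is applied to tuples entrywise. Factorizations. $T=\bigcup_{w\in W}wSw^{-1}$, $\tilde T=\bigcup_{w\in\tilde W}w\tilde Sw^{-1}$. $\tilde c=\tilde s_1\cdots\tilde s_{t-1}\tilde s_{t+1}\cdots\tilde s_n\tilde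 s_0\tilde s_t\tilde s_{t^\star}$, and $c$ is the same product of the $s_i$. $\ell_T(w)$ is the minimal number of factors in an expression of $w$ as a product of elements of $T$; with $r=\ell_T(w)$, $\mathrm{Red}_T(w)=\{(t_1,\dots,t_r)\in T^r\mid w=t_1\cdots t_r\}$; similarly for $\tilde T$. $\mathrm{Red}_T(c)^{\mathrm{gen}}$ is the set of $(t_1,\dots,t_{n+2})\in\mathrm{Red}_T(c)$ with $\langle t_1,\dots,t_{n+2}\rangle=W$. Hurwitz orbits are the orbits of the braid group $\mathcal B_r$ acting by $\sigma_i(t_1,\dots,t_r)=(t_1,\dots,t_{i-1},t_{i+1},t_{i+1}^{-1}t_it_{i+1},t_{i+2},\dots,t_r)$. *)

(* Defs.v *)
From mathcomp Require Import all_boot all_order all_algebra.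
From mathcomp Require Import boolp classical_sets functions cardinality reals.
From Stdlib Require Import Relation_Operators.

Set Implicit Arguments.
Unset Strict Implicit.
Unset Printing Implicit Defensive.

Import Order.TTheory GRing.Theory Num.Theory.
Local Open Scope classical_set_scope.
Local Open Scope ring_scope.

Section RootSystems.
Variables (R : realType) (V : vectType R).
Implicit Types (B : V -> V -> R) (U : {vspace V}) (Phi : set V).

Definition zspan Phi : set V :=
  [set v | exists k (s : k.-tuple V),
     (forall i, Phi (tnth s i)) /\ inIntSpan s v].

Definition spans Phi U : Prop :=
  (forall x, Phi x -> x \in U) /\
  (forall U' : {vspace V}, (forall x, Phi x -> x \in U') -> (U <= U')%VS).

Definition is_lattice (L : set V) U : Prop :=
  exists X : (\dim U).-tuple V, basis_of U X /\ L = [set v | inIntSpan X v].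

Definition radical B : set V := [set v | forall w, B v w = 0].

Definition reflect_fun B (alpha v : V) : V :=
  v - (2 * B alpha v / B alpha alpha) *: alpha.

(* The subspace U is a parameter so that the two parts in a decomposition of a
   root system can be root systems in their own (smaller) spans. *)
Record gen_root_system B U Phi : Prop := {
  grs_neq0 : Phi !=set0;
  grs_anisotropic : forall alpha, Phi alpha -> B alpha alpha != 0;
  grs_spans : spans Phi U;
  grs_reflect : forall alpha beta, Phi alpha -> Phi beta ->
    Phi (reflect_fun B alpha beta);
  grs_int : forall alpha beta, Phi alpha -> Phi beta ->
    2 * B alpha beta / B beta beta \is a Num.int;
  grs_lattice : is_lattice (zspan Phi) U
}.

Definition reduced Phi : Prop :=
  forall alpha (r : R), Phi alpha -> Phi (r *: alpha) -> r = 1 \/ r = -1.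

Definition irreducible_rs B Phi : Prop :=
  ~ exists (Phi1 Phi2 : set V) (U1 U2 : {vspace V}),
      [/\ gen_root_system B U1 Phi1, gen_root_system B U2 Phi2,
          Phi = Phi1 `|` Phi2
        & forall x y, Phi1 x -> Phi2 y -> B x y = 0].

(* Numbers of positive, negative and zero eigenvalues (with multiplicity) of
   the Gram matrix in some basis; independent of the basis by Sylvester. *)
Definition signature B (p q z : nat) : Prop :=
  exists (X : (\dim {: V}).-tuple V) (l : seq R),
    [/\ basis_of {: V} X,
        char_poly (\matrix_(i, j) B (tnth X i) (tnth X j))
          = \prod_(x <- l) ('X - x%:P),
        count (fun x => 0 < x) l = p,
        count (fun x => x < 0) l = q
      & count_mem 0 l = z].

Record elliptic B (n : nat) Phi : Prop := {
  ell_grs : gen_root_system B {: V} Phi;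
  ell_irreducible : irreducible_rs B Phi;
  ell_reduced : reduced Phi;
  ell_dim : \dim {: V} = n.+2;
  ell_signature : signature B n 0 2
}.

Definition root_basis Phi k (beta : 'I_k -> V) : Prop :=
  [/\ forall i, Phi (beta i),
      free [seq beta i | i <- enum 'I_k]
    & forall x, Phi x -> exists c : 'I_k -> nat,
        x = \sum_i beta i *+ c i \/ x = - \sum_i beta i *+ c i].

Definition finite_root_system B U Phi : Prop :=
  gen_root_system B U Phi /\ finite_set Phi.

(* edges: the bonds of a simply-laced Dynkin diagram with vertices 0 .. k-1 *)
Definition cartan_entry (edges : seq (nat * nat)) (i j : nat) : int :=
  if i == j then 2
  else if ((i, j) \in edges) || ((j, i) \in edges) then -1 else 0.

Definition of_type B Phi (k : nat) (edges : seq (nat * nat)) : Prop :=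
  exists gamma : 'I_k -> V,
    root_basis Phi gamma /\
    forall i j : 'I_k, 2 * B (gamma i) (gamma j) / B (gamma j) (gamma j)
                       = (cartan_entry edges i j)%:~R.

Definition span_of k (x : 'I_k -> V) : {vspace V} := (\sum_i <[x i]>)%VS.

End RootSystems.

(* Bourbaki numbering, shifted so that it starts at 0 *)
Definition edges_D4 : seq (nat * nat) := [:: (0, 1); (1, 2); (1, 3)]%N.
Definition edges_E6 : seq (nat * nat) :=
  [:: (0, 2); (2, 3); (3, 4); (4, 5); (1, 3)]%N.
Definition edges_E7 : seq (nat * nat) := rcons edges_E6 (5, 6)%N.
Definition edges_E8 : seq (nat * nat) := rcons edges_E7 (6, 7)%N.

Section AffineQuotient.
Variables (R : realType) (V Q : vectType R).

(* Q, with the form BQ and the projection pi, is a model of V / U with its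
   induced form. *)
Definition is_quotient (B : V -> V -> R) (U : {vspace V})
    (BQ : Q -> Q -> R) (pi : 'Hom(V, Q)) : Prop :=
  [/\ lker pi = U, limg pi = fullv & forall v w, BQ (pi v) (pi w) = B v w].

Definition finite_part (T : Type) n (x : 'I_n.+1 -> T) : 'I_n -> T :=
  fun i => x (lift ord0 i).

(* That beta_0 is the affine node is the condition m_0 = 1: the nodes with
   coefficient 1 in the generator of the radical lattice are the images of the
   affine node under automorphisms of the affine diagram. *)
Definition affine_root_basis (B : V -> V -> R) (Phi : set V)
    (BQ : Q -> Q -> R) (pi : 'Hom(V, Q))
    n (beta : 'I_n.+1 -> Q) (m : 'I_n.+1 -> nat) : Prop :=
  let PhiQ := pi @` Phi in
  let Qfin := span_of (finite_part beta) in
  let PhiQfin := PhiQ `&` [set x | x \in Qfin] in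
  [/\ root_basis PhiQ beta,
      finite_root_system BQ Qfin PhiQfin,
      root_basis PhiQfin (finite_part beta),
      m ord0 = 1%N /\ (forall i, (0 < m i)%N)
    & zspan PhiQ `&` (pi @` radical B) = zspan [set \sum_i beta i *+ m i]].

End AffineQuotient.

Section Transformations.
Variables (R : realType) (V : vectType R).
Implicit Types (S W T : set 'End(V)) (w : 'End(V)) (s : seq 'End(V)).

Definition refl (B : V -> V -> R) (alpha : V) : 'End(V) :=
  linfun (reflect_fun B alpha).

Inductive generated S : set 'End(V) :=
| gen_in w of S w : generated S w
| gen_1 : generated S \1%VF
| gen_mul w1 w2 of generated S w1 & generated S w2 :
    generated S (w1 \o w2)%VF
| gen_inv w of generated S w : generated S (w^-1)%VF.

Definition conj_closure W S : set 'End(V) :=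
  [set x | exists w r, [/\ W w, S r & x = (w \o r \o w^-1)%VF]].

Definition lprod s : 'End(V) := foldr (fun x y => (x \o y)%VF) \1%VF s.

Definition factorization T w s : Prop :=
  (forall x, x \in s -> T x) /\ lprod s = w.

Definition has_length T w (r : nat) : Prop :=
  (exists2 s, factorization T w s & size s = r) /\
  (forall s, factorization T w s -> (r <= size s)%N).

Definition Red T w : set (seq 'End(V)) :=
  [set s | factorization T w s /\ has_length T w (size s)].

Definition Red_gen T W k w : set (seq 'End(V)) :=
  [set s | [/\ Red T w s, size s = k & generated [set x | x \in s] = W]].

Inductive hurwitz_step : seq 'End(V) -> seq 'End(V) -> Prop :=
| HurwitzStep p x y q :
    hurwitz_step (p ++ [:: x, y & q])
                 (p ++ [:: y, (y^-1 \o x \o y)%VF & q]).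

(* The symmetric closure adds the inverses of the braid generators: on tuples
   of invertible maps each move is a bijection. *)
Definition hurwitz_orbit s : set (seq 'End(V)) :=
  [set s' | clos_refl_sym_trans _ hurwitz_step s s'].

Definition hurwitz_orbits (X : set (seq 'End(V))) : set (set (seq 'End(V))) :=
  [set hurwitz_orbit s | s in X].

End Transformations.

Section WeylSystem.
Variables (R : realType) (V : vectType R) (n : nat).

(* The index set M is option 'I_n.+1, with None for t-star. *)
Definition extended_roots (alpha : 'I_n.+1 -> V) (t : 'I_n.+1) (a : V)
    (i : option 'I_n.+1) : V :=
  if i is Some j then alpha j else alpha t + a.

Definition coxeter_word (t : 'I_n.+1) : seq (option 'I_n.+1) :=
  [seq Some i | i <- enum 'I_n.+1 & (i != ord0) && (i != t)]
    ++ [:: Some ord0; Some t; None].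

Definition coxeter (s : option 'I_n.+1 -> 'End(V)) (t : 'I_n.+1) : 'End(V) :=
  lprod [seq s i | i <- coxeter_word t].

Definition tubular (m : 'I_n.+1 -> nat) (t : 'I_n.+1) : Prop :=
  forall i, (m i == \max_j m j) = (i == t).

End WeylSystem.

Section HyperbolicCover.
Variables (R : realType) (V Vhat : vectType R).

Definition hyperbolic_pair (Bhat : Vhat -> Vhat -> R) (x y : Vhat) : Prop :=
  [/\ Bhat x x = 0, Bhat y y = 0 & Bhat x y = 1].

Definition orthogonal_spaces (Bhat : Vhat -> Vhat -> R)
    (U1 U2 : {vspace Vhat}) : Prop :=
  forall x y, x \in U1 -> y \in U2 -> Bhat x y = 0.

(* iota is the inclusion of V in Vhat. *)
Definition hyperbolic_extension (B : V -> V -> R) (Vfin : {vspace V}) (a b : V)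
    (Bhat : Vhat -> Vhat -> R) (iota : 'Hom(V, Vhat)) (a' b' : Vhat) : Prop :=
  let F := (iota @: Vfin)%VS in
  let Ha := (<[iota a]> + <[a']>)%VS in
  let Hb := (<[iota b]> + <[b']>)%VS in
  [/\ lker iota = 0%VS /\ (forall v w, Bhat (iota v) (iota w) = B v w),
      hyperbolic_pair Bhat (iota a) a',
      hyperbolic_pair Bhat (iota b) b',
      [/\ orthogonal_spaces Bhat F Ha, orthogonal_spaces Bhat F Hb
        & orthogonal_spaces Bhat Ha Hb]
    & (F + Ha + Hb)%VS = fullv /\ directv (F + Ha + Hb)].

Definition Vtilde (iota : 'Hom(V, Vhat)) (b' : Vhat) : {vspace Vhat} :=
  (limg iota + <[b']>)%VS.

Definition form_tilde (Bhat : Vhat -> Vhat -> R) (U : {vspace Vhat})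
    (x y : subvs_of U) : R := Bhat (vsval x) (vsval y).

(* v |-> w v for v in V; iota^-1 is the inverse of iota on its image, which is
   stable under the group generated by reflections in elements of V. *)
Definition restrict_to_V (iota : 'Hom(V, Vhat)) (U : {vspace Vhat})
    (w : 'End(subvs_of U)) : 'End(V) :=
  (iota^-1 \o linfun vsval \o w \o linfun (vsproj U) \o iota)%VF.

End HyperbolicCover.

(* Main.v *)
From HB Require Import structures.
Require Import Defs.
From mathcomp Require Import all_boot all_order all_algebra.
From mathcomp Require Import boolp classical_sets functions cardinality reals.
From mathcomp Require Import zify ring lra.
From Stdlib Require Import Relation_Operators.

(** The proof works with roots instead of reflections. In the cover every root is
    determined up to sign by its reflection, and so it is in [V]; hence
    factorizations are sequences of roots up to signs, the restriction map is
    injective on them, and the question is which factorizations of [c] lift to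
    [ct].

    Let [es] be the sequence of roots of the Coxeter word. It is a basis of [V]
    and spans the root lattice [L]; [a] and [b] span the radical. The roots are
    all vectors of square length 2 in [L] (Phi_norm2). Two products of reflections
    that agree on [V] differ on the cover by a transvection in the plane of [a]
    and [b] with one parameter [k] (agree_V), which is an integer by integrality.
    Everything about lengths and generation follows from the operators
    [1 - P gs], where [P gs] is the product of the reflections in [gs]: they map
    vectors with integral products into the span of [gs], and in the case of [es]
    onto [L]. So a factorization of [ct] generates the lattice (cover_lattice),
    which amounts to generating the Weyl group (generating_lattice). A
    factorization of [c] has at least [n + 2] members, because [1 - P gs] remains
    surjective onto [V]: on [a] and [b] it is changed by the factor [1 - k m_t],
    which is not 0 as [m_t >= 2] (agree_size). If the factorization generates the
    lattice and is a basis, then comparing with the primitive vector [b] gives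
    [1 - k m_t = 1] or [-1] (agree_generating).

    In the types E6, E7 and E8 the largest coefficient is at least 3, since a
    unique largest coefficient 2 forces a star with four rays (mt_ge3). Then
    [k = 0], so all generating factorizations of [c] lift and the restriction map
    is a bijection onto them (Red_bij).

    In type D4 the largest coefficient is 2 (D4_diagram), and [k = 1] does occur.
    In integral coordinates of the root lattice the Hurwitz action becomes an
    action of braid words on sequences of six vectors. Modulo 2 and the radical,
    roots fall into three classes, the frames of four orthogonal lines, on which
    reflections act as transpositions; this and finite checks bring the finite
    parts of a generating factorization to those of the Coxeter word (star_tup).
    Two radical vectors [s] and [u] remain, such that [a + 2 s] and [b + 2 u] are a
    basis of the radical lattice. Explicit braid words act on such bases by
    the elementary matrices with off-diagonal entry 2 and by the sign, and the
    Euclidean algorithm leaves two normal forms (D4_reduction), the Coxeter word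
    and one with [k = 1]. The orbit of the Coxeter word consists of the
    factorizations that lift (orbit_tilde), because orbits lift
    (hurwitz_tilde) and the second normal form does not (other_tilde). *)

Set Implicit Arguments.
Unset Strict Implicit.
Unset Printing Implicit Defensive.

Import Order.TTheory GRing.Theory Num.Theory.
Local Open Scope classical_set_scope.
Local Open Scope ring_scope.

(** * Integral spans *)

Section IntegralSpan.
Variables (R : realType) (V : vectType R).
Implicit Types (S P : set V) (x y v : V).

Lemma zspan_id S x : S x -> zspan S x.
Proof.
move=> Sx; exists 1%N, [tuple x]; split=> [i|]; first by rewrite (ord1 i).
by exists [ffun=> 1]; rewrite big_ord1 ffunE.
Qed.

Lemma zspan0 S : zspan S 0.
Proof.
exists 0%N, [tuple]; split=> [[]//|].
by exists [ffun=> 0]; rewrite big_ord0.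
Qed.

Lemma zspanB S x y : zspan S x -> zspan S y -> zspan S (x - y).
Proof.
move=> [k [s [Ss [c ->]]]] [l [r [Sr [d ->]]]].
exists (k + l)%N, [tuple of s ++ r]; split=> [i|].
  case: (split_ordP i) => j ->; rewrite (tnth_nth 0) /=.
    by rewrite nth_cat size_tuple /= ltn_ord -tnth_nth.
  by rewrite nth_cat size_tuple /= ltnNge leq_addr /= addKn -tnth_nth.
exists [ffun i : 'I_(k + l) => match fintype.split i with inl j => c j | inr j => - d j end].
rewrite big_split_ord /=; congr (_ + _).
  apply: eq_bigr => i _; rewrite ffunE.
  by rewrite -[lshift l i]/(unsplit (inl i)) unsplitK /= nth_cat size_tuple ltn_ord.
rewrite -sumrN; apply: eq_bigr => i _; rewrite ffunE.
rewrite -[rshift k i]/(unsplit (inr i)) unsplitK /= nth_cat size_tuple.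
by rewrite ltnNge leq_addr /= addKn mulrNz.
Qed.

Lemma zspanN S x : zspan S x -> zspan S (- x).
Proof. by move=> Sx; rewrite -[- x]add0r; apply: zspanB => //; apply: zspan0. Qed.

Lemma zspanD S x y : zspan S x -> zspan S y -> zspan S (x + y).
Proof. by move=> Sx Sy; rewrite -[y]opprK; apply: zspanB => //; apply: zspanN. Qed.

Lemma zspanMz S x (c : int) : zspan S x -> zspan S (x *~ c).
Proof.
move=> Sx; case: c => k; rewrite ?NegzE ?mulrNz; last apply: zspanN.
  by elim: k => [|k IH]; [rewrite mulr0z; apply: zspan0 | rewrite -pmulrn mulrS; apply: zspanD].
elim: k => [|k IH]; first by rewrite mulr1z.
by rewrite -pmulrn mulrS; apply: zspanD => //; rewrite pmulrn.
Qed.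

Lemma zspan_sum S I (r : seq I) (p : pred I) (F : I -> V) :
  (forall i, p i -> zspan S (F i)) -> zspan S (\sum_(i <- r | p i) F i).
Proof.
move=> H; apply: (big_ind (zspan S)) => //; first exact: zspan0.
by move=> x y; apply: zspanD.
Qed.

Lemma zspan_ind S (P : V -> Prop) : P 0 -> (forall x y, P x -> P y -> P (x - y)) ->
  (forall x, S x -> P x) -> forall x, zspan S x -> P x.
Proof.
move=> P0 PB PS x [k [s [Ss [c ->]]]].
have PN y : P y -> P (- y) by move=> Py; rewrite -[- y]add0r; apply: PB.
have PD y z : P y -> P z -> P (y + z).
  by move=> Py Pz; rewrite -[z]opprK; apply: PB => //; apply: PN.
have PM y (d : int) : P y -> P (y *~ d).
  have PMn m : P y -> P (y *+ m).
    by move=> Py; elim: m => [|m IH]; rewrite ?mulr0n // mulrS; apply: PD.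
  by move=> Py; case: d => m; rewrite ?NegzE ?mulrNz; [|apply: PN]; apply: PMn.
apply: (big_ind P) => // i _; apply/PM/PS.
by have := Ss i; rewrite (tnth_nth 0).
Qed.

Lemma zspan_sub S S' : (forall x, S x -> zspan S' x) ->
  forall x, zspan S x -> zspan S' x.
Proof. by move=> H; apply: zspan_ind => //; [apply: zspan0 | move=> *; apply: zspanB]. Qed.

End IntegralSpan.

(** * Symmetric forms and reflections *)

Section Form.
Variables (R : realType) (V : vectType R) (B : {symmetric V}).
Implicit Types (x y z g : V) (c : R).

Lemma symC x y : B x y = B y x.
Proof. by rewrite hermC expr0 mul1r. Qed.
Lemma symDl x y z : B (x + y) z = B x z + B y z.
Proof. exact: linearDl. Qed.
Lemma symDr x y z : B z (x + y) = B z x + B z y.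
Proof. exact: linearDr. Qed.
Lemma symNl x z : B (- x) z = - B x z.
Proof. exact: linearNl. Qed.
Lemma symNr x z : B z (- x) = - B z x.
Proof. exact: linearNr. Qed.
Lemma symBl x y z : B (x - y) z = B x z - B y z.
Proof. by rewrite symDl symNl. Qed.
Lemma symBr x y z : B z (x - y) = B z x - B z y.
Proof. by rewrite symDr symNr. Qed.
Lemma symZl c x z : B (c *: x) z = c * B x z.
Proof. by rewrite linearZl_LR. Qed.
Lemma symZr c x z : B z (c *: x) = c * B z x.
Proof. by rewrite symC symZl symC. Qed.
Lemma sym0l z : B 0 z = 0.
Proof. exact: linear0l. Qed.
Lemma sym0r z : B z 0 = 0.
Proof. exact: linear0r. Qed.
Lemma sym_suml I (r : seq I) (p : pred I) (F : I -> V) z :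
  B (\sum_(i <- r | p i) F i) z = \sum_(i <- r | p i) B (F i) z.
Proof. exact: linear_sumlz. Qed.
Lemma sym_sumr I (r : seq I) (p : pred I) (F : I -> V) z :
  B z (\sum_(i <- r | p i) F i) = \sum_(i <- r | p i) B z (F i).
Proof. by rewrite symC sym_suml; apply: eq_bigr => i _; rewrite symC. Qed.

Definition symE := (symDl, symDr, symNl, symNr, symZl, symZr, sym0l, sym0r).

Lemma radicalr x y : radical B x -> B y x = 0.
Proof. by move=> rx; rewrite symC rx. Qed.

Lemma radicalD x y : radical B x -> radical B y -> radical B (x + y).
Proof. by move=> rx ry z; rewrite symDl rx ry addr0. Qed.

Lemma radicalN x : radical B x -> radical B (- x).
Proof. by move=> rx z; rewrite symNl rx oppr0. Qed.

Lemma radicalZ c x : radical B x -> radical B (c *: x).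
Proof. by move=> rx z; rewrite symZl rx mulr0. Qed.

(** The reflection in a vector of square length 2: the denominator of the
    general formula cancels. *)
Definition rs g x : V := x - B g x *: g.

Lemma reflect_rs g x : B g g = 2 -> reflect_fun B g x = rs g x.
Proof. by move=> gg; rewrite /reflect_fun /rs gg mulrAC mulfV ?mul1r // pnatr_eq0. Qed.

Lemma reflect_fun_linear g : linear (reflect_fun B g).
Proof.
move=> c x y; rewrite /reflect_fun symDr symZr scalerBr scalerA.
rewrite [RHS]addrACA -opprD -scalerDl; congr (_ - _ *: _).
by rewrite mulrDr mulrDl; congr (_ + _); rewrite -!mulrA mulrCA.
Qed.

Lemma reflE g x : B g g = 2 -> refl B g x = rs g x.
Proof.
move=> gg; rewrite -reflect_rs //.
pose H := GRing.isLinear.Build R V V *:%R (reflect_fun B g) (@reflect_fun_linear g).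
pose f : {linear V -> V} := HB.pack (reflect_fun B g) H.
by rewrite /refl -[LHS]/(linfun f x) lfunE.
Qed.

Lemma rs_iso g x y : B g g = 2 -> B (rs g x) (rs g y) = B x y.
Proof. by move=> gg; rewrite /rs !symE gg (symC x g); ring. Qed.

Lemma rsK g : B g g = 2 -> involutive (rs g).
Proof.
move=> gg x; rewrite /rs !symE gg -[RHS](subr0 x) -addrA -opprD -scalerDl.
by congr (x - _); rewrite (_ : _ + _ = 0) ?scale0r //; ring.
Qed.

Lemma rsN g x : rs (- g) x = rs g x.
Proof. by rewrite /rs symNl scalerN scaleNr !opprK. Qed.

Lemma rs_self g : B g g = 2 -> rs g g = - g.
Proof. by move=> gg; rewrite /rs gg scaler_nat mulr2n opprD addNKr. Qed.

Lemma rsD g x y : rs g (x + y) = rs g x + rs g y.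
Proof. by rewrite /rs symDr scalerDl opprD addrACA. Qed.

Lemma rs_fix g x : B g x = 0 -> rs g x = x.
Proof. by move=> gx; rewrite /rs gx scale0r subr0. Qed.

Lemma rsB g x y : rs g (x - y) = rs g x - rs g y.
Proof. by rewrite rsD /rs symNr scaleNr opprK opprD opprK. Qed.

Lemma rsZ g c x : rs g (c *: x) = c *: rs g x.
Proof. by rewrite /rs symZr scalerBr scalerA. Qed.

Lemma rs_conj g x y : B g g = 2 -> rs (rs g x) y = rs g (rs x (rs g y)).
Proof.
move=> gg; have -> : rs x (rs g y) = rs g y - B x (rs g y) *: x by [].
by rewrite rsB rsZ rsK // -(rs_iso x _ gg) rsK.
Qed.

Lemma rs_neg g x : B g g = 2 -> B g (rs g x) = - B g x.
Proof. by move=> gg; rewrite /rs !symE gg; ring. Qed.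

Lemma rs_shift g r x : radical B r -> rs (g + r) x = rs g x - B g x *: r.
Proof. by move=> rr; rewrite /rs symDl rr addr0 scalerDr opprD addrA. Qed.

(** Reflections in two roots that are congruent modulo the radical multiply to
    a transvection; all translations of roots below come from this product. *)
Lemma rs_shift_rs g r x : B g g = 2 -> radical B r ->
  rs (g + r) (rs g x) = x + B g x *: r.
Proof. by move=> gg rr; rewrite rs_shift // rsK // rs_neg // scaleNr opprK. Qed.

Lemma rs_rs_shift g r x : B g g = 2 -> radical B r ->
  rs g (rs (g + r) x) = x - B g x *: r.
Proof.
move=> gg rr; rewrite rs_shift // rsB rsK // rsZ [rs g r]rs_fix //.
exact: radicalr.
Qed.

End Form.

Section IntegralProducts.
Variables (R : realType) (V : vectType R) (B : {symmetric V}) (G : set V).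
Hypothesis G_int : forall g h, G g -> G h -> B g h \is a Num.int.

Lemma zspan_intl x h : zspan G x -> G h -> B x h \is a Num.int.
Proof.
move=> Zx Gh; move: x Zx; apply: zspan_ind => [|x y hx hy|g Gg].
- by rewrite sym0l rpred0.
- by rewrite symBl rpredB.
- exact: G_int.
Qed.

Lemma zspan_int x y : zspan G x -> zspan G y -> B x y \is a Num.int.
Proof.
move=> Zx; move: y; apply: zspan_ind => [|y z hy hz|g Gg].
- by rewrite sym0r rpred0.
- by rewrite symBr rpredB.
- exact: zspan_intl.
Qed.

End IntegralProducts.

(** * Simply laced root systems in a positive semidefinite lattice *)

Section SimplyLaced.
Variables (R : realType) (V : vectType R) (B : {symmetric V}).
Hypothesis psd : forall x, 0 <= B x x.
Hypothesis psd0 : forall x, B x x = 0 -> radical B x.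
Implicit Types (x y z g : V) (G P : set V).

Definition adj x y := B x y = 1 \/ B x y = -1.

Lemma adjC x y : adj x y -> adj y x.
Proof. by rewrite /adj symC. Qed.

(** Connectedness of the graph of non-orthogonality, as an induction principle
    along its edges. *)
Definition connected_set G := forall P : set V, (exists2 g, G g & P g) ->
  (forall g h, G g -> G h -> P g -> B g h != 0 -> P h) -> forall g, G g -> P g.

(** By the Cauchy-Schwarz inequality the product of two roots is at most 2 in
    absolute value, with equality only for roots that are equal or opposite
    modulo the radical. *)
Variant root_product x y : Prop :=
| RootOrth of B x y = 0
| RootAdj of adj x y
| RootSame of B x y = 2 & radical B (x - y)
| RootOpp of B x y = -2 & radical B (x + y).

Lemma root_productP x y : B x x = 2 -> B y y = 2 -> B x y \is a Num.int ->
  root_product x y.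
Proof.
move=> xx yy /intrP[k Bk].
have /= := psd (x - y); have /= := psd (x + y).
rewrite !symE xx yy (symC B y x) Bk => h1 h2.
have : (-2 <= k%:~R :> R) && (k%:~R <= 2%:R :> R) by apply/andP; split; lra.
rewrite -[2%:R]/(2%:~R) -[-2]/((-2)%:~R) !ler_int => /andP[k1 k2].
have : k = -2 \/ k = -1 \/ k = 0 \/ k = 1 \/ k = 2 by lia.
move=> [kE|[kE|[kE|[kE|kE]]]]; rewrite kE in Bk.
- apply: RootOpp; rewrite // ; apply: psd0.
  by rewrite !symE xx yy (symC B y x) Bk; ring.
- by apply: RootAdj; right; rewrite Bk.
- exact: RootOrth.
- by apply: RootAdj; left; rewrite Bk.
- apply: RootSame; rewrite // ; apply: psd0.
  by rewrite !symE xx yy (symC B y x) Bk; ring.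
Qed.

Lemma same_product x y z : radical B (x - y) -> B x z = B y z.
Proof. by move=> /(_ z); rewrite symBl => /subr0_eq. Qed.

Lemma opp_product x y z : radical B (x + y) -> B x z = - B y z.
Proof. by move=> /(_ z); rewrite symDl => /eqP; rewrite addr_eq0 => /eqP. Qed.

Variables (Psi G : set V).
Hypothesis Psi_norm : forall x, Psi x -> B x x = 2.
Hypothesis Psi_int : forall x y, Psi x -> Psi y -> B x y \is a Num.int.
Hypothesis Psi_refl : forall x y, Psi x -> Psi y -> Psi (rs B x y).
Hypothesis G_Psi : forall g, G g -> Psi g.
Hypothesis G_conn : connected_set G.
Hypothesis G_span : forall x, (forall g, G g -> B x g = 0) -> radical B x.
Hypothesis G_adj : exists g h, [/\ G g, G h & adj g h].

Let prodP x y (hx : Psi x) (hy : Psi y) : root_product x y :=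
  root_productP (Psi_norm hx) (Psi_norm hy) (Psi_int hx hy).

Let n2 : 2 != 0 :> R. Proof. by rewrite pnatr_eq0. Qed.

Lemma adj_same x y z : radical B (x - y) -> adj y z -> adj x z.
Proof. by rewrite /adj => /(@same_product _ _ z) ->. Qed.

Lemma adj_opp x y z : radical B (x + y) -> adj y z -> adj x z.
Proof.
by rewrite /adj => /(@opp_product _ _ z) -> [] ->; [right|left]; rewrite ?opprK.
Qed.

(** Without a neighbour, [g] would be joined only to vectors congruent to [g] or
    [- g]; by connectedness these exhaust [G], which then has no adjacent pair. *)
Lemma G_neighbour g : G g -> exists2 h, G h & adj g h.
Proof.
move=> Gg; apply: contrapT => noh.
pose P := [set x | radical B (x - g) \/ radical B (x + g)].
have allP : forall x, G x -> P x.
  apply: G_conn.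
    by exists g => //; left => z; rewrite subrr sym0l.
  move=> x y Gx Gy Px Bxy; case: (prodP (G_Psi Gg) (G_Psi Gy)).
  - move=> gy; case/eqP: Bxy.
    by case: Px => [/same_product|/opp_product] ->; rewrite gy ?oppr0.
  - by move=> gy; case: noh; exists y.
  - by move=> _ r; left; rewrite -opprB; apply: radicalN.
  - by move=> _ r; right; rewrite addrC.
have [x [y [Gx Gy xy]]] := G_adj.
case: noh; exists y => //.
by case: (allP x Gx) xy => r; [apply: adj_same | apply: adj_opp];
  [rewrite -opprB; apply: radicalN | rewrite addrC].
Qed.

Lemma Psi_neighbour x : Psi x -> exists2 h, G h & adj x h.
Proof.
move=> Px.
have [g Gg xg] : exists2 g, G g & B x g != 0.
  apply: contrapT => H.
  case/eqP: n2; rewrite -(Psi_norm Px); apply: (G_span (x := x)) => g Gg.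
  by apply/eqP/negPn/negP => xg; apply: H; exists g.
have [h Gh gh] := G_neighbour Gg.
case: (prodP Px (G_Psi Gg)) => [xg0|xg1|_ r|_ r].
- by rewrite xg0 eqxx in xg.
- by exists g.
- by exists h => //; apply: adj_same gh.
- by exists h => //; apply: adj_opp gh.
Qed.

(** Non-orthogonal congruent roots are joined through a common neighbour, so
    connectedness persists when only products 1 and -1 count as edges. *)
Lemma Psi_connected (P : set V) : (exists2 x, Psi x & P x) ->
  (forall x y, Psi x -> Psi y -> P x -> adj x y -> P y) ->
  forall x, Psi x -> P x.
Proof.
move=> [x0 Px0 H0] Hadj.
have [h0 Gh0 x0h0] := Psi_neighbour Px0.
have PG : forall g, G g -> P g.
  apply: G_conn; first by exists h0 => //; apply: Hadj x0h0 => //; apply: G_Psi.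
  move=> g h Gg Gh Pg gh.
  have [z Gz gz] := G_neighbour Gg.
  have Pz : P z by apply: Hadj gz => //; apply: G_Psi.
  case: (prodP (G_Psi Gg) (G_Psi Gh)) => [gh0|gh1|_ r|_ r].
  - by rewrite gh0 eqxx in gh.
  - by apply: Hadj gh1 => //; apply: G_Psi.
  - apply: (Hadj z h) => //; [exact: G_Psi | exact: G_Psi|].
    by apply: adjC; apply: adj_same gz; rewrite -opprB; apply: radicalN.
  - apply: (Hadj z h) => //; [exact: G_Psi | exact: G_Psi|].
    by apply: adjC; apply: adj_opp gz; rewrite addrC.
move=> x Px; have [h Gh xh] := Psi_neighbour Px.
by apply: Hadj (adjC xh) => //; [apply: G_Psi | apply: PG].
Qed.

Definition translates r := forall x, Psi x -> Psi (x + r).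

Lemma Psi_opp x : Psi x -> Psi (- x).
Proof. by move=> Px; rewrite -(rs_self (Psi_norm Px)); apply: Psi_refl. Qed.

(** If one root may be shifted by a radical vector [r], then so may all roots:
    the product of the reflections in [x] and [x + r] moves [y] by a multiple
    [(x|y)] of [r], which is [r] or [- r] when [y] is a neighbour of [x]. *)
Lemma translates1 x r : radical B r -> Psi x -> Psi (x + r) -> translates r.
Proof.
move=> rr Px Pxr.
apply: (@Psi_connected (fun y => Psi (y + r))); first by exists x.
move=> {Px Pxr}x {}y Px Py Pxr [xy|xy].
- have := Psi_refl Pxr (Psi_refl Px Py).
  by rewrite rs_shift_rs ?Psi_norm // xy scale1r.
- have := Psi_refl Px (Psi_refl Pxr Py).
  by rewrite rs_rs_shift ?Psi_norm // xy scaleN1r opprK.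
Qed.

Lemma exists_neg_summand (l : seq V) x : B x (\sum_(y <- l) y) < 0 ->
  exists2 y, y \in l & B x y < 0.
Proof.
rewrite sym_sumr => lt; apply: contrapT => H.
suff : 0 <= \sum_(y <- l) B x y by move=> ?; lra.
rewrite big_seq; apply: sumr_ge0 => y yl; rewrite leNgt; apply/negP => yx.
by apply: H; exists y.
Qed.

Lemma sum_rem (l : seq V) y : y \in l ->
  \sum_(z <- l) z = y + \sum_(z <- rem y l) z.
Proof. by move=> yl; rewrite (perm_big _ (perm_to_rem yl)) big_cons. Qed.

(** A sum of roots that is radical has two summands with negative product,
    which merge into one root or cancel up to a translation. *)
Lemma translates_sum (l : seq V) : (forall x, x \in l -> Psi x) ->
  radical B (\sum_(x <- l) x) -> translates (\sum_(x <- l) x).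
Proof.
have [k] := ubnP (size l); elim: k l => // k IH [|x l] sz Hl rad.
  by rewrite big_nil => x; rewrite addr0.
have Px : Psi x by apply: Hl; rewrite mem_head.
have [y yl xy] : exists2 y, y \in l & B x y < 0.
  have := radicalr x rad; rewrite big_cons symDr (Psi_norm Px) => e.
  by apply: exists_neg_summand; lra.
have Py : Psi y by apply: Hl; rewrite inE yl orbT.
have Hr : forall z, z \in rem y l -> Psi z.
  by move=> z /mem_rem zl; apply: Hl; rewrite inE zl orbT.
have szr : (size (rem y l)).+1 = size l.
  by rewrite size_rem // prednK //; case: (l) yl.
have E : \sum_(z <- x :: l) z = x + y + \sum_(z <- rem y l) z.
  by rewrite big_cons (sum_rem yl) addrA.
rewrite E in rad *.
case: (prodP Px Py) => [e|[e|e]|e _|e r]; try lra.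
  have Pxy : Psi (x + y).
    by have := Psi_refl Py Px; rewrite /rs symC e scaleN1r opprK.
  have := IH (x + y :: rem y l); rewrite big_cons; apply => //.
    by rewrite /= szr; move: sz; rewrite /= ltnS.
  by move=> z; rewrite inE => /orP[/eqP->//|/Hr].
have t1 : translates (x + y).
  apply: (@translates1 (- y)) => //; first exact: Psi_opp.
  by rewrite addrC addrK.
have t2 : translates (\sum_(z <- rem y l) z).
  apply: IH => //; first by move: sz; rewrite /= ltnS -szr; apply: ltn_trans.
  move=> z; have := rad z; rewrite symDl r add0r; exact.
by move=> z Pz; rewrite addrA; apply/t2/t1.
Qed.

Lemma zspan_list x : zspan Psi x ->
  exists2 l : seq V, (forall y, y \in l -> Psi y) & x = \sum_(y <- l) y.
Proof.
move: x; apply: zspan_ind.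
- by exists [::]; rewrite ?big_nil.
- move=> x y [l Hl ->] [l' Hl' ->]; exists (l ++ map -%R l').
    move=> z; rewrite mem_cat => /orP[/Hl//|/mapP[w /Hl' Pw ->]].
    exact: Psi_opp.
  by rewrite big_cat big_map sumrN.
- move=> x Px; exists [:: x]; first by move=> y; rewrite inE => /eqP->.
  by rewrite big_seq1.
Qed.

(** A connected simply laced root system contains every vector [x] of square
    length 2 of its lattice. In an expression of [x] as a sum of roots, some
    summand [y] has [(x|y) > 0]. If [(x|y) = 1], then [x - y] has square length
    2 and fewer summands, hence is a root, and its reflection in [y] is [x]. If
    [(x|y) = 2], then [x - y] is a radical sum of roots, by which roots may be
    translated. *)
Theorem norm2_root x : zspan Psi x -> B x x = 2 -> Psi x.
Proof.
move=> Zx xx; have [l Hl E] := zspan_list Zx; move: Zx xx Hl; rewrite {x}E.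
have [k] := ubnP (size l); elim: k l => // k IH l sz Zx.
set x := \sum_(y <- l) y => xx Hl.
have [y yl xy] : exists2 y, y \in l & B (- x) y < 0.
  by apply: exists_neg_summand; rewrite symNl xx; lra.
have Py := Hl y yl.
have Hr : forall z, z \in rem y l -> Psi z by move=> z /mem_rem /Hl.
have szr : (size (rem y l)).+1 = size l.
  by rewrite size_rem // prednK //; case: (l) yl.
have E : x - y = \sum_(z <- rem y l) z.
  by rewrite /x (sum_rem yl) addrC addKr.
rewrite symNl in xy.
case: (root_productP xx (Psi_norm Py) (zspan_intl Psi_int Zx Py)) => [e|[e|e]|e r|e _]; try lra.
  have Pxy : Psi (x - y).
    rewrite E; apply: IH => //; first by move: sz; rewrite -szr ltnS.
      by rewrite -E; apply: zspanB => //; apply: zspan_id.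
    by rewrite -E !symE xx (Psi_norm Py) (symC B y) e; ring.
  have := Psi_refl Py Pxy; rewrite /rs symBr (Psi_norm Py) (symC B y) e.
  by rewrite (_ : 1 - 2 = -1) ?scaleN1r ?opprK ?subrK //; ring.
rewrite -(subrK y x) addrC; rewrite E in r *.
exact: translates_sum.
Qed.

End SimplyLaced.

(** * Products of reflections *)

Section ReflectionProduct.
Variables (R : realType) (V : vectType R) (B : {symmetric V}).
Implicit Types (gs : seq V) (x g : V) (ys : seq R).

Definition rp gs x := foldr (rs B) x gs.

Definition norm2 gs := forall g, g \in gs -> B g g = 2.

Lemma norm2_cons g gs : norm2 (g :: gs) -> B g g = 2 /\ norm2 gs.
Proof.
move=> H; split=> [|h hg]; apply: H; rewrite inE ?eqxx // hg orbT //.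
Qed.

Lemma rp_cat gs1 gs2 x : rp (gs1 ++ gs2) x = rp gs1 (rp gs2 x).
Proof. by rewrite /rp foldr_cat. Qed.

Lemma rpD gs (x y : V) : rp gs (x + y) = rp gs x + rp gs y.
Proof. by elim: gs => //= g gs ->; rewrite rsD. Qed.

Lemma rpZ gs c x : rp gs (c *: x) = c *: rp gs x.
Proof. by elim: gs => //= g gs ->; rewrite rsZ. Qed.

Lemma rpN gs x : rp gs (- x) = - rp gs x.
Proof. by rewrite -scaleN1r rpZ scaleN1r. Qed.

Lemma rpB gs (x y : V) : rp gs (x - y) = rp gs x - rp gs y.
Proof. by rewrite rpD rpN. Qed.

Lemma rp_iso gs (x y : V) : norm2 gs -> B (rp gs x) (rp gs y) = B x y.
Proof. by elim: gs => //= g gs IH /norm2_cons[gg /IH E]; rewrite rs_iso. Qed.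

Lemma rp_fix gs x : (forall g, g \in gs -> B g x = 0) -> rp gs x = x.
Proof.
elim: gs => //= g gs IH H; rewrite IH => [|h hg]; last by apply: H; rewrite inE hg orbT.
by rewrite rs_fix // H // mem_head.
Qed.

Lemma rp_revK gs x : norm2 gs -> rp gs (rp (rev gs) x) = x.
Proof.
elim: gs x => //= g gs IH x /norm2_cons[gg nn].
by rewrite rev_cons -cats1 rp_cat IH // rsK.
Qed.

Lemma lprod_refl gs x : norm2 gs -> lprod [seq refl B g | g <- gs] x = rp gs x.
Proof.
elim: gs => [|g gs IH] /= nn; first by rewrite id_lfunE.
by have [gg /IH E] := norm2_cons nn; rewrite comp_lfunE E reflE.
Qed.

(** Each reflection changes a vector by a multiple of its root; the multiple is
    integral as long as the vector has integral products with the roots. *)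
Lemma rp_zspan (S : set V) gs x :
  (forall g h, S g -> S h -> B g h \is a Num.int) ->
  (forall g, g \in gs -> S g) -> (forall g, g \in gs -> B g x \is a Num.int) ->
  zspan [set g | g \in gs] (x - rp gs x).
Proof.
move=> Sint; elim: gs => [|g gs IH] Sg gx; first by rewrite subrr; apply: zspan0.
have {}IH : zspan [set h | h \in gs] (x - rp gs x).
  by apply: IH => h hg; [apply: Sg|apply: gx]; rewrite inE hg orbT.
have IH' : zspan [set h | h \in g :: gs] (x - rp gs x).
  move: IH; apply: zspan_sub => h /= hg; apply: zspan_id.
  by rewrite /= inE hg orbT.
rewrite /= {1}/rs opprB addrCA addrC -/(rp gs x); apply: zspanD => //.
suff /intrP[k ->] : B g (rp gs x) \is a Num.int.
  by rewrite scaler_int; apply/zspanMz/zspan_id; rewrite /= mem_head.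
have -> : B g (rp gs x) = B g x - B g (x - rp gs x) by rewrite symBr subKr.
rewrite rpredB ?gx ?mem_head //; move: IH.
apply: (@zspan_ind _ _ _ (fun v => B g v \is a Num.int)).
- by rewrite sym0r rpred0.
- by move=> u v; rewrite symBr => hu hv; rewrite rpredB.
- by move=> h hg; apply: Sint; apply: Sg; rewrite inE ?eqxx ?hg ?orbT.
Qed.

Definition comb ys gs := \sum_(p <- zip ys gs) p.1 *: p.2.

Lemma comb_cons (y : R) ys g gs : comb (y :: ys) (g :: gs) = y *: g + comb ys gs.
Proof. by rewrite /comb big_cons. Qed.

Lemma comb_cat ys gs ys' gs' : size ys = size gs ->
  comb (ys ++ ys') (gs ++ gs') = comb ys gs + comb ys' gs'.
Proof. by move=> sz; rewrite /comb zip_cat // big_cat. Qed.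

Lemma comb_span ys gs : comb ys gs \in <<gs>>%VS.
Proof.
elim: ys gs => [|y ys IH] [|g gs]; rewrite /comb ?big_nil ?mem0v //.
rewrite big_cons /= span_cons; apply: memv_add; last exact: IH.
by rewrite memvZ // memv_line.
Qed.

Lemma rp_comb gs x : exists2 ys, size ys = size gs & x - rp gs x = comb ys gs.
Proof.
elim: gs => [|g gs [ys sy IH]] /=; first by exists [::]; rewrite // subrr /comb big_nil.
exists (B g (rp gs x) :: ys); first by rewrite /= sy.
by rewrite comb_cons -IH {1}/rs opprB addrCA addrC.
Qed.

Lemma span_comb gs x : x \in <<gs>>%VS -> exists2 ys, size ys = size gs & x = comb ys gs.
Proof.
elim: gs x => [|g gs IH] x.
  by rewrite span_nil memv0 => /eqP->; exists [::]; rewrite // /comb big_nil.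
rewrite span_cons => /memv_addP[_ /vlineP[c ->] [y /IH[ys sy ->] ->]].
by exists (c :: ys); rewrite ?comb_cons //= sy.
Qed.

(** [x - rp gs x] is a combination of [gs] whose coefficient at the first root
    is its product with the partly reflected vector, so independence gives the
    orthogonality one root at a time. *)
Lemma rp_fixed gs x : free gs -> rp gs x = x -> forall g, g \in gs -> B g x = 0.
Proof.
elim: gs => // g gs IH; rewrite free_cons => /andP[gn fg] /= E.
have [ys _ yE] := rp_comb gs x.
have c0 : B g (rp gs x) = 0.
  apply/eqP/negPn/negP => c; case/negP: gn.
  have /(congr1 (fun v => (B g (rp gs x))^-1 *: v)) : B g (rp gs x) *: g = - comb ys gs.
    by rewrite -yE opprB -{3}E /rs subKr.
  by rewrite scalerA mulVf // scale1r => ->; rewrite memvZ // memvN comb_span.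
have E' : rp gs x = x by rewrite -{2}E /rs c0 scale0r subr0.
by move=> h; rewrite inE => /orP[/eqP->|]; [rewrite -{1}E' | apply: IH].
Qed.

Definition all_int ys := forall y, y \in ys -> y \is a Num.int.

(** The equation [x - rp gs x = comb ys gs] is triangular in the products of
    [x] with the members of [gs], solved from the last one to the first. *)
Fixpoint solution ys gs : seq R :=
  match ys, gs with
  | y :: ys', g :: gs' => y + B g (comb ys' gs') :: solution ys' gs'
  | _, _ => [::]
  end.

Lemma size_solution ys gs : size ys = size gs -> size (solution ys gs) = size gs.
Proof. by elim: ys gs => [|y ys IH] [|g gs] //= [/IH->]. Qed.

Lemma solutionP ys gs x : size ys = size gs ->
  (forall i, (i < size gs)%N -> B gs`_i x = (solution ys gs)`_i) ->
  x - rp gs x = comb ys gs.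
Proof.
elim: ys gs => [|y ys IH] [|g gs] //=; first by rewrite subrr /comb big_nil.
move=> [sz] H; have E : x - rp gs x = comb ys gs.
  by apply: IH => // i lt; apply: (H i.+1).
have gy : B g (rp gs x) = y.
  have := H 0%N isT => /=; rewrite -E symBr; lra.
by rewrite comb_cons -E /rs gy opprB addrCA addrC.
Qed.

Lemma comb_zspan ys gs : all_int ys -> zspan [set g | g \in gs] (comb ys gs).
Proof.
elim: ys gs => [|y ys IH] [|g gs] Hy; rewrite /comb ?big_nil; try exact: zspan0.
rewrite big_cons /=; apply: zspanD.
  have /intrP[k ->] : y \is a Num.int by apply: Hy; rewrite mem_head.
  by rewrite scaler_int; apply/zspanMz/zspan_id; rewrite /= mem_head.
have := IH gs (fun z hz => Hy z (@mem_behead _ (y :: ys) z hz)).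
by apply: zspan_sub => h /= hg; apply: zspan_id; rewrite /= inE hg orbT.
Qed.

Lemma solution_int (S : set V) ys gs :
  (forall g h, S g -> S h -> B g h \is a Num.int) -> (forall g, g \in gs -> S g) ->
  all_int ys -> all_int (solution ys gs).
Proof.
move=> Sint; elim: ys gs => [|y ys IH] [|g gs] //= Sg Hy.
have Hy' : all_int ys by move=> z hz; apply: Hy; rewrite inE hz orbT.
move=> z; rewrite inE => /orP[/eqP->|]; last first.
  by apply: IH => // h hg; apply: Sg; rewrite inE hg orbT.
apply: rpredD; first by apply: Hy; rewrite mem_head.
have := comb_zspan gs Hy'; move: (comb ys gs).
apply: zspan_ind.
- by rewrite sym0r rpred0.
- by move=> u v; rewrite symBr => hu hv; rewrite rpredB.
- by move=> h hg; apply: Sint; apply: Sg; rewrite inE ?eqxx ?hg ?orbT.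
Qed.

Lemma zspan_comb gs x : zspan [set g | g \in gs] x ->
  exists ys, [/\ size ys = size gs, all_int ys & x = comb ys gs].
Proof.
move: x; apply: zspan_ind.
- exists (nseq (size gs) 0); rewrite size_nseq; split=> //.
    by move=> y; rewrite mem_nseq => /andP[_ /eqP->]; rewrite rpred0.
  by elim: gs => [|g gs IH]; rewrite ?comb_cons -?IH ?scale0r ?addr0 // /comb big_nil.
- move=> x y [ys [sy iy ->]] [zs [sz iz ->]].
  exists [seq p.1 - p.2 | p <- zip ys zs]; split.
  + by rewrite size_map size_zip sy sz minnn.
  + move=> z /mapP[[u v] /= uv ->].
    apply: rpredB; [apply: iy|apply: iz].
      by have := map_f fst uv; rewrite -/unzip1 unzip1_zip ?sy ?sz.
    by have := map_f snd uv; rewrite -/unzip2 unzip2_zip ?sy ?sz.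
  + elim: gs ys zs sy sz {iy iz} => [|g gs IH] [|u ys] [|v zs] //=.
      by move=> _ _; rewrite /comb !big_nil subrr.
    move=> [sy] [sz]; rewrite !comb_cons -IH // scalerBl.
    by rewrite opprD addrACA.
- move=> g; rewrite /=; elim: gs => // h gs IH; rewrite inE => /orP[/eqP->|].
    exists (1 :: nseq (size gs) 0); split; rewrite /= ?size_nseq //.
      move=> y; rewrite inE mem_nseq => /orP[/eqP->|/andP[_ /eqP->]];
      by rewrite ?rpred1 ?rpred0.
    rewrite comb_cons scale1r -[LHS]addr0; congr (_ + _).
    by elim: (gs) => [|k hs IH']; rewrite ?comb_cons -?IH' ?scale0r ?addr0 // /comb big_nil.
  move=> /IH[ys [sy iy ->]]; exists (0 :: ys); split; rewrite /= ?sy //.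
    by move=> y; rewrite inE => /orP[/eqP->|/iy//]; rewrite rpred0.
  by rewrite comb_cons scale0r add0r.
Qed.

End ReflectionProduct.

(** * The hyperbolic cover *)

Section Transport.
Variables (R : realType) (V V' : vectType R) (B : {symmetric V}) (B' : {symmetric V'}).
Variable f : {linear V -> V'}.
Hypothesis f_iso : forall v w, B' (f v) (f w) = B v w.

Let fZ c v : f (c *: v) = c *: f v. Proof. exact: linearZZ. Qed.

Lemma rs_morph g v : rs B' (f g) (f v) = f (rs B g v).
Proof. by rewrite /rs f_iso linearB fZ. Qed.

Lemma rp_morph gs v : rp B' [seq f g | g <- gs] (f v) = f (rp B gs v).
Proof. by elim: gs => //= g gs ->; rewrite rs_morph. Qed.

Lemma norm2_morph gs : norm2 B gs -> norm2 B' [seq f g | g <- gs].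
Proof. by move=> nn _ /mapP[g /nn gg ->]; rewrite f_iso. Qed.

End Transport.

(** What the hyperbolic cover contributes: the radical plane spanned by [a] and
    [b] is paired with [a'] and [b'], and prescribed products with independent
    vectors of [V] are realized by a vector of the cover. *)
Record cover_data (R : realType) (V W : vectType R) (B : {symmetric V})
    (C : {symmetric W}) (iota : {linear V -> W}) (a b : V) (a' b' : W) : Prop :=
  CoverData {
  cd_inj : injective iota;
  cd_iso : forall v w, C (iota v) (iota w) = B v w;
  cd_rad_a : radical B a;
  cd_rad_b : radical B b;
  cd_radE : forall v, radical B v -> exists p q, v = p *: a + q *: b;
  cd_aa' : C (iota a) a' = 1;
  cd_ab' : C (iota a) b' = 0;
  cd_ba' : C (iota b) a' = 0;
  cd_bb' : C (iota b) b' = 1;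
  cd_dec : forall x, exists v p q, x = iota v + p *: a' + q *: b';
  cd_dual : forall (gs : seq V) (hs : seq R), free gs ->
    exists x, forall i, (i < size gs)%N -> C (iota gs`_i) x = hs`_i
}.

(** The roots of a Coxeter transformation form a basis of [V]; the last two
    differ by [a], and [b] is a primitive vector of their lattice with the
    coefficient [m], the largest one of the diagram, at the last but one. *)
Record coxeter_data (R : realType) (V W : vectType R) (B : {symmetric V})
    (C : {symmetric W}) (iota : {linear V -> W}) (a b : V) (b' : W)
    (es0 : seq V) (et : V) (ys0 : seq R) (m : R) : Prop := CoxeterData {
  xd_norm : norm2 B (es0 ++ [:: et; et + a]);
  xd_free : free (es0 ++ [:: et; et + a]);
  xd_full : <<es0 ++ [:: et; (et + a)%R]>>%VS = fullv;
  xd_int : forall g h, zspan [set g | g \in es0 ++ [:: et; et + a]] g ->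
    zspan [set g | g \in es0 ++ [:: et; et + a]] h -> B g h \is a Num.int;
  xd_size : size ys0 = size es0;
  xd_ys0 : all_int ys0;
  xd_m : m \is a Num.int;
  xd_b : b = comb ys0 es0 + m *: et;
  xd_b_prim : forall d z, d \is a Num.int ->
    zspan [set g | g \in es0 ++ [:: et; et + a]] z -> b = d *: z -> d = 1 \/ d = -1;
  xd_a_prim : forall k : R, zspan [set g | g \in es0 ++ [:: et; et + a]] (k *: a) ->
    k \is a Num.int;
  xd_b' : forall g, g \in es0 ++ [:: et; et + a] -> C (iota g) b' \is a Num.int
}.

Section Cover.
Variables (R : realType) (V W : vectType R) (B : {symmetric V}) (C : {symmetric W}).
Variable iota : {linear V -> W}.
Variables (a b : V) (a' b' : W).
Hypothesis K : cover_data B C iota a b a' b'.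

Let iota_inj := cd_inj K.
Let iota_iso := cd_iso K.
Let rad_a := cd_rad_a K.
Let rad_b := cd_rad_b K.
Let radE := cd_radE K.
Let aa' := cd_aa' K.
Let ab' := cd_ab' K.
Let ba' := cd_ba' K.
Let bb' := cd_bb' K.
Let decW := cd_dec K.
Let dual := cd_dual K.

Notation P gs := (rp C [seq iota g | g <- gs]).

Let iotaZ c v : iota (c *: v) = c *: iota v. Proof. exact: linearZZ. Qed.
Let a'a : C a' (iota a) = 1. Proof. by rewrite symC. Qed.
Let b'a : C b' (iota a) = 0. Proof. by rewrite symC. Qed.
Let a'b : C a' (iota b) = 0. Proof. by rewrite symC. Qed.
Let b'b : C b' (iota b) = 1. Proof. by rewrite symC. Qed.

Let rpi gs v : P gs (iota v) = iota (rp B gs v).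
Proof. exact: rp_morph iota_iso gs v. Qed.

Let comb_iota ys gs : comb ys [seq iota h | h <- gs] = iota (comb ys gs).
Proof.
rewrite /comb linear_sum; elim: ys gs => [|z ys IH] [|h gs] //=;
by rewrite ?big_nil // !big_cons iotaZ IH.
Qed.

Let solution_iota ys gs : solution C ys [seq iota g | g <- gs] = solution B ys gs.
Proof.
by elim: ys gs => [|y ys IH] [|g gs] //=; rewrite IH comb_iota iota_iso.
Qed.

Lemma perpV d : (forall v, C d (iota v) = 0) -> exists p q, d = iota (p *: a + q *: b).
Proof.
have [v [p [q ->]]] := decW d => H.
have p0 : p = 0.
  by have := H a; rewrite !symE iota_iso a'a b'a (radicalr _ rad_a); lra.
have q0 : q = 0.
  by have := H b; rewrite !symE iota_iso a'b b'b (radicalr _ rad_b); lra.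
move: H; rewrite {}p0 {}q0 !scale0r !addr0 => H.
suff /radE[r [s ->]] : radical B v by exists r, s.
by move=> w; rewrite -iota_iso H.
Qed.

Lemma P_fix gs v : radical B v -> P gs (iota v) = iota v.
Proof.
move=> rv; rewrite rpi rp_fix // => g _.
exact: radicalr.
Qed.

Lemma C_P_rad gs v x : norm2 B gs -> radical B v -> C (P gs x) (iota v) = C x (iota v).
Proof.
move=> nn rv; rewrite -{1}(P_fix gs rv) rp_iso //.
exact: (norm2_morph iota_iso).
Qed.

(** Two products of reflections that agree on [V] differ on the cover by a
    transvection in the plane of [a] and [b]: the difference vanishes on [V]
    and, since both are isometries, takes values orthogonal to [V], hence in
    this plane; being isometric on [a'] and [b'] leaves one parameter. *)
Lemma agree_V gs es : norm2 B gs -> norm2 B es ->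
  (forall v, rp B gs v = rp B es v) ->
  exists k, forall x, P gs x = P es x +
    k *: (C (iota b) x *: iota a - C (iota a) x *: iota b).
Proof.
move=> ng ne agree.
have nG : norm2 C [seq iota g | g <- gs] by apply: (norm2_morph iota_iso).
have nE : norm2 C [seq iota g | g <- es] by apply: (norm2_morph iota_iso).
pose d x := P gs x - P es x.
have dV v : d (iota v) = 0 by rewrite /d !rpi agree subrr.
have dlin x y p : d (x + p *: y) = d x + p *: d y.
  by rewrite /d !rpD !rpZ scalerBr opprD addrACA.
have dE x : exists p q, d x = iota (p *: a + q *: b).
  apply: perpV => v.
  have -> : v = rp B es (rp B (rev es) v) by rewrite rp_revK.
  set w := rp B (rev es) v.
  rewrite symBl -{1}agree -!rpi !rp_iso //.
  by rewrite subrr.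
have dC x y : C (d x) (P es y) + C (P es x) (d y) + C (d x) (d y) = 0.
  have : C (P gs x) (P gs y) = C (P es x) (P es y) by rewrite !rp_iso.
  have -> z : P gs z = P es z + d z by rewrite /d addrC subrK.
  by rewrite !symE; lra.
have [p [q da]] := dE a'; have [r [s db]] := dE b'.
have rd u v : radical B (u *: a + v *: b).
  by apply: radicalD; apply: radicalZ.
have dd u v w z : C (iota (u *: a + v *: b)) (iota (w *: a + z *: b)) = 0.
  by rewrite iota_iso rd.
have Ed x u v : C (P es x) (iota (u *: a + v *: b)) = u * C x (iota a) + v * C x (iota b).
  by rewrite C_P_rad // linearD !iotaZ !symE.
have := dC a' a'; have := dC b' b'; have := dC a' b'.
rewrite da db !dd !addr0 !(symC C (iota _) (P es _)) !Ed a'a a'b b'a b'b.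
move=> h1 h2 h3.
have p0 : p = 0 by lra.
have s0 : s = 0 by lra.
have qr : q = - r by lra.
exists r => x; have [v [u [w ->]]] := decW x.
rewrite -[LHS](subrK (P es (iota v + u *: a' + w *: b'))) addrC; congr (_ + _).
have -> : C (iota b) (iota v + u *: a' + w *: b') = w.
  by rewrite !symE iota_iso rad_b ba' bb'; ring.
have -> : C (iota a) (iota v + u *: a' + w *: b') = u.
  by rewrite !symE iota_iso rad_a aa' ab'; ring.
rewrite -/(d _) !dlin dV da db p0 s0 qr !scale0r !add0r addr0 !iotaZ.
by rewrite scalerBr !scalerA mulrN scaleNr addrC (mulrC w) (mulrC u).
Qed.

Section Lattice.
Variables (es0 : seq V) (et : V) (ys0 : seq R) (m : R).
Notation es := (es0 ++ [:: et; et + a]).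
Notation L := (zspan [set g | g \in es]).
Hypothesis X : coxeter_data B C iota a b b' es0 et ys0 m.

Let es_norm := xd_norm X.
Let es_free := xd_free X.
Let es_full := xd_full X.
Let es_int := xd_int X.
Let size_ys0 := xd_size X.
Let ys0_int := xd_ys0 X.
Let m_int := xd_m X.
Let bE := xd_b X.
Let b_prim := xd_b_prim X.
Let a_prim := xd_a_prim X.
Let b'_int := xd_b' X.

Let in_es g : g \in es -> L g.
Proof. by move=> ge; apply: zspan_id. Qed.

Lemma L_b : L b.
Proof.
have -> : L b = L (comb ys0 es0 + m *: et) by rewrite bE.
apply: zspanD.
  have := comb_zspan es0 ys0_int; apply: zspan_sub => g /= ge.
  by apply: in_es; rewrite mem_cat ge.
have /intrP[k ->] := m_int; rewrite scaler_int; apply/zspanMz/in_es.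
by rewrite mem_cat !inE eqxx orbT.
Qed.

Lemma zspan_iota_ex gs w : zspan [set g | g \in [seq iota g | g <- gs]] w ->
  exists2 u, zspan [set g | g \in gs] u & w = iota u.
Proof.
move: w; apply: zspan_ind.
- by exists 0; rewrite ?linear0 //; apply: zspan0.
- move=> _ _ [u Zu ->] [w Zw ->]; exists (u - w); rewrite ?linearB //.
  exact: zspanB.
- by move=> _ /= /mapP[g gg ->]; exists g => //; apply: zspan_id.
Qed.

Lemma rp_iota_zspan gs x : (forall g, g \in gs -> L g) ->
  (forall w, L w -> C (iota w) x \is a Num.int) ->
  exists2 u, zspan [set g | g \in gs] u & x - P gs x = iota u.
Proof.
move=> Lg xint; apply: zspan_iota_ex; apply: (rp_zspan (S := [set iota g | g in L])).
- by move=> _ _ [g Lg' <-] [h Lh <-]; rewrite iota_iso es_int.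
- by move=> _ /mapP[g gg ->]; exists g => //; apply: Lg.
- by move=> _ /mapP[g gg ->]; apply/xint/Lg.
Qed.

(** The products with the basis [gs] prescribed by [solution] are integral, and
    some vector of the cover has them. *)
Lemma solve_lattice gs v : norm2 B gs -> free gs -> (forall g, g \in gs -> L g) ->
  zspan [set g | g \in gs] v -> exists2 x,
    (forall w, zspan [set g | g \in gs] w -> C (iota w) x \is a Num.int)
    & x - P gs x = iota v.
Proof.
move=> ng fg Lg /zspan_comb[ys [sy iy ->]].
have [x Hx] := dual (solution B ys gs) fg.
exists x.
  apply: zspan_ind => [|u w hu hw|g /= gg].
  - by rewrite linear0 sym0l rpred0.
  - by rewrite linearB symBl rpredB.
  - rewrite -(nth_index 0 gg) Hx ?index_mem //.
    apply: (solution_int es_int Lg iy); apply: mem_nth.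
    by rewrite size_solution // index_mem.
rewrite -comb_iota; apply: solutionP; rewrite ?size_map // => i lt.
by rewrite solution_iota (nth_map 0) // Hx.
Qed.

(** A factorization of the Coxeter transformation of the cover generates the
    whole lattice: [1 - P es] maps the vectors with integral products onto the
    lattice [L], while [1 - P gs] maps them into the span of [gs]. *)
Lemma cover_lattice gs : (forall g, g \in gs -> L g) ->
  (forall x, P gs x = P es x) -> forall v, L v -> zspan [set g | g \in gs] v.
Proof.
move=> Lg agree v Lv.
have [x xint xv] := solve_lattice es_norm es_free in_es Lv.
have [u Zu] := rp_iota_zspan Lg xint.
by rewrite agree xv => /iota_inj ->.
Qed.

Lemma bE' : b = comb (ys0 ++ [:: m; 0]) es.
Proof.
rewrite comb_cat // !comb_cons scale0r add0r bE; congr (_ + _).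
by rewrite /comb big_nil addr0.
Qed.

(** The preimage [x] of [b] under [1 - P es]. It is orthogonal to [b] because
    [P es] is an isometry, and its products with the last two roots, read off
    from [solution], are [m] and 0; their difference is the product with [a]. *)
Lemma solve_b : exists x, [/\ forall w, L w -> C (iota w) x \is a Num.int,
  x - P es x = iota b, C (iota b) x = 0 & C (iota a) x = - m].
Proof.
have [x Hx] := dual (solution B (ys0 ++ [:: m; 0]) es) es_free.
have szy : size (ys0 ++ [:: m; 0]) = size es by rewrite !size_cat size_ys0.
have int_y : all_int (ys0 ++ [:: m; 0]).
  move=> y; rewrite mem_cat !inE => /orP[/ys0_int//|/orP[]/eqP-> //].
have xint w : L w -> C (iota w) x \is a Num.int.
  move: w; apply: zspan_ind => [|u w hu hw|g /= gg].
  - by rewrite linear0 sym0l rpred0.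
  - by rewrite linearB symBl rpredB.
  - rewrite -(nth_index 0 gg) Hx ?index_mem //.
    apply: (solution_int es_int in_es int_y); apply: mem_nth.
    by rewrite size_solution // index_mem.
have xb : x - P es x = iota b.
  rewrite bE' -comb_iota; apply: solutionP; rewrite ?size_map // => i lt.
  by rewrite solution_iota (nth_map 0) // Hx.
exists x; split=> //.
  have := rp_iso x x (norm2_morph iota_iso es_norm).
  have -> : P es x = x - iota b by rewrite -xb subKr.
  rewrite !symE iota_iso rad_b (symC C x); lra.
have solE : exists2 s, size s = size es0 & solution B (ys0 ++ [:: m; 0]) es = s ++ [:: m; 0].
  elim: ys0 es0 size_ys0 => [|y ys IH] [|e gs] //= => [_|[/IH[s ss ->]]].
    exists [::] => //.
    by rewrite comb_cons scale0r add0r /comb big_nil !sym0r !addr0.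
  by eexists (_ :: s); rewrite //= ss.
have [s ss se] := solE.
have last2 k : (k < 2)%N -> C (iota [:: et; et + a]`_k) x = [:: m; 0]`_k.
  move=> k2; have := Hx (size es0 + k)%N.
  have lt : (size es0 + k < size es0)%N = false by rewrite ltnNge leq_addr.
  by rewrite se !nth_cat ss lt addKn size_cat ltn_add2l; apply.
have h1 : C (iota et) x = m by apply: (last2 0%N).
have h2 : C (iota (et + a)) x = 0 by apply: (last2 1%N).
by move: h2; rewrite linearD symDl h1; lra.
Qed.

Lemma b'_int_L w : L w -> C (iota w) b' \is a Num.int.
Proof.
move: w; apply: zspan_ind => [|u w hu hw|]; last exact: b'_int.
- by rewrite linear0 sym0l rpred0.
- by rewrite linearB symBl rpredB.
Qed.

(** The parameter [k] of [agree_V] is seen in the image of [b'], which changes by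
    [k *: a]; this vector lies in the lattice, where [a] is primitive. *)
Lemma agree_int gs : norm2 B gs -> (forall g, g \in gs -> L g) ->
  (forall v, rp B gs v = rp B es v) ->
  exists2 k, k \is a Num.int & forall x, P gs x = P es x +
    k *: (C (iota b) x *: iota a - C (iota a) x *: iota b).
Proof.
move=> ng Lg /(agree_V ng es_norm)[k Hk]; exists k => //.
have [u Zu ue] := rp_iota_zspan Lg b'_int_L.
have [w Zw we] := rp_iota_zspan in_es b'_int_L.
apply: a_prim; have -> : k *: a = w - u.
  apply: iota_inj; rewrite linearB -ue -we Hk bb' ab' scale1r scale0r subr0.
  by rewrite iotaZ opprB !addrA subrK addrAC subrr add0r.
apply: zspanB => //; move: Zu; apply: zspan_sub => g /=; exact: Lg.
Qed.

Lemma solve_real v : exists x, x - P es x = iota v.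
Proof.
have [ys sy ->] : exists2 ys, size ys = size es & v = comb ys es.
  by apply: span_comb; rewrite es_full memvf.
have [x Hx] := dual (solution B ys es) es_free.
exists x; rewrite -comb_iota; apply: solutionP; rewrite ?size_map // => i lt.
by rewrite solution_iota (nth_map 0) // Hx.
Qed.

(** A factorization of the Coxeter transformation of [V] has full length. The
    vectors that [1 - P es] maps to [a] and [b] are mapped by [1 - P gs] to
    their multiples with the factor [1 - k m], which is not 0; so the image of
    [1 - P gs], contained in the span of [gs], is all of [V]. *)
Lemma agree_size gs : norm2 B gs -> (forall g, g \in gs -> L g) ->
  (forall v, rp B gs v = rp B es v) -> 2 <= m -> (size es <= size gs)%N.
Proof.
move=> ng Lg agree m2.
have [k kint Hk] := agree_int ng Lg agree.
have nz : 1 - k * m != 0.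
  rewrite subr_eq0; apply/eqP => km.
  have k0 : k != 0 by apply: contra_eq_neq km => ->; rewrite mul0r oner_eq0.
  have /= := norm_intr_ge1 kint k0; move: km.
  by case: (ger0P k) => ? km k1; nra.
have [x0 [_ x0E bx0 ax0]] := solve_b.
have [x1 x1E] := solve_real a.
have nE := norm2_morph iota_iso es_norm.
have ax1 : C (iota a) x1 = 0.
  have := rp_iso x1 x1 nE.
  have -> : P es x1 = x1 - iota a by rewrite -x1E subKr.
  rewrite !symE iota_iso rad_a (symC C x1 (iota a)); lra.
have bx1 : C (iota b) x1 = m.
  have := rp_iso x1 x0 nE.
  have -> : P es x1 = x1 - iota a by rewrite -x1E subKr.
  have -> : P es x0 = x0 - iota b by rewrite -x0E subKr.
  rewrite !symE iota_iso rad_a (symC C x1 (iota b)) ax0; lra.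
pose D x := x - P gs x.
have Dlin x c y : D (x + c *: y) = D x + c *: D y.
  by rewrite /D rpD rpZ scalerBr opprD addrACA.
have DE x : D x = (x - P es x) - k *: (C (iota b) x *: iota a - C (iota a) x *: iota b).
  by rewrite /D Hk opprD addrA.
have D1 : D x1 = (1 - k * m) *: iota a.
  by rewrite DE x1E ax1 bx1 scale0r subr0 scalerA scalerBl scale1r.
have D0 : D x0 = (1 - k * m) *: iota b.
  by rewrite DE x0E ax0 bx0 scale0r sub0r scaleNr opprK scalerA scalerBl scale1r.
have full : (fullv <= <<gs>>)%VS.
  apply/subvP => v _; have [x xE] := solve_real v.
  (* Multiples of [x1] and [x0] cancel the components along [a] and [b]. *)
  pose p := k * C (iota b) x / (1 - k * m); pose q := - (k * C (iota a) x) / (1 - k * m).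
  have [ys _ yE] := rp_comb C [seq iota g | g <- gs] (x + p *: x1 + q *: x0).
  suff /iota_inj-> : iota v = iota (comb ys gs) by apply: comb_span.
  rewrite -comb_iota -yE -/(D _) !Dlin DE D1 D0 xE !scalerA !divfK //.
  by rewrite scalerBr !scalerA scaleNr opprB !addrA subrK addrK.
have := dimvS full; rewrite -es_full => dimle.
have : \dim <<es>> = size es by apply/eqP.
by move=> <-; apply: leq_trans dimle (dim_span _).
Qed.

(** If [gs] is moreover a basis of the lattice, then [b] has an integral preimage
    [x2] under [1 - P gs]. The vector [x0] of [solve_b] is mapped to
    [(1 - k m) b], so [x0 - (1 - k m) x2] is fixed by [P gs], hence orthogonal
    to [V] and fixed by [P es]. Therefore [b] is [1 - k m] times the vector
    [(1 - P es) x2] of the lattice, in which it is primitive. *)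
Lemma agree_generating gs : norm2 B gs -> (forall g, g \in gs -> L g) ->
  (forall v, rp B gs v = rp B es v) -> free gs ->
  (forall v, L v -> zspan [set g | g \in gs] v) ->
  exists k, [/\ k \is a Num.int, 1 - k * m = 1 \/ 1 - k * m = -1 &
    forall x, P gs x = P es x +
      k *: (C (iota b) x *: iota a - C (iota a) x *: iota b)].
Proof.
move=> ng Lg agree fg Lsub.
have [k kint Hk] := agree_int ng Lg agree.
exists k; split=> //.
have [x0 [x0int x0E bx0 ax0]] := solve_b.
have [x2 x2int x2E] := solve_lattice ng fg Lg (Lsub _ L_b).
have D0 : x0 - P gs x0 = (1 - k * m) *: iota b.
  rewrite Hk opprD addrA x0E ax0 bx0 scale0r sub0r scaleNr opprK.
  by rewrite scalerA scalerBl scale1r.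
pose y := x0 - (1 - k * m) *: x2.
have yfix : P gs y = y.
  apply/esym/eqP; rewrite -subr_eq0.
  have -> : y - P gs y = (x0 - P gs x0) - (1 - k * m) *: (x2 - P gs x2).
    by rewrite /y rpB rpZ scalerBr !opprD !opprK addrACA.
  by rewrite D0 x2E subrr.
have yperp v : C (iota v) y = 0.
  have : v \in <<gs>>%VS.
    have : v \in <<es>>%VS by rewrite es_full memvf.
    apply/subvP: v; apply/span_subvP => e /in_es /Lsub; move: e.
    apply: zspan_ind; [exact: mem0v | by move=> *; rewrite memvB|].
    by move=> g /= gg; apply: memv_span.
  case/span_comb => ys _ ->.
  have fi : free [seq iota g | g <- gs].
    have -> : [seq iota g | g <- gs] = [seq linfun iota g | g <- gs].
      by apply: eq_map => g; rewrite lfunE.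
    have k0 : lker (linfun iota) = 0%VS.
      by apply/eqP/lker0P => u w; rewrite !lfunE; apply: iota_inj.
    rewrite /free size_map -limg_span limg_dim_eq ?k0 ?capv0 //.
  have Hf := rp_fixed fi yfix.
  rewrite -comb_iota; elim: [seq _ | _ <- _] ys Hf => [|g hs IH] [|c ys] Hf;
    try by rewrite /comb ?big_nil sym0l.
  rewrite comb_cons symDl symZl Hf ?mem_head // mulr0 add0r; apply: IH => h hg; apply: Hf.
  by rewrite inE hg orbT.
have yfixe : P es y = y.
  by apply: rp_fix => _ /mapP[g _ ->].
have [z Lz zE] := rp_iota_zspan in_es (fun w Lw => x2int w (Lsub w Lw)).
apply: (@b_prim _ z) => //; first by rewrite rpredB ?rpredM ?rpred1.
apply: iota_inj; rewrite iotaZ -zE -x0E.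
have -> : x0 = y + (1 - k * m) *: x2 by rewrite /y subrK.
by rewrite rpD rpZ yfixe opprD addrACA subrr add0r scalerBr.
Qed.

End Lattice.
End Cover.

(** * Systems of generators of a lattice of roots *)

Section LatticeGenerators.
Variables (R : realType) (V : vectType R) (B : {symmetric V}).
Hypothesis psd : forall x, 0 <= B x x.
Hypothesis psd0 : forall x, B x x = 0 -> radical B x.
Variable G : set V.
Hypothesis G_norm : forall g, G g -> B g g = 2.
Hypothesis G_int : forall g h, G g -> G h -> B g h \is a Num.int.

Lemma zspan_even x : zspan G x -> B x x / 2 \is a Num.int.
Proof.
suff H : zspan G x -> zspan G x /\ B x x / 2 \is a Num.int by move=> /H[].
move: x; apply: zspan_ind => [|x y [Zx hx] [Zy hy]|g Gg].
- by split; [apply: zspan0 | rewrite sym0l mul0r rpred0].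
- split; first exact: zspanB.
  have -> : B (x - y) (x - y) / 2 = B x x / 2 + B y y / 2 - B x y.
    by rewrite !symE (symC B y x); field.
  by rewrite rpredB ?rpredD // (zspan_int G_int).
- by split; [apply: zspan_id | rewrite G_norm // mulfV ?rpred1 // pnatr_eq0].
Qed.

(** Products of roots other than 1 and -1 are even, so without adjacent
    generators all products in the lattice would be even. *)
Lemma adj_generators x y : zspan G x -> zspan G y -> adj B x y ->
  exists g h, [/\ G g, G h & adj B g h].
Proof.
move=> Zx Zy xy; apply: contrapT => none.
have ev g h : G g -> G h -> B g h / 2 \is a Num.int.
  move=> Gg Gh.
  case: (root_productP psd psd0 (G_norm Gg) (G_norm Gh) (G_int Gg Gh)) => [->|e|-> _|-> _].
  - by rewrite mul0r rpred0.
  - by case: none; exists g, h.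
  - by rewrite mulfV ?rpred1 // pnatr_eq0.
  - by rewrite mulNr mulfV ?pnatr_eq0 // rpredN rpred1.
have : B x y / 2 \is a Num.int.
  move: y Zy {xy}; apply: zspan_ind => [|y z hy hz|h Gh].
  - by rewrite sym0r mul0r rpred0.
  - by rewrite symBr mulrBl rpredB.
  - move: x Zx; apply: zspan_ind => [|x y hx hy|g Gg].
    + by rewrite sym0l mul0r rpred0.
    + by rewrite symBl mulrBl rpredB.
    + exact: ev.
move=> /intrP[k kE]; have E : B x y = (k * 2)%:~R.
  by rewrite intrM -kE divfK // pnatr_eq0.
by case: xy; rewrite E; [rewrite -[1]/(1%:~R)|rewrite -[-1]/((-1)%:~R)];
  move=> /eqP; rewrite eqr_int; move: k {kE E} => k; lia.
Qed.

(** Suppose that the generators split into two orthogonal parts. A root [e] of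
    the connected system [E] is then [x + y] with [x] and [y] in the spans of
    the parts, both of even square length, so one of them is radical. By
    connectedness the same part is radical for all [e], and the generators in
    this part are orthogonal to [E], hence radical, which is absurd. *)
Lemma connected_generators (E : set V) : connected_set B E ->
  (forall e, E e -> B e e = 2) -> (forall e, E e -> zspan G e) ->
  (forall x, (forall e, E e -> B x e = 0) -> radical B x) ->
  connected_set B G.
Proof.
move=> conn E2 EG Espan P [g0 Gg0 Pg0] Pstep h0 Gh0; apply: contrapT => nP.
have orth g h : G g -> G h -> P g -> ~ P h -> B g h = 0.
  by move=> Gg Gh Pg nPh; apply/eqP/negPn/negP => gh; apply/nPh/(Pstep g).
have zorth x y : zspan (G `&` P) x -> zspan (G `&` ~` P) y -> B x y = 0.
  move=> Zx; move: y; apply: zspan_ind => [|y z hy hz|h [Gh nPh]].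
  - by rewrite sym0r.
  - by rewrite symBr hy hz subr0.
  - move: x Zx; apply: zspan_ind => [|x y hx hy|g [Gg Pg]].
    + by rewrite sym0l.
    + by rewrite symBl hx hy subr0.
    + exact: orth.
have split e : zspan G e -> exists x y,
    [/\ e = x + y, zspan (G `&` P) x & zspan (G `&` ~` P) y].
  move: e; apply: zspan_ind.
  - by exists 0, 0; rewrite addr0; split=> //; apply: zspan0.
  - move=> _ _ [x [y [-> Zx Zy]]] [z [w [-> Zz Zw]]].
    exists (x - z), (y - w); split; [by rewrite opprD addrACA | exact: zspanB..].
  - move=> g Gg; have [Pg|nPg] := pselect (P g).
      exists g, 0; rewrite addr0; split=> //; last exact: zspan0.
      by apply: zspan_id.
    by exists 0, g; rewrite add0r; split=> //; [apply: zspan0 | apply: zspan_id].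
have sub1 x : zspan (G `&` P) x -> zspan G x.
  by apply: zspan_sub => g [Gg _]; apply: zspan_id.
have sub2 x : zspan (G `&` ~` P) x -> zspan G x.
  by apply: zspan_sub => g [Gg _]; apply: zspan_id.
(* The roots of [E] whose component in the second, respectively the first part
   of the generators is radical. *)
pose X := [set e | exists x y, [/\ e = x + y, zspan (G `&` P) x,
   zspan (G `&` ~` P) y & radical B y]].
pose Y := [set e | exists x y, [/\ e = x + y, zspan (G `&` P) x,
   zspan (G `&` ~` P) y & radical B x]].
have XY e : E e -> X e \/ Y e.
  move=> Ee; have [x [y [exy Zx Zy]]] := split e (EG e Ee).
  have := E2 e Ee; rewrite exy !symE (symC B y x) (zorth x y Zx Zy) !(addr0, add0r) => s.
  have [/eqP y0|yn] := boolP (B y y == 0).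
    by left; exists x, y; split=> //; apply: psd0.
  right; exists x, y; split=> //; apply: psd0.
  have := psd x; have := psd y; move: s yn.
  have /intrP[k kE] := zspan_even (sub1 _ Zx).
  have /intrP[l lE] := zspan_even (sub2 _ Zy).
  have -> : B x x = (2 * k)%:~R by rewrite intrM -kE mulrCA mulfV ?mulr1 // pnatr_eq0.
  have -> : B y y = (2 * l)%:~R by rewrite intrM -lE mulrCA mulfV ?mulr1 // pnatr_eq0.
  rewrite (_ : 2 = 2%:~R :> R) // -intrD => /eqP; rewrite eqr_int => /eqP s.
  rewrite intr_eq0 !ler0z => yn y0 x0.
  by rewrite (_ : k = 0) ?mulr0 //; move: s yn y0 x0; clear; lia.
have n2 : 2 <> 0 :> R by apply/eqP; rewrite pnatr_eq0.
have [allX|/existsNP[e1 /not_implyP[Ee1 nX1]]] := pselect (forall e, E e -> X e).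
  apply: n2; rewrite -(G_norm Gh0).
  suff H : radical B h0 by apply: H.
  apply: Espan => e /allX[x [y [-> Zx Zy ry]]].
  rewrite symDr (radicalr _ ry) addr0 symC; apply: zorth => //.
  by apply: zspan_id.
have allnX e : E e -> ~ X e.
  move=> Ee Xe; apply: nX1; move: e1 Ee1; apply: conn; first by exists e.
  move=> g h Eg Eh [x [y [gE Zx Zy ry]]] gh; case: (XY h Eh) => // -[z [w [hE Zz Zw rz]]].
  move: gh; rewrite gE hE !symE !ry (radicalr _ rz).
  by rewrite (zorth x w Zx Zw) !addr0 eqxx.
apply: n2; rewrite -(G_norm Gg0).
suff H : radical B g0 by apply: H.
apply: Espan => e Ee; case: (XY e Ee) => [/(allnX _ Ee)//|[x [y [-> Zx Zy rx]]]].
rewrite symDr (radicalr _ rx) add0r; apply: zorth => //.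
by apply: zspan_id.
Qed.

End LatticeGenerators.

(** * The root lattice of the elliptic root system *)

(** The choices of [U], [a], the model [Q] of [V / U] and the preimages [alpha]
    of an affine root basis are made once and used together throughout. *)
Record affine_data (R : realType) (V Q : vectType R) (B : {symmetric V})
    (BQ : {symmetric Q}) (n : nat) (Phi : set V) (U : {vspace V}) (a : V)
    (pi : 'Hom(V, Q)) (beta : 'I_n.+1 -> Q) (m : 'I_n.+1 -> nat)
    (alpha : 'I_n.+1 -> V) : Prop := AffineData {
  ad_grs : gen_root_system B {: V} Phi;
  ad_norm : forall x, Phi x -> B x x = 2;
  ad_Urad : forall v, v \in U -> radical B v;
  ad_Urat : exists2 v, v \in U & v != 0 /\ zspan Phi v;
  ad_gen : zspan Phi `&` [set v | v \in U] = zspan [set a];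
  ad_quo : is_quotient B U BQ pi;
  ad_basis : affine_root_basis B Phi BQ pi beta m;
  ad_Phi : forall i, Phi (alpha i);
  ad_beta : forall i, pi (alpha i) = beta i
}.

Section EllipticLattice.
Variables (R : realType) (V Q : vectType R) (B : {symmetric V}) (BQ : {symmetric Q}).
Variables (n : nat) (Phi : set V) (U : {vspace V}) (a : V) (pi : 'Hom(V, Q)).
Variables (beta : 'I_n.+1 -> Q) (m : 'I_n.+1 -> nat) (alpha : 'I_n.+1 -> V).
Hypothesis D : affine_data B BQ Phi U a pi beta m alpha.

Let grs := ad_grs D.
Let Phi_norm := ad_norm D.
Let U_rad := ad_Urad D.
Let U_rat := ad_Urat D.
Let a_gen := ad_gen D.
Let Q_quo := ad_quo D.
Let beta_basis := ad_basis D.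
Let alpha_Phi := ad_Phi D.
Let alpha_beta := ad_beta D.

Notation b := (\sum_i alpha i *+ m i).
Notation Vfin := (span_of (finite_part alpha)).

Lemma Phi_int x y : Phi x -> Phi y -> B x y \is a Num.int.
Proof.
move=> Px Py; have := grs_int grs Px Py; rewrite (Phi_norm Py).
by rewrite mulrAC mulfV ?mul1r // pnatr_eq0.
Qed.

Lemma Phi_refl x y : Phi x -> Phi y -> Phi (rs B x y).
Proof. by move=> Px Py; rewrite -reflect_rs ?Phi_norm //; apply: (grs_reflect grs). Qed.

Lemma zspan1 (v x : V) : zspan [set v] x -> exists d : int, x = v *~ d.
Proof.
move: x; apply: zspan_ind => [|_ _ [d ->] [e ->]|_ ->].
- by exists 0.
- by exists (d - e); rewrite mulrzBr.
- by exists 1.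
Qed.

Lemma a_U : a \in U /\ zspan Phi a.
Proof.
have : zspan [set a] a by apply: zspan_id.
by rewrite -a_gen => -[].
Qed.

Lemma rad_a : radical B a.
Proof. by apply: U_rad; have [] := a_U. Qed.

Lemma a_neq0 : a != 0.
Proof.
have [v vU [v0 Zv]] := U_rat.
have : zspan [set a] v by rewrite -a_gen.
by move=> /zspan1[d vE]; apply: contra_neq v0 => a0; rewrite vE a0 mul0rz.
Qed.

Lemma pi_a : pi a = 0.
Proof.
have [aU _] := a_U; have [kE _ _] := Q_quo.
by move: aU; rewrite -kE memv_ker => /eqP.
Qed.

Lemma m_gt0 i : (0 < m i)%N.
Proof. by have [_ _ _ [_ ->] _] := beta_basis. Qed.

Lemma m0 : m ord0 = 1%N.
Proof. by have [_ _ _ [-> _] _] := beta_basis. Qed.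

Lemma free_fun (W : vectType R) k (e : 'I_k -> W) : free [seq e i | i <- enum 'I_k] ->
  forall c : 'I_k -> R, \sum_i c i *: e i = 0 -> forall i, c i = 0.
Proof.
move=> fe c cE i.
have sz : size [seq e i | i <- enum 'I_k] == k by rewrite size_map size_enum_ord.
have /freeP := (fe : free (Tuple sz)); apply.
rewrite -[RHS]cE; apply: eq_bigr => j _; congr (_ *: _).
by rewrite (nth_map j) ?size_enum_ord //= nth_ord_enum.
Qed.

Lemma beta_coef (c : 'I_n.+1 -> R) : \sum_i c i *: beta i = 0 -> forall i, c i = 0.
Proof. by apply: free_fun; have [[_ + _] _ _ _ _] := beta_basis. Qed.

Lemma alpha_coef (c : 'I_n.+1 -> R) d :
  \sum_i c i *: alpha i + d *: a = 0 -> (forall i, c i = 0) /\ d = 0.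
Proof.
move=> E; have c0 : forall i, c i = 0.
  apply: beta_coef; have := congr1 pi E.
  rewrite linear0 linearD linearZ /= pi_a scaler0 addr0 linear_sum => E'.
  rewrite -[RHS]E'.
  by apply: eq_bigr => i _; rewrite linearZ /= alpha_beta.
split=> //; move: E; rewrite big1 => [|i _]; last by rewrite c0 scale0r.
by rewrite add0r => /eqP; rewrite scaler_eq0 (negPf a_neq0) orbF => /eqP.
Qed.

Lemma beta_dec x : Phi x ->
  exists c : 'I_n.+1 -> int, pi x = \sum_i beta i *~ c i.
Proof.
move=> Px; have [[_ _ H] _ _ _ _] := beta_basis.
have [c [->|->]] := H (pi x) (ex_intro2 _ _ x Px erefl).
  by exists (fun i => (c i)%:Z).
exists (fun i => - (c i)%:Z); rewrite -sumrN.
by apply: eq_bigr => i _; rewrite mulrNz.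
Qed.

Lemma Phi_dec x : Phi x ->
  exists (c : 'I_n.+1 -> int) (d : int), x = \sum_i alpha i *~ c i + a *~ d.
Proof.
move=> Px; have [c cE] := beta_dec Px; exists c.
have /zspan1[d dE] : zspan [set a] (x - \sum_i alpha i *~ c i).
  rewrite -a_gen; split.
    apply: zspanB; first exact: zspan_id.
    by apply: zspan_sum => i _; apply/zspanMz/zspan_id.
  have [<- _ _] := Q_quo; rewrite /= memv_ker linearB /= cE linear_sum subr_eq0; apply/eqP.
  by apply: eq_bigr => i _; rewrite raddfMz /= alpha_beta.
by exists d; rewrite -dE addrC subrK.
Qed.

Lemma zspan_dec x : zspan Phi x ->
  exists (c : 'I_n.+1 -> int) (d : int), x = \sum_i alpha i *~ c i + a *~ d.
Proof.
move: x; apply: zspan_ind.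
- by exists (fun=> 0), 0; rewrite big1 // addr0.
- move=> _ _ [c [d ->]] [c' [d' ->]]; exists (fun i => c i - c' i), (d - d').
  rewrite opprD addrACA -sumrB mulrzBr; congr (_ + _).
  by apply: eq_bigr => i _; rewrite mulrzBr.
- exact: Phi_dec.
Qed.

Lemma V_dec v : exists (c : 'I_n.+1 -> R) d, v = \sum_i c i *: alpha i + d *: a.
Proof.
have [_ Hmin] := grs_spans grs.
pose U' := (\sum_i <[alpha i]> + <[a]>)%VS.
have : v \in U'.
  apply: (subvP (Hmin U' _)); last exact: memvf.
  move=> x /Phi_dec[c [d ->]]; apply: memv_add; last first.
    by rewrite -scaler_int memvZ // memv_line.
  apply: memv_sumr => i _; by rewrite -scaler_int memvZ // memv_line.
move=> /memv_addP[u /memv_sumP[w wE ->] [_ /vlineP[d ->] ->]].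
have /choice[c cE] : forall i, exists k, w i = k *: alpha i.
  by move=> i; apply/vlineP/wE.
by exists c, d; congr (_ + _); apply: eq_bigr => i _.
Qed.

Lemma rad_b : radical B b.
Proof.
have [_ _ _ _ E] := beta_basis.
have : zspan [set \sum_i beta i *+ m i] (\sum_i beta i *+ m i) by apply: zspan_id.
rewrite -E => -[_ [r rr rE]].
have : b - r \in U.
  have [<- _ _] := Q_quo; rewrite memv_ker linearB /= rE linear_sum subr_eq0; apply/eqP.
  by apply: eq_bigr => i _; rewrite raddfMn /= alpha_beta.
by move=> /U_rad br; rewrite -(subrK r b); apply: radicalD.
Qed.

(** Distinct simple roots have non-positive products: otherwise the reflection
    of one in the other would have coefficients of both signs. *)
Lemma alpha_le0 i j : i != j -> B (alpha i) (alpha j) <= 0.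
Proof.
move=> ij; have /intrP[k kE] := Phi_int (alpha_Phi i) (alpha_Phi j).
rewrite kE lerz0 leNgt; apply/negP => k0.
have [[_ _ H] _ _ _ _] := beta_basis.
have [c cE] := H _ (ex_intro2 _ _ _ (Phi_refl (alpha_Phi i) (alpha_Phi j)) erefl).
have E : pi (rs B (alpha i) (alpha j)) = beta j - k%:~R *: beta i.
  by rewrite /rs linearB /= linearZ /= !alpha_beta kE.
rewrite {}E in cE.
have [s [ns sE]] : exists s : 'I_n.+1 -> int, ((forall l, 0 <= s l) \/ (forall l, s l <= 0)) /\
   beta j - k%:~R *: beta i = \sum_l (s l)%:~R *: beta l.
  case: cE => ->.
    exists (fun l => (c l)%:Z); split; first by left.
    by apply: eq_bigr => l _; rewrite scaler_nat.
  exists (fun l => - (c l)%:Z); split; first by right => l; rewrite oppr_le0.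
  by rewrite -sumrN; apply: eq_bigr => l _; rewrite intrN scaleNr scaler_nat.
pose e l : R := (l == j)%:R - k%:~R * (l == i)%:R - (s l)%:~R.
have e0 : forall l, e l = 0.
  apply: beta_coef; rewrite /e.
  under eq_bigr => l _ do rewrite scalerBl scalerBl.
  rewrite sumrB -sE sumrB.
  rewrite (bigD1 j) //= eqxx scale1r big1 => [|l /negPf ->]; last by rewrite scale0r.
  rewrite (bigD1 i) //= eqxx mulr1 big1 => [|l /negPf ->]; last by rewrite mulr0 scale0r.
  by rewrite !addr0 subrr.
have := e0 i; have := e0 j; rewrite /e !eqxx (negPf ij) eq_sym (negPf ij) mulr0 mulr1 !subr0 sub0r.
move=> /subr0_eq/eqP; rewrite -[1]/(1%:~R) eqr_int => /eqP sj.
move=> /subr0_eq/eqP; rewrite -intrN eqr_int => /eqP si.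
case: ns => [/(_ i)|/(_ j)]; rewrite -?si -?sj; move: k0; clear; lia.
Qed.

Lemma null_vector i : \sum_j B (alpha i) (alpha j) * (m j)%:R = 0.
Proof.
rewrite -[RHS](radicalr (alpha i) rad_b) sym_sumr; apply: eq_bigr => j _.
by rewrite -scaler_nat symZr mulrC.
Qed.

Hypothesis posdef : forall v, v \in Vfin -> 0 <= B v v /\ (B v v = 0 -> v = 0).

Lemma alpha_fin (i : 'I_n) : alpha (lift ord0 i) \in Vfin.
Proof. by rewrite memvE; apply: (sumv_sup i). Qed.

Lemma V_dec_fin v : exists f p q, f \in Vfin /\ v = f + p *: a + q *: b.
Proof.
have [c [d ->]] := V_dec v.
exists (\sum_(i < n) (c (lift ord0 i) - c ord0 * (m (lift ord0 i))%:R) *: alpha (lift ord0 i)), d, (c ord0).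
split; first by apply: rpred_sum => i _; rewrite memvZ // alpha_fin.
have -> : b = alpha ord0 + \sum_(i < n) alpha (lift ord0 i) *+ m (lift ord0 i).
  by rewrite big_ord_recl m0 mulr1n.
rewrite big_ord_recl [RHS]addrAC; congr (_ + _).
rewrite scalerDr addrCA; congr (_ + _).
rewrite scaler_sumr -big_split; apply: eq_bigr => i _ /=.
by rewrite scalerBl -scaler_nat scalerA subrK.
Qed.

Lemma B_fin f p q : B (f + p *: a + q *: b) (f + p *: a + q *: b) = B f f.
Proof.
by rewrite !symE !rad_a !rad_b !(radicalr _ rad_a) !(radicalr _ rad_b) !mulr0 !addr0.
Qed.

Lemma psd x : 0 <= B x x.
Proof. by have [f [p [q [/posdef[? _] ->]]]] := V_dec_fin x; rewrite B_fin. Qed.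

Lemma psd0_rad x : B x x = 0 -> exists p q, x = p *: a + q *: b.
Proof.
have [f [p [q [/posdef[_ f0] ->]]]] := V_dec_fin x; rewrite B_fin => /f0 ->.
by exists p, q; rewrite add0r.
Qed.

Lemma radE x : radical B x -> exists p q, x = p *: a + q *: b.
Proof. by move=> /(_ x); apply: psd0_rad. Qed.

Lemma psd0 x : B x x = 0 -> radical B x.
Proof.
move=> /psd0_rad[p [q ->]]; apply: radicalD; apply: radicalZ.
  exact: rad_a.
exact: rad_b.
Qed.

Lemma alpha_span x : (forall i, B x (alpha i) = 0) -> radical B x.
Proof.
move=> H y; have [c [d ->]] := V_dec y.
rewrite symDr symZr (radicalr _ rad_a) mulr0 addr0 sym_sumr big1 // => i _.
by rewrite symZr H mulr0.
Qed.

Lemma alpha_coef_sum (p : pred 'I_n.+1) :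
  \sum_(i | p i) alpha i *+ m i = 0 -> forall i, ~~ p i.
Proof.
move=> E i; apply/negP => pi0.
have [|c0 _] := @alpha_coef (fun i => if p i then (m i)%:R else 0) 0.
  rewrite scale0r addr0 -[RHS]E [RHS]big_mkcond; apply: eq_bigr => j _.
  by case: (p j); rewrite ?scaler_nat ?scale0r.
by have := c0 i; rewrite pi0 => /eqP; rewrite pnatr_eq0 gtn_eqF // m_gt0.
Qed.

(** A set of nodes orthogonal to its complement cuts [b] into two parts that are
    both orthogonal to all simple roots, hence radical. A part that avoids the
    affine node lies in the positive definite space and vanishes. *)
Lemma rad_partial (p : pred 'I_n.+1) : ~~ p ord0 ->
  (forall i j, p i -> ~~ p j -> B (alpha i) (alpha j) = 0) -> forall i, ~~ p i.
Proof.
move=> p0 orth; apply: alpha_coef_sum; set v := \sum_(i | _) _.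
have vfin : v \in Vfin.
  rewrite /v big_mkcond big_ord_recl (negPf p0) /= add0r; apply: rpred_sum => i _.
  case: (p _); last exact: mem0v.
  by rewrite -scaler_nat memvZ // alpha_fin.
have [_] := posdef vfin; apply.
suff : radical B v by move=> H; apply: H.
apply: alpha_span => j; have := rad_b (alpha j).
rewrite (bigID p) /= symDl -/v; case pj : (p j).
  rewrite [X in _ + X]sym_suml [X in _ + X]big1 ?addr0 // => i pi0.
  by rewrite -scaler_nat symZl symC orth ?mulr0.
move=> _; rewrite sym_suml big1 // => i pi0.
by rewrite -scaler_nat symZl orth ?mulr0 ?pj.
Qed.

Lemma alpha_connected : connected_set B [set alpha i | i in setT].
Proof.
move=> P [_ [i0 _ <-] Pi0] step _ [j0 _ <-]; apply: contrapT => nPj0.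
pose p i := `[< P (alpha i) >].
have orth i j : p i -> ~~ p j -> B (alpha i) (alpha j) = 0.
  move=> /asboolP Pi /asboolP nPj; apply/eqP/negPn/negP => ij.
  by apply: nPj; apply: step ij.
have [p0|p0] := boolP (p ord0); last first.
  by have /negP := rad_partial p0 orth i0; apply; apply/asboolP.
suff : ~~ ~~ p j0 by rewrite negbK => /asboolP.
apply: (@rad_partial (fun i => ~~ p i)); first by rewrite negbK.
by move=> i j ni; rewrite negbK => pj; rewrite symC; apply: orth.
Qed.

Hypothesis Phi_adj : exists x y, [/\ Phi x, Phi y & adj B x y].

Lemma alpha_adj : exists g h, [/\ [set alpha i | i in setT] g,
  [set alpha i | i in setT] h & adj B g h].
Proof.
have [x [y [Px Py xy]]] := Phi_adj.
have [c [d xE]] := Phi_dec Px; have [c' [d' yE]] := Phi_dec Py.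
apply: (@adj_generators _ _ B psd psd0 _ _ _ (\sum_i alpha i *~ c i) (\sum_i alpha i *~ c' i)).
- by move=> _ [i _ <-]; apply: Phi_norm.
- by move=> _ _ [i _ <-] [j _ <-]; apply: Phi_int.
- by apply: zspan_sum => i _; apply/zspanMz/zspan_id; exists i.
- by apply: zspan_sum => i _; apply/zspanMz/zspan_id; exists i.
- have rM e : radical B (a *~ e) by rewrite -scaler_int; apply: radicalZ; apply: rad_a.
  by move: xy; rewrite /adj xE yE symDl rM addr0 symDr (radicalr _ (rM _)) addr0.
Qed.

(** Membership in [Phi] is thereby a condition on the lattice and the form only;
    in particular [Phi] is stable under translation by [a]. *)
Lemma Phi_norm2 x : zspan Phi x -> B x x = 2 -> Phi x.
Proof.
apply: (@norm2_root _ _ B psd psd0 Phi [set alpha i | i in setT]).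
- exact: Phi_norm.
- exact: Phi_int.
- exact: Phi_refl.
- by move=> _ [i _ <-].
- exact: alpha_connected.
- move=> y H; apply: alpha_span => i; apply: H; by exists i.
- exact: alpha_adj.
Qed.

Lemma Phi_shift x : Phi x -> Phi (x + a).
Proof.
move=> Px; apply: Phi_norm2.
  by apply: zspanD; [apply: zspan_id|have [] := a_U].
by rewrite !symE !rad_a (radicalr _ rad_a) !addr0 Phi_norm.
Qed.

End EllipticLattice.

(** * Positive definiteness of the finite parts *)

Section DynkinForms.
Variable R : realType.

Definition form_E8 (x0 x1 x2 x3 x4 x5 x6 x7 : R) : R :=
  2 * (x0 ^+ 2 + x1 ^+ 2 + x2 ^+ 2 + x3 ^+ 2 + x4 ^+ 2 + x5 ^+ 2 + x6 ^+ 2 + x7 ^+ 2)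
  - 2 * (x0 * x2 + x2 * x3 + x3 * x4 + x4 * x5 + x1 * x3 + x5 * x6 + x6 * x7).

(** Completing squares along the three arms towards the branch vertex leaves
    it the coefficient [2 - 1/2 - 2/3 - 4/5 = 1/30]. *)
Lemma form_E8E x0 x1 x2 x3 x4 x5 x6 x7 : form_E8 x0 x1 x2 x3 x4 x5 x6 x7 =
  2 * (x1 - x3 / 2) ^+ 2 + 2 * (x0 - x2 / 2) ^+ 2 + 3 / 2 * (x2 - 2 / 3 * x3) ^+ 2
  + 2 * (x7 - x6 / 2) ^+ 2 + 3 / 2 * (x6 - 2 / 3 * x5) ^+ 2
  + 4 / 3 * (x5 - 3 / 4 * x4) ^+ 2 + 5 / 4 * (x4 - 4 / 5 * x3) ^+ 2
  + 1 / 30 * x3 ^+ 2.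
Proof. by rewrite /form_E8; field. Qed.

Lemma form_E8_pos x0 x1 x2 x3 x4 x5 x6 x7 :
  0 <= form_E8 x0 x1 x2 x3 x4 x5 x6 x7 /\
  (form_E8 x0 x1 x2 x3 x4 x5 x6 x7 = 0 ->
   [/\ x0 = 0, x1 = 0, x2 = 0 & x3 = 0] /\ [/\ x4 = 0, x5 = 0, x6 = 0 & x7 = 0]).
Proof.
rewrite form_E8E.
set y1 := x1 - _; set y0 := x0 - _; set y2 := x2 - _; set y7 := x7 - _.
set y6 := x6 - _; set y5 := x5 - _; set y4 := x4 - _.
have := (sqr_ge0 y0, sqr_ge0 y1, sqr_ge0 y2, sqr_ge0 x3,
         sqr_ge0 y4, sqr_ge0 y5, sqr_ge0 y6, sqr_ge0 y7).
move=> [[[[[[[h0 h1] h2] h3] h4] h5] h6] h7]; split; first by lra.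
move=> E.
have sq0 (y : R) : y ^+ 2 = 0 -> y = 0 by move=> /eqP; rewrite sqrf_eq0 => /eqP.
have /sq0 z3 : x3 ^+ 2 = 0 by lra.
have /sq0 : y1 ^+ 2 = 0 by lra. rewrite /y1 z3 => z1.
have /sq0 : y2 ^+ 2 = 0 by lra. rewrite /y2 z3 => z2.
have /sq0 : y4 ^+ 2 = 0 by lra. rewrite /y4 z3 => z4.
have /sq0 : y0 ^+ 2 = 0 by lra. rewrite /y0 => z0.
have /sq0 : y5 ^+ 2 = 0 by lra. rewrite /y5 => z5.
have /sq0 : y6 ^+ 2 = 0 by lra. rewrite /y6 => z6.
have /sq0 : y7 ^+ 2 = 0 by lra. rewrite /y7 => z7.
by split; split=> //; lra.
Qed.

Lemma form_D4_pos (x0 x1 x2 x3 : R) :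
  let q := 2 * (x0 ^+ 2 + x1 ^+ 2 + x2 ^+ 2 + x3 ^+ 2)
    - 2 * (x0 * x1 + x1 * x2 + x1 * x3) in
  0 <= q /\ (q = 0 -> [/\ x0 = 0, x1 = 0, x2 = 0 & x3 = 0]).
Proof.
move=> q; have -> : q = 2 * (x0 - x1 / 2) ^+ 2 + 2 * (x2 - x1 / 2) ^+ 2
  + 2 * (x3 - x1 / 2) ^+ 2 + 1 / 2 * x1 ^+ 2 by rewrite /q; field.
set y0 := x0 - _; set y2 := x2 - _; set y3 := x3 - _.
have := (sqr_ge0 y0, sqr_ge0 x1, sqr_ge0 y2, sqr_ge0 y3).
move=> [[[h0 h1] h2] h3]; split; first by lra.
move=> E.
have sq0 (y : R) : y ^+ 2 = 0 -> y = 0 by move=> /eqP; rewrite sqrf_eq0 => /eqP.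
have /sq0 z1 : x1 ^+ 2 = 0 by lra.
have /sq0 : y0 ^+ 2 = 0 by lra. rewrite /y0 z1 => z0.
have /sq0 : y2 ^+ 2 = 0 by lra. rewrite /y2 z1 => z2.
have /sq0 : y3 ^+ 2 = 0 by lra. rewrite /y3 z1 => z3.
by split=> //; lra.
Qed.

Definition cartan_form k (edges : seq (nat * nat)) (x : 'I_k -> R) : R :=
  \sum_i \sum_j x i * x j * (cartan_entry edges i j)%:~R.

Definition cartan_posdef k (edges : seq (nat * nat)) : Prop :=
  forall x : 'I_k -> R, 0 <= cartan_form edges x /\
    (cartan_form edges x = 0 -> forall i, x i = 0).

Lemma ord_recl_all k (P : 'I_k.+1 -> Prop) :
  P ord0 -> (forall i, P (lift ord0 i)) -> forall i, P i.
Proof. by move=> P0 PS i; case: (unliftP ord0 i) => [j ->|->]. Qed.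

Notation up := (lift ord0).

(** The forms of types E6 and E7 are restrictions of the form of type E8. *)
Lemma posdef_E6 : cartan_posdef 6 edges_E6.
Proof.
move=> x.
have := form_E8_pos (x ord0) (x (up ord0)) (x (up (up ord0))) (x (up (up (up ord0))))
  (x (up (up (up (up ord0))))) (x (up (up (up (up (up ord0)))))) 0 0.
rewrite (_ : form_E8 _ _ _ _ _ _ _ _ = cartan_form edges_E6 x).
  move=> [q0 qz]; split=> // /qz[[? ? ? ?] [? ? _ _]].
  by do 6!(apply: ord_recl_all => //); case.
rewrite /form_E8 /cartan_form !big_ord_recl !big_ord0 /cartan_entry /=; ring.
Qed.

Lemma posdef_E7 : cartan_posdef 7 edges_E7.
Proof.
move=> x.
have := form_E8_pos (x ord0) (x (up ord0)) (x (up (up ord0))) (x (up (up (up ord0))))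
  (x (up (up (up (up ord0))))) (x (up (up (up (up (up ord0))))))
  (x (up (up (up (up (up (up ord0))))))) 0.
rewrite (_ : form_E8 _ _ _ _ _ _ _ _ = cartan_form edges_E7 x).
  move=> [q0 qz]; split=> // /qz[[? ? ? ?] [? ? ? _]].
  by do 7!(apply: ord_recl_all => //); case.
rewrite /form_E8 /cartan_form !big_ord_recl !big_ord0 /cartan_entry /=; ring.
Qed.

Lemma posdef_E8 : cartan_posdef 8 edges_E8.
Proof.
move=> x.
have := form_E8_pos (x ord0) (x (up ord0)) (x (up (up ord0))) (x (up (up (up ord0))))
  (x (up (up (up (up ord0))))) (x (up (up (up (up (up ord0))))))
  (x (up (up (up (up (up (up ord0))))))) (x (up (up (up (up (up (up (up ord0)))))))).
rewrite (_ : form_E8 _ _ _ _ _ _ _ _ = cartan_form edges_E8 x).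
  move=> [q0 qz]; split=> // /qz[[? ? ? ?] [? ? ? ?]].
  by do 8!(apply: ord_recl_all => //); case.
rewrite /form_E8 /cartan_form !big_ord_recl !big_ord0 /cartan_entry /=; ring.
Qed.

Lemma posdef_D4 : cartan_posdef 4 edges_D4.
Proof.
move=> x; have := form_D4_pos (x ord0) (x (up ord0)) (x (up (up ord0))) (x (up (up (up ord0)))).
rewrite /= (_ : _ - _ = cartan_form edges_D4 x).
  move=> [q0 qz]; split=> // /qz[? ? ? ?].
  by do 4!(apply: ord_recl_all => //); case.
rewrite /cartan_form !big_ord_recl !big_ord0 /cartan_entry /=; ring.
Qed.

End DynkinForms.

Section FiniteType.
Variables (R : realType) (V Q : vectType R) (B : {symmetric V}) (BQ : {symmetric Q}).
Variables (n : nat) (Phi : set V) (U : {vspace V}) (a : V) (pi : 'Hom(V, Q)).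
Variables (beta : 'I_n.+1 -> Q) (m : 'I_n.+1 -> nat) (alpha : 'I_n.+1 -> V).
Hypothesis D : affine_data B BQ Phi U a pi beta m alpha.

Let Phi_norm := ad_norm D.
Let alpha_Phi := ad_Phi D.

Notation Vfin := (span_of (finite_part alpha)).
Notation Phifin := (Phi `&` [set v | v \in Vfin]).

Lemma span_of_sub k (x : 'I_k -> V) (E : {vspace V}) :
  (forall i, x i \in E) -> (span_of x <= E)%VS.
Proof. by move=> H; apply/subv_sumP => i _; rewrite -memvE. Qed.

Lemma span_of_dec k (x : 'I_k -> V) v : v \in span_of x ->
  exists c : 'I_k -> R, v = \sum_i c i *: x i.
Proof.
move=> /memv_sumP[w wE ->].
have /choice[c cE] : forall i, exists k, w i = k *: x i.
  by move=> i; apply/vlineP/wE.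
by exists c; apply: eq_bigr => i _.
Qed.

Lemma span_of_dim k (x : 'I_k -> V) : (\dim (span_of x) <= k)%N.
Proof.
have -> : span_of x = <<[seq x i | i <- enum 'I_k]>>%VS.
  by rewrite span_def big_map big_enum.
by apply: leq_trans (dim_span _) _; rewrite size_map size_enum_ord.
Qed.

Lemma span_of_free k (x : 'I_k -> V) (E : {vspace V}) :
  free [seq x i | i <- enum 'I_k] -> (forall i, x i \in E) -> (k <= \dim E)%N.
Proof.
move=> fx xE; have <- : \dim <<[seq x i | i <- enum 'I_k]>> = k.
  by move: fx => /eqP ->; rewrite size_map size_enum_ord.
by apply: dimvS; apply/span_subvP => _ /mapP[i _ ->].
Qed.

Lemma alpha_fin_free : free [seq finite_part alpha i | i <- enum 'I_n].
Proof.
have sz : size [seq finite_part alpha i | i <- enum 'I_n] == n by rewrite size_map size_enum_ord.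
suff: free (Tuple sz) by [].
apply/freeP => c cE i.
have nthE (j : 'I_n) : (Tuple sz)`_j = alpha (lift ord0 j).
  by rewrite (nth_map j) ?size_enum_ord //= nth_ord_enum.
have [|c0 _] := @alpha_coef _ _ _ _ _ _ _ _ _ _ _ _ _ D
  (fun l => if unlift ord0 l is Some j then c j else 0) 0.
  rewrite scale0r addr0 big_ord_recl unlift_none scale0r add0r -[RHS]cE.
  by apply: eq_bigr => j _; rewrite liftK nthE.
by have := c0 (lift ord0 i); rewrite liftK.
Qed.

(** The root basis of the given type and the simple roots other than the affine
    one span the same space, so the explicit form decides its definiteness. *)
Lemma type_facts k edges : cartan_posdef R k edges -> of_type B Phifin k edges ->
  [/\ n = k, forall v, v \in Vfin -> 0 <= B v v /\ (B v v = 0 -> v = 0) &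
  forall i j : 'I_k, cartan_entry edges i j = -1 -> exists x y, [/\ Phi x, Phi y & adj B x y]].
Proof.
move=> pd [gamma [[gPhi gfree gdec] gB]].
have gprod i j : B (gamma i) (gamma j) = (cartan_entry edges i j)%:~R.
  have := gB i j; have [Pj _] := gPhi j; rewrite (Phi_norm Pj).
  by rewrite mulrAC mulfV ?mul1r // pnatr_eq0.
have fin_gamma v : v \in Vfin -> v \in span_of gamma.
  apply/subvP: v; apply: span_of_sub => i.
  have [|c [->|->]] := gdec (finite_part alpha i).
  - split; first exact: alpha_Phi.
    by rewrite /= memvE; apply: (sumv_sup i).
  - by apply: rpred_sum => l _; rewrite rpredMn // memvE; apply: (sumv_sup l).
  - by rewrite rpredN; apply: rpred_sum => l _; rewrite rpredMn // memvE; apply: (sumv_sup l).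
have nk : n = k.
  apply/eqP; rewrite eqn_leq; apply/andP; split.
    apply: leq_trans (span_of_dim gamma).
    apply: (span_of_free alpha_fin_free) => i; apply: fin_gamma.
    by rewrite memvE; apply: (sumv_sup i).
  apply: leq_trans (span_of_dim (finite_part alpha)).
  by apply: (span_of_free gfree) => i; have [] := gPhi i.
split=> //; last first.
  move=> i j cij; exists (gamma i), (gamma j).
  have [Pi _] := gPhi i; have [Pj _] := gPhi j.
  by split=> //; right; rewrite gprod cij.
move=> v /fin_gamma/span_of_dec[x ->].
have -> : B (\sum_i x i *: gamma i) (\sum_i x i *: gamma i) = cartan_form edges x.
  rewrite sym_suml /cartan_form; apply: eq_bigr => i _.
  rewrite symZl sym_sumr mulr_sumr; apply: eq_bigr => j _.
  by rewrite symZr gprod mulrA.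
have [q0 qz] := pd x; split=> // /qz x0.
by rewrite big1 // => i _; rewrite x0 scale0r.
Qed.

(** * Affine diagrams with a unique largest coefficient *)

Hypothesis posdef : forall v, v \in Vfin -> 0 <= B v v /\ (B v v = 0 -> v = 0).
Variable t : 'I_n.+1.
Hypothesis tub : tubular m t.

(** That [b] is radical means at each node that twice its coefficient is the
    weighted sum of the coefficients of its neighbours. *)
Lemma bonds : exists N : 'I_n.+1 -> 'I_n.+1 -> nat,
  [/\ forall i j, i != j -> B (alpha i) (alpha j) = - (N i j)%:R,
      forall i j, N i j = N j i
    & forall i, (2 * m i = \sum_(j | j != i) N i j * m j)%N].
Proof.
have /choice[N0 N0E] : forall ij : 'I_n.+1 * 'I_n.+1, exists k : nat,
    ij.1 != ij.2 -> B (alpha ij.1) (alpha ij.2) = - k%:R.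
  move=> [i j] /=; have [->|ij] := eqVneq i j; first by exists 0%N.
  have /intrP[k kE] := Phi_int D (alpha_Phi i) (alpha_Phi j).
  have := alpha_le0 D ij.
  rewrite kE lerz0 => k0; exists `|k|%N => _.
  by rewrite natr_absz ler0_norm // intrN opprK.
pose N i j := N0 (i, j).
have NE i j : i != j -> B (alpha i) (alpha j) = - (N i j)%:R by apply: (N0E (i, j)).
exists (fun i j => if i == j then 0%N else N i j); split.
- by move=> i j ij; rewrite (negPf ij) NE.
- move=> i j; rewrite eq_sym; case: eqVneq => // ij.
  have := NE j i ij; rewrite symC NE 1?eq_sym // => /oppr_inj/eqP.
  by rewrite eqr_nat => /eqP.
- move=> i; apply/eqP; rewrite -(eqr_nat R); apply/eqP.
  have := null_vector D i.
  rewrite (bigD1 i) //= Phi_norm // natrM natr_sum => /eqP; rewrite addr_eq0 => /eqP ->.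
  rewrite -sumrN; apply: eq_bigr => j ji.
  by rewrite eq_sym (negPf ji) NE 1?eq_sym // natrM mulNr opprK.
Qed.

Lemma m_lt_t i : i != t -> (m i < m t)%N.
Proof.
move=> it; have := tub t; rewrite eqxx => /eqP mt.
have := tub i; rewrite (negPf it) => /eqP mi.
by rewrite ltn_neqAle mt leq_bigmax andbT; apply/eqP.
Qed.

Lemma mt_ge2 : (0 < n)%N -> (2 <= m t)%N.
Proof.
move=> n0; pose i : 'I_n.+1 := if t == ord0 then ord_max else ord0.
have it : i != t.
  rewrite /i; have [->|t0] := eqVneq t ord0; last by rewrite eq_sym.
  by rewrite -val_eqE /= -lt0n.
by have := m_lt_t it; apply: leq_trans; rewrite ltnS (m_gt0 D).
Qed.

(** If the largest coefficient were 2, all others would be 1. The relations of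
    [bonds] then give the node [t] four simple bonds and its neighbours none
    besides; as the diagram is connected, it would have five nodes. *)
Lemma mt_ge3 : (5 <= n)%N -> (3 <= m t)%N.
Proof.
move=> n5; rewrite ltn_neqAle mt_ge2 ?(leq_trans _ n5) // andbT; apply/negP => /eqP mt2.
have m1 i : i != t -> m i = 1%N.
  move=> it; apply/eqP; rewrite eqn_leq (m_gt0 D) andbT -ltnS mt2.
  exact: m_lt_t.
have [N [NE Nsym Neq]] := bonds.
have Nt j : j != t -> (0 < N t j)%N -> N t j = 1%N /\ forall l, l != j -> l != t -> N j l = 0%N.
  move=> jt Npos; have := Neq j; rewrite (bigD1 t) 1?eq_sym //= -mt2 m1 // Nsym => E.
  have Z : (\sum_(i | (i != j) && (i != t)) N j i * m i = 0)%N.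
    by move: E Npos; set S := (\sum_(i | _) _)%N; lia.
  split; first by move: E Npos; rewrite Z; lia.
  move=> l lj lt; have /eqP := Z; rewrite sum_nat_eq0 => /forallP/(_ l).
  by rewrite lj lt /= (m1 l lt) muln1 => /eqP.
have c4 : #|[set j : 'I_n.+1 | (j != t) && (0 < N t j)%N]%SET| = 4.
  have E : (\sum_(j | j != t) N t j * m j = 4)%N by rewrite -(Neq t) -mt2.
  rewrite -[RHS]E (bigID (fun j => 0 < N t j)%N) /= [X in (_ + X)%N]big1; last first.
    by move=> j /andP[_]; rewrite lt0n negbK => /eqP->.
  rewrite addn0 -sum1_card; apply: eq_big => j; first by rewrite inE.
  by rewrite inE => /andP[jt /(Nt j jt)[-> _]]; rewrite m1.
pose p (i : 'I_n.+1) := (i == t) || (0 < N t i)%N.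
have orth i j : p i -> ~~ p j -> B (alpha i) (alpha j) = 0.
  rewrite /p negb_or => pi' /andP[jt]; rewrite -leqNgt leqn0 => /eqP tj.
  have ij : i != j.
    by apply: contraTneq pi' => ->; rewrite (negPf jt) tj.
  rewrite NE //; case/orP: pi' => [/eqP->|it]; first by rewrite tj oppr0.
  have [->|it'] := eqVneq i t; first by rewrite tj oppr0.
  by have [_ ->] := Nt i it' it; rewrite ?oppr0 // eq_sym.
have all_p : forall j, p j.
  have [p0|p0] := boolP (p ord0).
    have H := @rad_partial _ _ _ _ _ _ _ _ _ _ _ _ _ D posdef (fun j => ~~ p j).
    move=> j; rewrite -[p j]negbK; apply: H; first by rewrite negbK.
    by move=> x y px; rewrite negbK => py; rewrite symC; apply: orth.
  have /negP := @rad_partial _ _ _ _ _ _ _ _ _ _ _ _ _ D posdef p p0 orth t.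
  by rewrite /p eqxx.
have : (#|'I_n.+1| <= 5)%N.
  have -> : #|'I_n.+1| = #|(t |: [set j : 'I_n.+1 | (j != t) && (0 < N t j)%N])%SET|.
    rewrite -cardsT; congr #|pred_of_set _|; apply/setP => j; rewrite !inE.
    by have := all_p j; rewrite /p; case: eqVneq.
  by rewrite cardsU1 c4; case: (_ \notin _).
by rewrite card_ord; move: n5; lia.
Qed.

End FiniteType.

Section D4Diagram.

(** The excluded case of the next lemma: the node with the largest coefficient
    [M] has exactly the neighbours 1, 2, 3, and [k] is the coefficient of the
    fifth node. Adding the relations at the neighbours leaves no room for bonds
    between them, and the relation at the fifth node then yields
    [4 = (b1 + b2 + b3)^2 + b1^2 + b2^2 + b3^2], which has no solution. *)
Lemma three_neighbours (M m1 m2 m3 k a12 a13 a23 b1 b2 b3 : nat) :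
  (0 < m1 -> 0 < m2 -> 0 < m3 -> 0 < k ->
  2 * M = m1 + m2 + m3 -> 2 * m1 = M + a12 * m2 + a13 * m3 + b1 * k ->
  2 * m2 = M + a12 * m1 + a23 * m3 + b2 * k ->
  2 * m3 = M + a13 * m1 + a23 * m2 + b3 * k ->
  2 * k = b1 * m1 + b2 * m2 + b3 * m3 -> False)%N.
Proof.
move=> p1 p2 p3 pk eM e1 e2 e3 ek.
have S : M = (a12 * (m1 + m2) + a13 * (m1 + m3) + a23 * (m2 + m3) + (b1 + b2 + b3) * k)%N.
  by lia.
have bpos : (0 < b1 + b2 + b3)%N.
  rewrite lt0n; apply/eqP => b0; have [z1 [z2 z3]] : (b1 = 0 /\ b2 = 0 /\ b3 = 0)%N by lia.
  by move: ek pk; rewrite z1 z2 z3 !mul0n; lia.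
have bk : (0 < (b1 + b2 + b3) * k)%N by rewrite muln_gt0 bpos.
have z12 : a12 = 0%N.
  by case: a12 S e1 e2 => // x S e1 e2; exfalso; move: S; rewrite mulSn; lia.
have z13 : a13 = 0%N.
  by case: a13 S e1 e3 => // x S e1 e3; exfalso; move: S; rewrite mulSn; lia.
have z23 : a23 = 0%N.
  by case: a23 S e2 e3 => // x S e2 e3; exfalso; move: S; rewrite mulSn; lia.
subst a12 a13 a23.
have : (4 * k = (b1 + b2 + b3) ^ 2 * k + (b1 ^ 2 + b2 ^ 2 + b3 ^ 2) * k)%N.
  move: S e1 e2 e3 ek; rewrite !mul0n !add0n => -> e1 e2 e3 ek.
  have -> : (4 * k = b1 * (2 * m1) + b2 * (2 * m2) + b3 * (2 * m3))%N by lia.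
  by rewrite e1 e2 e3; nia.
rewrite -mulnDl => /eqP; rewrite eqn_pmul2r // => /eqP E {S e1 e2 e3 ek eM bk}.
have [h1 [h2 h3]] : (b1 <= 2 /\ b2 <= 2 /\ b3 <= 2)%N by move: E; clear; nia.
move: E bpos; clear -h1 h2 h3.
by case: b1 h1 => [|[|[|//]]] _; case: b2 h2 => [|[|[|//]]] _; case: b3 h3 => [|[|[|//]]] _.
Qed.

(** All bonds of the node with the largest coefficient [M] are simple, because
    its neighbours have smaller coefficients. Fewer than three neighbours cannot
    add up to [2 M], and with four of them all relations are tight. *)
Lemma star_D4 (M m1 m2 m3 m4 x1 x2 x3 x4 a12 a13 a14 a23 a24 a34 : nat) :
  (0 < m1 -> 0 < m2 -> 0 < m3 -> 0 < m4 -> m1 < M -> m2 < M -> m3 < M -> m4 < M ->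
  2 * M = x1 * m1 + x2 * m2 + x3 * m3 + x4 * m4 ->
  2 * m1 = x1 * M + a12 * m2 + a13 * m3 + a14 * m4 ->
  2 * m2 = x2 * M + a12 * m1 + a23 * m3 + a24 * m4 ->
  2 * m3 = x3 * M + a13 * m1 + a23 * m2 + a34 * m4 ->
  2 * m4 = x4 * M + a14 * m1 + a24 * m2 + a34 * m3 ->
  [/\ x1 = 1, x2 = 1, x3 = 1 & x4 = 1] /\
  [/\ a12 = 0, a13 = 0 & a14 = 0] /\ [/\ a23 = 0, a24 = 0 & a34 = 0] /\
  [/\ M = 2 * m1, m2 = m1, m3 = m1 & m4 = m1])%N.
Proof.
move=> p1 p2 p3 p4 l1 l2 l3 l4 eM e1 e2 e3 e4.
have small x k : (0 < M -> x * M <= 2 * k -> k < M -> x = 0 \/ x = 1)%N.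
  case: x => [|[|x]]; [by left|by right|]; rewrite !mulSn; lia.
have M0 : (0 < M)%N by lia.
have X1 := small x1 m1 M0 ltac:(lia) l1.
have X2 := small x2 m2 M0 ltac:(lia) l2.
have X3 := small x3 m3 M0 ltac:(lia) l3.
have X4 := small x4 m4 M0 ltac:(lia) l4.
case: X1 X2 X3 X4 => X1 [] X2 [] X3 [] X4; subst x1 x2 x3 x4;
  rewrite ?mul0n ?mul1n ?addn0 ?add0n in eM e1 e2 e3 e4; try by exfalso; lia.
- by exfalso; apply: (@three_neighbours M m2 m3 m4 m1 a23 a24 a34 a12 a13 a14); lia.
- by exfalso; apply: (@three_neighbours M m1 m3 m4 m2 a13 a14 a34 a12 a23 a24); lia.
- by exfalso; apply: (@three_neighbours M m1 m2 m4 m3 a12 a14 a24 a13 a23 a34); lia.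
- by exfalso; apply: (@three_neighbours M m1 m2 m3 m4 a12 a13 a23 a14 a24 a34); lia.
have nul x k : (0 < k -> x * k = 0 -> x = 0)%N.
  by move=> k0 /eqP; rewrite muln_eq0 => /orP[/eqP//|/eqP kE]; rewrite kE in k0.
have z12 : a12 = 0%N by apply: (nul _ m2) => //; lia.
have z13 : a13 = 0%N by apply: (nul _ m3) => //; lia.
have z14 : a14 = 0%N by apply: (nul _ m4) => //; lia.
have z23 : a23 = 0%N by apply: (nul _ m3) => //; lia.
have z24 : a24 = 0%N by apply: (nul _ m4) => //; lia.
have z34 : a34 = 0%N by apply: (nul _ m4) => //; lia.
by subst; do !split=> //; lia.
Qed.

End D4Diagram.

Section D4Affine.
Variables (R : realType) (V Q : vectType R) (B : {symmetric V}) (BQ : {symmetric Q}).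
Variables (Phi : set V) (U : {vspace V}) (a : V) (pi : 'Hom(V, Q)).
Variables (beta : 'I_5 -> Q) (m : 'I_5 -> nat) (alpha : 'I_5 -> V).
Hypothesis D : affine_data B BQ Phi U a pi beta m alpha.

Let Phi_norm := ad_norm D.
Variable t : 'I_5.
Hypothesis tub : tubular m t.
Hypothesis t2 : t = 2%N :> nat.

Lemma D4_diagram : m t = 2%N /\ (forall i, i != t -> m i = 1%N) /\
  forall i j, B (alpha i) (alpha j) =
    if i == j then 2 else if (i == t) || (j == t) then -1 else 0.
Proof.
have [N [NE Nsym Neq]] := bonds D.
pose o k : 'I_5 := inord k.
have oE k (i : 'I_5) : (k = i :> nat)%N -> i = o k by move=> ->; rewrite /o inord_val.
have tE : t = o 2%N by apply: oE.
have neq k l : (k < 5)%N -> (l < 5)%N -> (o k == o l) = (k == l).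
  by move=> k5 l5; rewrite -val_eqE /= !inordK.
have lt k : (k < 5)%N -> k != 2%N -> (m (o k) < m (o 2%N))%N.
  by move=> k5 k2; rewrite -tE; apply: (m_lt_t tub); rewrite tE neq.
have Eq k : (k < 5)%N -> (2 * m (o k) =
    (k != 0) * (N (o k) (o 0%N) * m (o 0%N)) + (k != 1) * (N (o k) (o 1%N) * m (o 1%N))
  + (k != 2) * (N (o k) (o 2%N) * m (o 2%N)) + (k != 3) * (N (o k) (o 3%N) * m (o 3%N))
  + (k != 4) * (N (o k) (o 4%N) * m (o 4%N)))%N.
  move=> k5; rewrite Neq big_mkcond !big_ord_recl big_ord0 /= addn0 !addnA.
  have -> : lift ord0 (lift ord0 (lift ord0 (lift ord0 ord0))) = o 4%N :> 'I_5 by apply: oE.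
  have -> : lift ord0 (lift ord0 (lift ord0 ord0)) = o 3%N :> 'I_5 by apply: oE.
  have -> : lift ord0 (lift ord0 ord0) = o 2%N :> 'I_5 by apply: oE.
  have -> : lift ord0 ord0 = o 1%N :> 'I_5 by apply: oE.
  have -> : ord0 = o 0%N by apply: oE.
  by rewrite !neq //; case: k k5 => [|[|[|[|[|//]]]]] _ /=; rewrite ?mul0n ?mul1n.
have g k := m_gt0 D (o k).
have m00 : m (o 0%N) = 1%N by have -> : o 0%N = ord0 by [apply/esym/oE]; apply: (m0 D).
have := Eq 0%N isT; have := Eq 1%N isT; have := Eq 2%N isT; have := Eq 3%N isT; have := Eq 4%N isT.
rewrite /= !mul0n !mul1n !add0n !addn0.
rewrite ?(Nsym (o 1%N) (o 0%N)) ?(Nsym (o 2%N) (o 0%N)) ?(Nsym (o 3%N) (o 0%N)) ?(Nsym (o 4%N) (o 0%N))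
  ?(Nsym (o 2%N) (o 1%N)) ?(Nsym (o 3%N) (o 1%N)) ?(Nsym (o 4%N) (o 1%N))
  ?(Nsym (o 3%N) (o 2%N)) ?(Nsym (o 4%N) (o 2%N)) ?(Nsym (o 4%N) (o 3%N)) => e4 e3 e2 e1 e0.
have [] := @star_D4 (m (o 2%N)) (m (o 0%N)) (m (o 1%N)) (m (o 3%N)) (m (o 4%N))
  (N (o 0%N) (o 2%N)) (N (o 1%N) (o 2%N)) (N (o 2%N) (o 3%N)) (N (o 2%N) (o 4%N))
  (N (o 0%N) (o 1%N)) (N (o 0%N) (o 3%N)) (N (o 0%N) (o 4%N)) (N (o 1%N) (o 3%N)) (N (o 1%N) (o 4%N)) (N (o 3%N) (o 4%N))
  (g _) (g _) (g _) (g _) (lt 0%N isT isT) (lt 1%N isT isT) (lt 3%N isT isT) (lt 4%N isT isT);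
  try by move: e4 e3 e2 e1 e0; clear; lia.
move=> [n02 n12 n23 n24] [[n01 n03 n04] [[n13 n14 n34] [mM E1 E3 E4]]].
split; first by rewrite tE mM m00.
split.
  move=> i; rewrite tE (oE i i erefl); case: i => -[|[|[|[|[|//]]]]] /= p.
  - by rewrite m00.
  - by rewrite E1 m00.
  - by rewrite eqxx.
  - by rewrite E3 m00.
  - by rewrite E4 m00.
move=> i j; have [->|ij] := eqVneq i j; first by apply: Phi_norm; apply: (ad_Phi D).
rewrite NE // tE; move: ij; rewrite (oE i i erefl) (oE j j erefl).
case: i => -[|[|[|[|[|//]]]]] /= p; case: j => -[|[|[|[|[|//]]]]] /= q;
  rewrite ?eqxx // !neq //= => _; try (rewrite Nsym); rewrite ?(n02, n12, n23, n24, n01, n03, n04, n13, n14, n34) ?oppr0 //.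
all: try by rewrite Nsym ?(n02, n12, n23, n24, n01, n03, n04, n13, n14, n34) ?oppr0 //.
Qed.

End D4Affine.

(** * Groups generated by reflections *)

Section Words.
Variables (R : realType) (X : vectType R) (A : eqType) (f : A -> 'End(X)).
Implicit Types (gs : seq A).
Notation word gs := (lprod [seq f x | x <- gs]).
Definition all_in (S : set A) gs := forall x, x \in gs -> S x.

Lemma all_in_cons (S : set A) x gs : all_in S (x :: gs) <-> S x /\ all_in S gs.
Proof.
split=> [H|[Sx H] y]; last by rewrite inE => /orP[/eqP->//|/H].
by split=> [|y yg]; apply: H; rewrite inE ?eqxx // yg orbT.
Qed.

Lemma all_in_cat (S : set A) gs hs : all_in S gs -> all_in S hs -> all_in S (gs ++ hs).
Proof. by move=> Sg Sh x; rewrite mem_cat => /orP[/Sg|/Sh]. Qed.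

Lemma all_in_rev (S : set A) gs : all_in S gs -> all_in S (rev gs).
Proof. by move=> Sg x; rewrite mem_rev => /Sg. Qed.

Lemma lprod_cat (s1 s2 : seq 'End(X)) : lprod (s1 ++ s2) = (lprod s1 \o lprod s2)%VF.
Proof.
elim: s1 => [|x s1 IH] /=; first by rewrite comp_lfun1l.
by rewrite IH comp_lfunA.
Qed.

Lemma inv_lfun_unique (g h : 'End(X)) : (h \o g)%VF = \1%VF -> (g \o h)%VF = \1%VF ->
  (g^-1)%VF = h.
Proof.
move=> hg gh; have kg : lker g == 0%VS.
  apply/lker0P => x y E; have := congr1 h E.
  by rewrite -!comp_lfunE hg !id_lfunE.
by rewrite -[LHS]comp_lfun1r -gh comp_lfunA (lker0_compVf kg) comp_lfun1l.
Qed.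

Variable S : set A.
Hypothesis f_inv : forall x, S x -> (f x \o f x)%VF = \1%VF.

Lemma word_rev gs : all_in S gs -> (word gs \o word (rev gs))%VF = \1%VF.
Proof.
elim: gs => [|x gs IH] /=; first by rewrite comp_lfun1l.
move=> /all_in_cons[Sx /IH E].
rewrite rev_cons -cats1 map_cat lprod_cat /= comp_lfun1r -comp_lfunA.
by rewrite (comp_lfunA (word gs)) E comp_lfun1l f_inv.
Qed.

Lemma word_inv gs : all_in S gs -> (word gs)^-1%VF = word (rev gs).
Proof.
move=> Sg; apply: inv_lfun_unique; last exact: word_rev.
by have := word_rev (all_in_rev Sg); rewrite revK.
Qed.

Lemma generated_wordP S' w : S' `<=` S -> generated [set f x | x in S'] w <->
  exists2 gs, all_in S' gs & w = word gs.
Proof.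
move=> sub; split.
  elim=> {w} [_ [x Sx <-]||w1 w2 _ [gs Sg ->] _ [hs Sh ->]|w _ [gs Sg ->]].
  - exists [:: x]; last by rewrite /= comp_lfun1r.
    by move=> y; rewrite inE => /eqP->.
  - by exists [::].
  - by exists (gs ++ hs); [apply: all_in_cat | rewrite map_cat lprod_cat].
  - exists (rev gs); first exact: all_in_rev.
    by rewrite word_inv // => x /Sg /sub.
move=> [gs Sg ->]; elim: gs Sg => [|x gs IH] /=; first by move=> _; apply: gen_1.
by move=> /all_in_cons[Sx Sg]; apply: gen_mul; [apply: gen_in; exists x | apply: IH].
Qed.

End Words.

Section Orbit.
Variables (R : realType) (V : vectType R) (B : {symmetric V}).

Lemma refl_invol g : B g g = 2 -> (refl B g \o refl B g)%VF = \1%VF.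
Proof. by move=> gg; apply/lfunP => x; rewrite comp_lfunE !reflE // rsK // id_lfunE. Qed.

Lemma reflN g : B g g = 2 -> refl B (- g) = refl B g.
Proof.
by move=> gg; apply/lfunP => x; rewrite !reflE ?rsN // !symE opprK.
Qed.

Lemma rs_rp gs e x : norm2 B gs -> rs B (rp B gs e) x = rp B gs (rs B e (rp B (rev gs) x)).
Proof.
elim: gs x => //= g gs IH x /norm2_cons[gg nn].
by rewrite rs_conj // IH // rev_cons -cats1 rp_cat.
Qed.

Hypothesis psd : forall x, 0 <= B x x.
Hypothesis psd0 : forall x, B x x = 0 -> radical B x.

(** The conjugates of the generators form a root system that spans the same
    lattice, so [norm2_root] applies to it. *)
Lemma orbit_roots (gs : seq V) x : norm2 B gs ->
  (forall g h, g \in gs -> h \in gs -> B g h \is a Num.int) ->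
  connected_set B [set g | g \in gs] ->
  (forall x, (forall g, g \in gs -> B x g = 0) -> radical B x) ->
  (exists g h, [/\ g \in gs, h \in gs & adj B g h]) ->
  zspan [set g | g \in gs] x -> B x x = 2 ->
  exists w e, [/\ {subset w <= gs}, e \in gs & x = rp B w e].
Proof.
move=> nn gint gconn gspan gadj Zx.
pose Psi := [set x | exists w e, [/\ {subset w <= gs}, e \in gs & x = rp B w e]].
have nw w : {subset w <= gs} -> norm2 B w by move=> sw g /sw /nn.
have Psi_z y : Psi y -> zspan [set g | g \in gs] y.
  move=> [w [e [sw eg ->]]]; elim: w sw => [|g w IH] sw /=; first exact: zspan_id.
  have Zy : zspan [set g | g \in gs] (rp B w e).
    by apply: IH => h hw; apply: sw; rewrite inE hw orbT.
  have gg : g \in gs by apply: sw; rewrite mem_head.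
  apply: zspanB => //.
  have /intrP[k ->] : B g (rp B w e) \is a Num.int.
    by rewrite symC; apply: (zspan_intl (B := B) gint Zy gg).
  by rewrite scaler_int; apply/zspanMz/zspan_id.
apply: (@norm2_root _ _ B psd psd0 Psi [set g | g \in gs]) => //.
- by move=> _ [w [e [sw eg ->]]]; rewrite rp_iso ?nn //; apply: nw.
- by move=> y z Py Pz; apply: (zspan_int (B := B) gint); apply: Psi_z.
- move=> _ _ [w [e [sw eg ->]]] [w' [e' [sw' eg' ->]]].
  exists (w ++ e :: rev w ++ w'), e'; split=> //.
    move=> g; rewrite mem_cat inE mem_cat mem_rev.
    by case/orP => [/sw//|/orP[/eqP->//|/orP[/sw//|/sw'//]]].
  by rewrite rs_rp ?rp_cat //= ?rp_cat //; apply: nw.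
- by move=> g gg; exists [::], g.
- by move: Zx; apply: zspan_sub => g gg; apply: zspan_id; exists [::], g.
Qed.

End Orbit.

(** * The Coxeter word and the hyperbolic cover *)

Definition coxeter_prefix (V : Type) n (alpha : 'I_n.+1 -> V) (t : 'I_n.+1) : seq V :=
  rcons [seq alpha i | i <- enum 'I_n.+1 & (i != ord0) && (i != t)] (alpha ord0).

Section CoverData.
Variables (R : realType) (V Q : vectType R) (B : {symmetric V}) (BQ : {symmetric Q}).
Variables (n : nat) (Phi : set V) (U : {vspace V}) (a : V) (pi : 'Hom(V, Q)).
Variables (beta : 'I_n.+1 -> Q) (m : 'I_n.+1 -> nat) (alpha : 'I_n.+1 -> V).
Hypothesis D : affine_data B BQ Phi U a pi beta m alpha.
Notation b := (\sum_i alpha i *+ m i).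
Notation Vfin := (span_of (finite_part alpha)).
Hypothesis posdef : forall v, v \in Vfin -> 0 <= B v v /\ (B v v = 0 -> v = 0).
Hypothesis Phi_adj : exists x y, [/\ Phi x, Phi y & adj B x y].
Hypothesis V_dim : \dim {: V} = n.+2.
Variable t : 'I_n.+1.
Hypothesis tub : tubular m t.
Hypothesis n_gt0 : (0 < n)%N.

Let Phi_norm := ad_norm D.
Let alpha_Phi := ad_Phi D.

Notation es0 := (coxeter_prefix alpha t).
Notation et := (alpha t).
Notation es := (es0 ++ [:: et; et + a]).
Notation L := (zspan [set g | g \in es]).

Lemma t_neq0 : t != ord0.
Proof.
have := mt_ge2 D tub n_gt0; apply: contraTneq => ->.
by rewrite (m0 D).
Qed.

Lemma es_word : [seq extended_roots alpha t a i | i <- coxeter_word t] = es.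
Proof.
by rewrite /coxeter_word /coxeter_prefix map_cat -map_comp /= -cats1 -catA.
Qed.

Lemma mem_es g : g \in es <-> (exists i, g = alpha i) \/ g = et + a.
Proof.
rewrite mem_cat mem_rcons !inE; split.
  move=> /orP[/orP[/eqP->|/mapP[i _ ->]]|/orP[/eqP->|/eqP->]].
  - by left; exists ord0.
  - by left; exists i.
  - by left; exists t.
  - by right.
move=> [[i ->]|->]; last by rewrite eqxx !orbT.
have [->|i0] := eqVneq i ord0; first by rewrite eqxx.
have [->|it] := eqVneq i t; first by rewrite eqxx !orbT.
by rewrite map_f ?orbT // mem_filter i0 it mem_enum.
Qed.

Lemma alpha_es i : alpha i \in es.
Proof. by apply/mem_es; left; exists i. Qed.

Lemma es_Phi g : g \in es -> Phi g.
Proof.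
by move=> /mem_es[[i ->]|->] //; apply: (Phi_shift D posdef Phi_adj).
Qed.

Lemma es_norm : norm2 B es.
Proof. by move=> g /es_Phi/Phi_norm. Qed.

Lemma zspan_es x : L x <-> zspan Phi x.
Proof.
split; first by apply: zspan_sub => g /es_Phi; apply: zspan_id.
move=> /(zspan_dec D)[c [d ->]].
have Lal i : L (alpha i) by apply/zspan_id/alpha_es.
apply: zspanD; first by apply: zspan_sum => i _; apply: zspanMz.
apply: zspanMz; have -> : L a = L (et + a - et) by rewrite [et + a]addrC addrK.
by apply: zspanB => //; apply: zspan_id => /=; apply/mem_es; right.
Qed.

Lemma es_full : <<es>>%VS = fullv.
Proof.
apply/eqP; rewrite eqEsubv subvf; apply/subvP => v _.
have [c [d ->]] := V_dec D v.
have al i : alpha i \in <<es>>%VS by apply/memv_span/alpha_es.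
apply: memvD; first by apply: rpred_sum => i _; apply: memvZ.
apply: memvZ.
have -> : (a \in <<es>>%VS) = (et + a - et \in <<es>>%VS) by rewrite [et + a]addrC addrK.
apply: memvB => //.
by apply: memv_span; apply/mem_es; right.
Qed.

Lemma big_es0 (M : nmodType) (F : 'I_n.+1 -> M) :
  \sum_(i <- rcons [seq i <- enum 'I_n.+1 | (i != ord0) && (i != t)] ord0) F i + F t
  = \sum_i F i.
Proof.
rewrite -cats1 big_cat big_seq1 big_filter big_enum_cond /=.
rewrite [RHS](bigD1 ord0) //= [in RHS](bigD1 t) ?t_neq0 //=.
by rewrite addrAC addrC [F t + _]addrC.
Qed.

Lemma es0_map : es0 = [seq alpha i | i <- rcons [seq i <- enum 'I_n.+1 | (i != ord0) && (i != t)] ord0].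
Proof. by rewrite map_rcons. Qed.

Lemma size_es : size es = n.+2.
Proof.
rewrite size_cat es0_map size_map addn2; congr _.+1.
rewrite -[in RHS](card_ord n.+1) -sum1_card.
set s := rcons _ _; have := big_es0 (fun=> 1%N); rewrite -/s => <-.
by rewrite sum1_size -[RHS]/(size s + 1)%N addn1.
Qed.

Lemma es_free : free es.
Proof. by rewrite /free es_full V_dim size_es. Qed.

Notation ys0 := [seq (m i)%:R : R | i <- rcons [seq i <- enum 'I_n.+1 | (i != ord0) && (i != t)] ord0].

Lemma comb_map (I : Type) (s : seq I) (f : I -> R) (g : I -> V) :
  comb [seq f i | i <- s] [seq g i | i <- s] = \sum_(i <- s) f i *: g i.
Proof. by elim: s => [|i s IH]; rewrite /= ?comb_cons ?IH ?big_cons // /comb !big_nil. Qed.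

Lemma b_comb : b = comb ys0 es0 + (m t)%:R *: et.
Proof.
rewrite es0_map comb_map (big_es0 (fun i => (m i)%:R *: alpha i)).
by apply: eq_bigr => i _; rewrite scaler_nat.
Qed.

Lemma size_ys0 : size ys0 = size es0.
Proof. by rewrite es0_map !size_map. Qed.

Lemma ys0_int : all_int ys0.
Proof. by move=> y /mapP[i _ ->]; apply: natr_int. Qed.

Lemma es_int g h : L g -> L h -> B g h \is a Num.int.
Proof.
by apply: zspan_int => x y /es_Phi Px /es_Phi Py; apply: (Phi_int D).
Qed.

Lemma a_prim (k : R) : L (k *: a) -> k \is a Num.int.
Proof.
move=> /zspan_es Zk; have [aU _] := a_U D.
have : zspan [set a] (k *: a) by rewrite -(ad_gen D); split=> //; apply: memvZ.
move=> /zspan1[d]; rewrite -scaler_int => /eqP.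
by rewrite -subr_eq0 -scalerBl scaler_eq0 (negPf (a_neq0 D)) orbF subr_eq0 => /eqP->.
Qed.

Lemma b_prim (d : R) z : d \is a Num.int -> L z -> b = d *: z -> d = 1 \/ d = -1.
Proof.
move=> /intrP[e ->] /zspan_es/(zspan_dec D)[c [f ->]] E.
have [|H _] := @alpha_coef _ _ _ _ _ _ _ _ _ _ _ _ _ D
  (fun i => (m i)%:R - e%:~R * (c i)%:~R) (- (e%:~R * f%:~R)).
  under eq_bigr => i _ do rewrite scalerBl scaler_nat -scalerA.
  rewrite sumrB -scaler_sumr scaleNr -scalerA -addrA -opprD -scalerDr [X in X - _]E.
  apply/eqP; rewrite subr_eq0 -scaler_int; apply/eqP; congr (_ *: (_ + _)).
  by apply: eq_bigr => i _; rewrite scaler_int.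
have := H ord0; rewrite (m0 D) -intrM => /eqP.
rewrite subr_eq0 -[X in X == _]/(1%:~R) eqr_int => /eqP ec.
have : e = 1 \/ e = -1.
  have /eqP : absz (e * c ord0) = 1%N by rewrite -ec.
  by rewrite abszM muln_eq1 => /andP[/eqP e1 _]; lia.
by case=> ->; [left|right].
Qed.

Section Cover.
Variables (Vhat : vectType R) (Bhat : {symmetric Vhat}) (iota : 'Hom(V, Vhat)).
Variables (a' b' : Vhat).
Hypothesis ext : hyperbolic_extension B Vfin a b Bhat iota a' b'.

Lemma iota_iso v w : Bhat (iota v) (iota w) = B v w.
Proof. by have [[_ ->] _ _ _ _] := ext. Qed.

Lemma iota_inj : injective iota.
Proof. by apply/lker0P; have [[/eqP] ] := ext. Qed.

Lemma pair_aa' : Bhat (iota a) a' = 1. Proof. by have [_ [_ _ ->]] := ext. Qed.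
Lemma pair_bb' : Bhat (iota b) b' = 1. Proof. by have [_ _ [_ _ ->]] := ext. Qed.

Let memHa p q : p *: iota a + q *: a' \in (<[iota a]> + <[a']>)%VS.
Proof. by apply: memv_add; rewrite memvZ ?memv_line. Qed.
Let memHb p q : p *: iota b + q *: b' \in (<[iota b]> + <[b']>)%VS.
Proof. by apply: memv_add; rewrite memvZ ?memv_line. Qed.
Let orthHaHb p q r s : Bhat (p *: iota a + q *: a') (r *: iota b + s *: b') = 0.
Proof. by have [_ _ _ [_ _ H] _] := ext; apply: H. Qed.

Lemma pair_ab' : Bhat (iota a) b' = 0.
Proof. by have := orthHaHb 1 0 0 1; rewrite !scale1r !scale0r addr0 add0r. Qed.
Lemma pair_ba' : Bhat (iota b) a' = 0.
Proof. by have := orthHaHb 0 1 1 0; rewrite symC !scale1r !scale0r addr0 add0r. Qed.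
Lemma pair_finb' f : f \in Vfin -> Bhat (iota f) b' = 0.
Proof.
move=> ff; have [_ _ _ [_ H _] _] := ext; apply: H; first exact: memv_img.
by have := memHb 0 1; rewrite scale0r add0r scale1r.
Qed.

Lemma Vhat_dec x : exists v p q, x = iota v + p *: a' + q *: b'.
Proof.
have [_ _ _ _ [E _]] := ext.
have : x \in (iota @: Vfin + (<[iota a]> + <[a']>) + (<[iota b]> + <[b']>))%VS.
  by rewrite E memvf.
move=> /memv_addP[_ /memv_addP[_ /memv_imgP[f _ ->] [_ /memv_addP[_ /vlineP[p ->] [_ /vlineP[q ->] ->]] ->]] [_ /memv_addP[_ /vlineP[r ->] [_ /vlineP[s ->] ->]] ->]].
exists (f + p *: a + r *: b), q, s.
rewrite !linearD !linearZ /= !addrA; congr (_ + _).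
by rewrite addrAC.
Qed.

Lemma b'_int g : g \in es -> Bhat (iota g) b' \is a Num.int.
Proof.
have al i : Bhat (iota (alpha i)) b' \is a Num.int.
  case: (unliftP ord0 i) => [j ->|->]; first by rewrite pair_finb' ?alpha_fin.
  have -> : alpha ord0 = b - \sum_(i < n) alpha (lift ord0 i) *+ m (lift ord0 i).
    by rewrite big_ord_recl (m0 D) mulr1n addrK.
  rewrite linearB symBl pair_bb' pair_finb' ?subr0 //.
  by apply: rpred_sum => j _; rewrite rpredMn // alpha_fin.
move=> /mem_es[[i ->]|->] //.
by rewrite linearD symDl pair_ab' addr0 al.
Qed.

Lemma cover_nondeg v : (forall x, Bhat (iota v) x = 0) -> v = 0.
Proof.
move=> H; have : radical B v by move=> w; rewrite -iota_iso.
move=> /(radE D posdef)[p [q vE]].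
have := H a'; have := H b'; rewrite vE linearD !linearZ /= !symE.
rewrite pair_ab' pair_bb' pair_aa' pair_ba' !mulr0 !mulr1 addr0 add0r => -> ->.
by rewrite !scale0r addr0.
Qed.

(** No non-zero vector of [V] is orthogonal to the cover, so independent vectors
    of [V] define independent linear forms on it. *)
Lemma cover_dual (gs : seq V) (hs : seq R) : free gs ->
  exists x, forall i, (i < size gs)%N -> Bhat (iota gs`_i) x = hs`_i.
Proof.
move=> fg; pose k := size gs; pose X := vbasis {: Vhat}.
pose M := \matrix_(i < k, j < \dim {: Vhat}) Bhat (iota gs`_i) X`_j.
have fM : row_free M.
  apply: inj_row_free => v vM.
  have v0 : \sum_i v 0 i *: gs`_i = 0.
    apply: cover_nondeg => x; rewrite (coord_vbasis (memvf x)) sym_sumr big1 // => j _.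
    suff E : Bhat (iota (\sum_i v 0 i *: gs`_i)) X`_j = (v *m M) 0 j.
      by rewrite symZr E vM mxE mulr0.
    rewrite mxE linear_sum sym_suml; apply: eq_bigr => i _.
    by rewrite linearZ /= symZl mxE.
  have /freeP H : free (in_tuple gs) by [].
  by apply/rowP => i; rewrite mxE; apply: (H (fun i => v 0 i)).
have /row_freeP[A MA] := fM.
pose h := \col_(i < k) hs`_i.
exists (\sum_j (A *m h) j 0 *: X`_j) => i lt.
have : (M *m (A *m h)) (Ordinal lt) 0 = hs`_i by rewrite mulmxA MA mul1mx mxE.
rewrite mxE => <-; rewrite sym_sumr; apply: eq_bigr => j _.
by rewrite symZr [M _ _]mxE mulrC.
Qed.

Lemma cover_dataP : cover_data B Bhat iota a b a' b'.
Proof.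
split; [exact: iota_inj | exact: iota_iso | exact: (rad_a D) | exact: (rad_b D)
  | exact: (radE D posdef) | exact: pair_aa' | exact: pair_ab' | exact: pair_ba'
  | exact: pair_bb' | exact: Vhat_dec | exact: cover_dual].
Qed.

Lemma coxeter_dataP :
  coxeter_data B Bhat iota a b b' es0 et ys0 (m t)%:R.
Proof.
split; [exact: es_norm | exact: es_free | exact: es_full | exact: es_int
  | exact: size_ys0 | exact: ys0_int | exact: natr_int | exact: b_comb
  | exact: b_prim | exact: a_prim | exact: b'_int].
Qed.

End Cover.
End CoverData.

(** * Factorizations of the Coxeter transformations *)

Lemma list_preimage (A : eqType) (Y : eqType) (f : A -> Y) (S : set A) (s : seq Y) :
  (forall y, y \in s -> exists2 x, S x & y = f x) ->
  exists2 gs, (forall g, g \in gs -> S g) & s = [seq f g | g <- gs].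
Proof.
elim: s => [|y s IH] H; first by exists [::].
have [x Sx ->] : exists2 x, S x & y = f x by apply: H; rewrite mem_head.
have [|gs Sg ->] := IH; first by move=> z zs; apply: H; rewrite inE zs orbT.
by exists (x :: gs) => // g; rewrite inE => /orP[/eqP->|/Sg].
Qed.

Lemma small_multiple (R : realFieldType) (k M : R) :
  3 <= M -> 1 <= `|k| -> k * M = 0 \/ k * M = 2 -> False.
Proof. by move=> M3 + km; case: km => km; case: (ger0P k) => ? ?; nra. Qed.

Section Factorizations.
Variables (R : realType) (V Q : vectType R) (B : {symmetric V}) (BQ : {symmetric Q}).
Variables (n : nat) (Phi : set V) (U : {vspace V}) (a : V) (pi : 'Hom(V, Q)).
Variables (beta : 'I_n.+1 -> Q) (m : 'I_n.+1 -> nat) (alpha : 'I_n.+1 -> V).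
Hypothesis D : affine_data B BQ Phi U a pi beta m alpha.
Notation b := (\sum_i alpha i *+ m i).
Notation Vfin := (span_of (finite_part alpha)).
Hypothesis posdef : forall v, v \in Vfin -> 0 <= B v v /\ (B v v = 0 -> v = 0).
Hypothesis Phi_adj : exists x y, [/\ Phi x, Phi y & adj B x y].
Hypothesis V_dim : \dim {: V} = n.+2.
Variable t : 'I_n.+1.
Hypothesis tub : tubular m t.
Hypothesis n_gt0 : (0 < n)%N.
Variables (Vhat : vectType R) (Bhat : {symmetric Vhat}) (iota : 'Hom(V, Vhat)).
Variables (a' b' : Vhat).
Hypothesis ext : hyperbolic_extension B Vfin a b Bhat iota a' b'.

Let Phi_norm := ad_norm D.
Let alpha_Phi := ad_Phi D.
Let iso := iota_iso ext.
Let inj := iota_inj ext.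
Let cover := cover_dataP D posdef ext.
Let cox := coxeter_dataP D posdef Phi_adj V_dim tub n_gt0 ext.

Notation es := (coxeter_prefix alpha t ++ [:: alpha t; alpha t + a]).
Notation L := (zspan [set g | g \in es]).
Notation Vt := (Vtilde iota b').
Notation Bt := (form_tilde Bhat (U := Vt)).
Notation rt v := (refl Bt (vsproj Vt (iota v))).
Notation root := (extended_roots alpha t a).
Notation P gs := (rp Bhat [seq iota g | g <- gs]).
Notation W := (generated [set refl B x | x in Phi]).
Notation T := (conj_closure W (range (fun i => refl B (root i)))).
Notation Wt := (generated (range (fun i => rt (root i)))).
Notation Tt := (conj_closure Wt (range (fun i => rt (root i)))).
Notation c := (coxeter (fun i => refl B (root i)) t).
Notation ct := (coxeter (fun i => rt (root i)) t).
Notation phi := (restrict_to_V iota (U := Vt)).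

Let all_Phi_norm gs : all_in Phi gs -> norm2 B gs.
Proof. by move=> H g /H/Phi_norm. Qed.

Let esPhi : all_in Phi es := es_Phi D posdef Phi_adj (t := t).
Let esnorm : norm2 B es := all_Phi_norm esPhi.

Lemma coxeterE : c = lprod [seq refl B g | g <- es].
Proof. by rewrite /coxeter -es_word -map_comp. Qed.

Lemma coxeter_tildeE : ct = lprod [seq rt g | g <- es].
Proof. by rewrite /coxeter -es_word -map_comp. Qed.

Lemma iota_Vt v : iota v \in Vt.
Proof. by apply: (subvP (addvSl _ _)); apply: memv_img; apply: memvf. Qed.

Lemma b'_Vt : b' \in Vt.
Proof. by apply: (subvP (addvSr _ _)); apply: memv_line. Qed.

Lemma vsval_proj v : vsval (vsproj Vt (iota v)) = iota v.
Proof. by apply: vsprojK; apply: iota_Vt. Qed.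

Lemma reflect_tilde v y : Phi v ->
  vsval (reflect_fun Bt (vsproj Vt (iota v)) y) = rs Bhat (iota v) (vsval y).
Proof.
move=> Pv; rewrite -reflect_rs ?iso ?Phi_norm //.
by rewrite /reflect_fun /form_tilde /= vsval_proj.
Qed.

Lemma refl_tilde v y : Phi v -> vsval (rt v y) = rs Bhat (iota v) (vsval y).
Proof.
move=> Pv; rewrite -reflect_tilde //; congr vsval.
set f := reflect_fun Bt _.
have f_lin : linear f.
  move=> k x z; apply: val_inj.
  rewrite -[LHS]/(vsval (f (k *: x + z))) -[RHS]/(vsval (k *: f x + f z)).
  have fE u : vsval (f u) = rs Bhat (iota v) (vsval u) by apply: reflect_tilde.
  have vP (l : R) (u w : subvs_of Vt) : vsval (l *: u + w) = l *: vsval u + vsval w.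
    by rewrite linearP.
  by rewrite vP !fE vP rsD rsZ.
pose H := GRing.isLinear.Build R (subvs_of Vt) (subvs_of Vt) *:%R f f_lin.
pose g : {linear subvs_of Vt -> subvs_of Vt} := HB.pack f H.
by rewrite -[LHS]/(linfun g y) lfunE.
Qed.

Lemma tilde_word gs y : all_in Phi gs ->
  vsval (lprod [seq rt g | g <- gs] y) = P gs (vsval y).
Proof.
elim: gs => [|g gs IH] /=; first by rewrite id_lfunE.
by move=> /all_in_cons[Pg /IH E]; rewrite comp_lfunE refl_tilde // E.
Qed.

Lemma phiE w v : phi w v = (iota^-1)%VF (vsval (w (vsproj Vt (iota v)))).
Proof. by rewrite /restrict_to_V !comp_lfunE !lfunE. Qed.

Lemma phi_rt v : Phi v -> phi (rt v) = refl B v.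
Proof.
move=> Pv; apply/lfunP => x; rewrite phiE refl_tilde // vsval_proj.
rewrite reflE ?Phi_norm // (rs_morph (B := B) iso) lker0_lfunK //.
by have [[->]] := ext.
Qed.

Lemma refl_eq v w : Phi v -> Phi w -> refl B v = refl B w -> v = w \/ v = - w.
Proof.
move=> Pv Pw /(congr1 (fun f : 'End(V) => f v)); rewrite !reflE ?Phi_norm //.
rewrite rs_self ?Phi_norm // => E.
have E2 : 2 *: v = B w v *: w.
  by rewrite scaler_nat mulr2n -{1}[v]opprK E /rs opprB subrK.
have : B (2 *: v) (2 *: v) = B (B w v *: w) (B w v *: w) by rewrite E2.
rewrite !symE !Phi_norm // => k2.
have /eqP : B w v ^+ 2 = 2 ^+ 2 by lra.
have n2 : 2 != 0 :> R by rewrite pnatr_eq0.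
rewrite eqf_sqr => /orP[/eqP k|/eqP k]; [left|right];
  by apply: (scalerI n2); rewrite E2 k ?scalerN ?scaleNr.
Qed.

Lemma rt_opp v : rt (- v) = rt v.
Proof.
rewrite linearN linearN; set u := vsproj _ _; congr linfun.
apply: funext => x; rewrite /reflect_fun /form_tilde.
have -> : vsval (- u) = - vsval u by rewrite linearN.
by rewrite !symE opprK mulrN mulNr scaleNr scalerN !opprK.
Qed.

Lemma rt_eq v w : Phi v -> Phi w -> refl B v = refl B w -> rt v = rt w.
Proof. by move=> Pv Pw /(refl_eq Pv Pw)[->|->] //; rewrite rt_opp. Qed.

Lemma agree_VP gs : all_in Phi gs ->
  lprod [seq refl B g | g <- gs] = c <-> forall v, rp B gs v = rp B es v.
Proof.
move=> /all_Phi_norm ng; rewrite coxeterE; split=> [E v|E].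
  by rewrite -!lprod_refl // E.
by apply/lfunP => v; rewrite !lprod_refl.
Qed.

(** Agreement at [b'] makes the parameter of [agree_V] vanish, so agreement on
    [Vt] extends to the whole cover. *)
Lemma agree_tildeP gs : all_in Phi gs ->
  lprod [seq rt g | g <- gs] = ct <-> forall x, P gs x = P es x.
Proof.
move=> Pg; rewrite coxeter_tildeE; split=> [E|E]; last first.
  by apply/lfunP => y; apply: val_inj; rewrite /= !tilde_word.
have Et x : x \in Vt -> P gs x = P es x.
  by move=> xV; rewrite -(vsprojK xV) -!tilde_word // E.
have EV v : rp B gs v = rp B es v.
  by apply: inj; rewrite -!(rp_morph (B := B) iso) Et ?iota_Vt.
have [k Hk] := agree_V cover (all_Phi_norm Pg) esnorm EV.
have := Hk b'; rewrite Et ?b'_Vt // (pair_bb' ext) (pair_ab' ext) scale1r scale0r subr0.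
move=> /eqP; rewrite -[X in X == _]addr0 (inj_eq (addrI _)) eq_sym -linearZ /=.
rewrite -(linear0 iota) (inj_eq inj) scaler_eq0 (negPf (a_neq0 D)) orbF => /eqP k0 x.
by rewrite Hk k0 scale0r addr0.
Qed.

Lemma tilde_agree_V gs : all_in Phi gs -> lprod [seq rt g | g <- gs] = ct ->
  lprod [seq refl B g | g <- gs] = c.
Proof.
move=> Pg /(agree_tildeP Pg) E; apply/(agree_VP Pg) => v; apply: inj.
by rewrite -!(rp_morph (B := B) iso) E.
Qed.

Let mt2 : (2 : R) <= (m t)%:R. Proof. by rewrite ler_nat (mt_ge2 D tub). Qed.

Let all_L gs : all_in Phi gs -> forall g, g \in gs -> L g.
Proof. by move=> Pg g /Pg Phig; apply/(zspan_es D posdef Phi_adj)/zspan_id. Qed.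

Lemma full_length gs : all_in Phi gs -> lprod [seq refl B g | g <- gs] = c ->
  (n.+2 <= size gs)%N.
Proof.
move=> Pg /(agree_VP Pg) E; rewrite -(size_es D tub n_gt0).
apply: (agree_size cover cox) => //; last exact: all_L.
exact: all_Phi_norm.
Qed.

Lemma Phi_rp gs e : all_in Phi gs -> Phi e -> Phi (rp B gs e).
Proof.
by elim: gs => //= g gs IH /all_in_cons[Pg /IH H] /H; apply: (Phi_refl D).
Qed.

Lemma rt_invol v : Phi v -> (rt v \o rt v)%VF = \1%VF.
Proof.
move=> Pv; apply/lfunP => y; apply: val_inj; rewrite comp_lfunE id_lfunE.
by rewrite -[LHS]/(vsval _) !refl_tilde // rsK // iso Phi_norm.
Qed.

Lemma refl_inv v : Phi v -> (refl B v \o refl B v)%VF = \1%VF.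
Proof. by move=> /Phi_norm; apply: refl_invol. Qed.

Lemma lfun_tilde (f g : 'End(subvs_of Vt)) : (forall x, vsval (f x) = vsval (g x)) -> f = g.
Proof. by move=> E; apply/lfunP => x; apply/val_inj/E. Qed.

Lemma refl_conj gs e : all_in Phi gs -> Phi e ->
  (lprod [seq refl B g | g <- gs] \o refl B e \o (lprod [seq refl B g | g <- gs])^-1)%VF
  = refl B (rp B gs e).
Proof.
move=> Pg Pe; rewrite (word_inv refl_inv) // -comp_lfunA; apply/lfunP => x.
have PP : B (rp B gs e) (rp B gs e) = 2 by apply/Phi_norm/Phi_rp.
have ng := all_Phi_norm Pg; have nrg := all_Phi_norm (all_in_rev Pg).
by rewrite (reflE _ PP) rs_rp // !comp_lfunE !lprod_refl // reflE // Phi_norm.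
Qed.

Lemma tilde_conj gs e : all_in Phi gs -> Phi e ->
  (lprod [seq rt g | g <- gs] \o rt e \o (lprod [seq rt g | g <- gs])^-1)%VF
  = rt (rp B gs e).
Proof.
move=> Pg Pe; rewrite (word_inv rt_invol) // -comp_lfunA; apply: lfun_tilde => x.
rewrite !comp_lfunE (tilde_word _ Pg) (refl_tilde _ Pe) (tilde_word _ (all_in_rev Pg)).
rewrite (refl_tilde _ (Phi_rp Pg Pe)) -(rp_morph (B := B) iso) rs_rp ?map_rev //.
by apply: (norm2_morph iso); apply: all_Phi_norm.
Qed.

Let es_connected : connected_set B [set g | g \in es].
Proof.
have Bt2 : B (alpha t) (alpha t + a) != 0.
  by rewrite symDr (radicalr _ (rad_a D)) addr0 Phi_norm // pnatr_eq0.
have al i : alpha i \in es by apply: alpha_es.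
have ea : alpha t + a \in es by apply/mem_es; right.
move=> S [g0 /= ge Sg0] step.
have Sal : forall g, range alpha g -> S g.
  apply: (alpha_connected D posdef).
    have [[i gE]|gE] := (mem_es a alpha t g0).1 ge.
      by exists g0 => //; exists i.
    exists (alpha t); first by exists t.
    by apply: (step g0) => //=; rewrite gE symC.
  by move=> _ _ [i _ <-] [j _ <-]; apply: step.
move=> g /= /mem_es[[i ->]|->]; first by apply: Sal; exists i.
by apply: (step (alpha t)) => //=; apply: Sal; exists t.
Qed.

Let es_radical x : (forall g, g \in es -> B x g = 0) -> radical B x.
Proof. by move=> H; apply: (alpha_span D) => i; apply/H/alpha_es. Qed.

Let alpha_adj' : exists g h, [/\ g \in es, h \in es & adj B g h].
Proof.
have [_ [_ [[i _ <-] [j _ <-] ij]]] := alpha_adj D posdef Phi_adj.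
by exists (alpha i), (alpha j); split=> //; apply: alpha_es.
Qed.

Lemma Phi_orbit gs v : all_in Phi gs -> (forall x, L x -> zspan [set g | g \in gs] x) ->
  Phi v -> exists w e, [/\ {subset w <= gs}, e \in gs & v = rp B w e].
Proof.
move=> Pg Lg Pv.
have gn := all_Phi_norm Pg.
have gi g h : g \in gs -> h \in gs -> B g h \is a Num.int.
  by move=> /Pg Pg' /Pg Ph; apply: (Phi_int D).
apply: (orbit_roots (psd D posdef) (psd0 D posdef) gn gi) => //.
- apply: (connected_generators (psd D posdef) (psd0 D posdef) gn gi es_connected).
  + exact: esnorm.
  + by move=> e /= ee; apply/Lg/zspan_id.
  + exact: es_radical.
- move=> x H; apply: es_radical => e ee.
  have : zspan [set g | g \in gs] e by apply/Lg/zspan_id.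
  move: e {ee}; apply: zspan_ind => [|y z hy hz|g gg]; rewrite ?sym0r //.
    by rewrite symBr hy hz subr0.
  exact: H.
- have [g [h [ge he gh]]] := alpha_adj'.
  by apply: (adj_generators (psd D posdef) (psd0 D posdef) gn gi _ _ gh); apply/Lg/zspan_id.
- by apply/Lg/(zspan_es D posdef Phi_adj)/zspan_id.
- exact: Phi_norm.
Qed.

Lemma root_es i : root i \in es.
Proof. by apply/mem_es; case: i => [i|]; [left; exists i|right]. Qed.

Lemma es_root g : g \in es -> exists i, g = root i.
Proof. by move=> /mem_es[[i ->]|->]; [exists (Some i)|exists None]. Qed.

(** All roots are conjugate to the roots of the Coxeter word by [Phi_orbit], so the
    conjugates of its reflections are the reflections in all roots. *)
Lemma T_E x : T x <-> exists2 v, Phi v & x = refl B v.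
Proof.
split=> [[w [_ [Ww [i _ <-] ->]]]|[v Pv ->]].
  have /(generated_wordP refl_inv)[|gs Pg ->] := Ww; first by [].
  have Pr : Phi (root i) by apply/esPhi/root_es.
  exists (rp B gs (root i)); first exact: Phi_rp.
  by rewrite refl_conj.
have [w [e [we ee ->]]] := Phi_orbit esPhi (fun x => id) Pv.
exists (lprod [seq refl B g | g <- w]), (refl B e); split.
- apply/(generated_wordP refl_inv) => //.
  by exists w => // g /we /esPhi.
- by have [i ->] := es_root ee; exists i.
- by rewrite refl_conj //; [move=> g /we /esPhi | apply: esPhi].
Qed.

Lemma Wt_range : Wt = generated [set rt v | v in [set g | g \in es]].
Proof.
congr generated; apply/seteqP; split=> x.
  by move=> [i _ <-]; exists (root i) => //; apply: root_es.
by move=> [v /= /es_root[i ->] <-]; exists i.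
Qed.

Lemma Tt_E x : Tt x <-> exists2 v, Phi v & x = rt v.
Proof.
have esP : [set g | g \in es] `<=` Phi by move=> g /= /esPhi.
rewrite Wt_range; split=> [[w [_ [Ww [i _ <-] ->]]]|[v Pv ->]].
  have /(generated_wordP rt_invol _ esP)[gs Pg ->] := Ww.
  have Pr : Phi (root i) by apply/esPhi/root_es.
  have Pg' : all_in Phi gs by move=> g /Pg /esPhi.
  exists (rp B gs (root i)); first exact: Phi_rp.
  by rewrite tilde_conj.
have [w [e [we ee ->]]] := Phi_orbit esPhi (fun x => id) Pv.
exists (lprod [seq rt g | g <- w]), (rt e); split.
- by apply/(generated_wordP rt_invol _ esP); exists w.
- by have [i ->] := es_root ee; exists i.
- by rewrite tilde_conj //; [move=> g /we /esPhi | apply: esPhi].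
Qed.

(** If the reflections in [gs] generate the group, the reflection in a root [e] is
    a word in them and moves a neighbour of [e] by [e] or [- e], which lies in
    the span of [gs]. Conversely, if [gs] spans the lattice, then every root is
    conjugate to a member of [gs] by [Phi_orbit]. *)
Lemma generating_lattice gs : all_in Phi gs ->
  generated [set x | x \in [seq refl B g | g <- gs]] = W <->
  forall v, L v -> zspan [set g | g \in gs] v.
Proof.
move=> Pg; have sub : [set g | g \in gs] `<=` Phi by move=> g /= /Pg.
have -> : [set x | x \in [seq refl B g | g <- gs]] =
    [set refl B g | g in [set g | g \in gs]].
  apply/seteqP; split=> x /=; first by move=> /mapP[g gg ->]; exists g.
  by move=> [g gg <-]; apply: map_f.
split=> [E v Lv|Lg].
  move: v Lv; apply: zspan_ind; [exact: zspan0|by move=> *; apply: zspanB|].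
  move=> e /= /esPhi Pe.
  have : W (refl B e) by apply: gen_in; exists e.
  rewrite -E => /(generated_wordP refl_inv _ sub)[w wg we].
  have [x ex xe] : exists2 x, Phi x & adj B e x.
    have G_Psi : [set alpha i | i in setT] `<=` Phi by move=> _ [i _ <-].
    have [_ [i _ <-] ei] := Psi_neighbour (psd D posdef) (psd0 D posdef) Phi_norm
      (fun x y => @Phi_int _ _ _ _ _ _ _ _ _ _ _ _ _ D x y) G_Psi (alpha_connected D posdef)
      (fun x H => alpha_span D (fun i => H _ (ex_intro2 _ _ i I erefl))) (alpha_adj D posdef Phi_adj) Pe.
    by exists (alpha i).
  have : zspan [set g | g \in w] (x - rp B w x).
    apply: (rp_zspan (S := Phi)) => [g h||g /wg gg].
    - exact: (Phi_int D).
    - by move=> g /wg /= /Pg.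
    - by apply: (Phi_int D) => //; apply: Pg.
  have nw : norm2 B w by apply: all_Phi_norm => g /wg /= /Pg.
  rewrite -lprod_refl // -we reflE ?Phi_norm // /rs subKr => Z.
  have {}Z : zspan [set g | g \in gs] (B e x *: e).
    by move: Z; apply: zspan_sub => g /wg; apply: zspan_id.
  case: xe Z => ->; rewrite ?scale1r // scaleN1r => /zspanN.
  by rewrite opprK.
apply/seteqP; split=> w.
  move=> /(generated_wordP refl_inv _ sub)[gs' Hg ->].
  by apply/(generated_wordP refl_inv _ (@subset_refl _ Phi)); exists gs' => // g /Hg /= /Pg.
elim=> {w} [_ [v Pv <-]||w1 w2 _ h1 _ h2|w _ h].
- have [w [e [we ee ->]]] := Phi_orbit Pg Lg Pv.
  have Pw : all_in Phi w by move=> g /we /Pg.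
  rewrite -refl_conj //; last exact: Pg.
  have gw : generated [set refl B g | g in [set g | g \in gs]] (lprod [seq refl B g | g <- w]).
    by apply/(generated_wordP refl_inv _ sub); exists w.
  apply: gen_mul; last exact: gen_inv.
  by apply: gen_mul => //; apply: gen_in; exists e.
- exact: gen_1.
- exact: gen_mul.
- exact: gen_inv.
Qed.

Lemma phi_map gs : all_in Phi gs ->
  [seq phi x | x <- [seq rt g | g <- gs]] = [seq refl B g | g <- gs].
Proof. by move=> Pg; rewrite -map_comp; apply/eq_in_map => g /Pg; apply: phi_rt. Qed.

Lemma map_rt_eq gs hs : all_in Phi gs -> all_in Phi hs ->
  [seq refl B g | g <- gs] = [seq refl B g | g <- hs] ->
  [seq rt g | g <- gs] = [seq rt g | g <- hs].
Proof.
elim: gs hs => [|g gs IH] [|h hs] //= /all_in_cons[Pg Pgs] /all_in_cons[Ph Phs] [e E].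
by rewrite (rt_eq Pg Ph e) (IH hs).
Qed.

Lemma T_list s : (forall x, x \in s -> T x) ->
  exists2 gs, all_in Phi gs & s = [seq refl B g | g <- gs].
Proof. by move=> sT; apply: list_preimage => x /sT/T_E. Qed.

Lemma Tt_list s : (forall x, x \in s -> Tt x) ->
  exists2 gs, all_in Phi gs & s = [seq rt g | g <- gs].
Proof. by move=> sT; apply: list_preimage => x /sT/Tt_E. Qed.

Lemma T_map gs x : all_in Phi gs -> x \in [seq refl B g | g <- gs] -> T x.
Proof. by move=> Pg /mapP[g /Pg Phig ->]; apply/T_E; exists g. Qed.

Lemma Tt_map gs x : all_in Phi gs -> x \in [seq rt g | g <- gs] -> Tt x.
Proof. by move=> Pg /mapP[g /Pg Phig ->]; apply/Tt_E; exists g. Qed.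

Lemma coxeter_length : has_length T c n.+2.
Proof.
split.
  exists [seq refl B g | g <- es]; last by rewrite size_map (size_es D tub n_gt0).
  by split=> [x|]; [apply: T_map | rewrite coxeterE].
by move=> s [/T_list[gs Pg ->]]; rewrite size_map; apply: full_length.
Qed.

Lemma coxeter_tilde_length : has_length Tt ct n.+2.
Proof.
split.
  exists [seq rt g | g <- es]; last by rewrite size_map (size_es D tub n_gt0).
  by split=> [x|]; [apply: Tt_map | rewrite coxeter_tildeE].
move=> s [/Tt_list[gs Pg ->] E]; rewrite size_map; apply: full_length => //.
exact: tilde_agree_V.
Qed.

Lemma length_unique (X : vectType R) (S : set 'End(X)) w k l :
  has_length S w k -> has_length S w l -> k = l.
Proof.
move=> [[s fs <-] mink] [[s' fs' <-] minl].
by apply/eqP; rewrite eqn_leq mink ?minl.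
Qed.

Lemma Red_tildeP s : Red Tt ct s <-> exists gs, [/\ all_in Phi gs, size gs = n.+2,
  lprod [seq rt g | g <- gs] = ct & s = [seq rt g | g <- gs]].
Proof.
split=> [[[sT sE] sl]|[gs [Pg sz E ->]]].
  have [gs Pg gE] := Tt_list sT; exists gs; split=> //; last by rewrite -gE.
  by rewrite -(length_unique sl coxeter_tilde_length) gE size_map.
split; last by rewrite size_map sz; apply: coxeter_tilde_length.
by split=> // x; apply: Tt_map.
Qed.

Lemma Red_genP s : Red_gen T W n.+2 c s <-> exists gs, [/\ all_in Phi gs, size gs = n.+2,
  lprod [seq refl B g | g <- gs] = c, s = [seq refl B g | g <- gs]
  & forall v, L v -> zspan [set g | g \in gs] v].
Proof.
split=> [[[[sT sE] _] sz sW]|[gs [Pg sz E -> Lg]]].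
  have [gs Pg gE] := T_list sT; exists gs; split=> //.
  - by rewrite -sz gE size_map.
  - by rewrite -gE.
  - by apply/(generating_lattice Pg); rewrite -gE.
split; [split | by rewrite size_map|exact/generating_lattice].
  by split=> // x; apply: T_map.
by rewrite size_map sz; apply: coxeter_length.
Qed.

Lemma tilde_lattice gs : all_in Phi gs -> lprod [seq rt g | g <- gs] = ct ->
  forall v, L v -> zspan [set g | g \in gs] v.
Proof.
move=> Pg /(agree_tildeP Pg) E; apply: (cover_lattice cover cox) => //.
exact: all_L.
Qed.

Lemma Red_tilde_gen gs : all_in Phi gs -> size gs = n.+2 ->
  lprod [seq rt g | g <- gs] = ct -> Red_gen T W n.+2 c [seq refl B g | g <- gs].
Proof.
move=> Pg sz E; apply/Red_genP; exists gs; split=> //; first exact: tilde_agree_V.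
exact: tilde_lattice.
Qed.

(** A generating factorization of [c] is a basis of the lattice, so by
    [agree_generating] it lifts to a factorization of [ct] up to a transvection
    whose parameter [k] satisfies [1 - k m_t = 1] or [1 - k m_t = -1]. *)
Lemma gen_parameter gs : all_in Phi gs -> size gs = n.+2 ->
  lprod [seq refl B g | g <- gs] = c -> (forall v, L v -> zspan [set g | g \in gs] v) ->
  exists k : R, [/\ k \is a Num.int, k * (m t)%:R = 0 \/ k * (m t)%:R = 2 &
    forall x, P gs x = P es x +
      k *: (Bhat (iota b) x *: iota a - Bhat (iota a) x *: iota b)].
Proof.
move=> Pg sz /(agree_VP Pg) E Lg.
have fg : free gs.
  rewrite /free eqn_leq dim_span sz -V_dim -(es_full D t) dimvS //.
  apply/span_subvP => e ee.
  have : zspan [set g | g \in gs] e by apply/Lg/zspan_id.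
  move: (e); apply: zspan_ind => [|x y hx hy|g gg]; first exact: mem0v.
    exact: memvB.
  exact: memv_span.
have [k [kint km Hk]] := agree_generating cover cox (all_Phi_norm Pg) (all_L Pg) E fg Lg.
by exists k; split=> //; case: km => km; [left|right]; lra.
Qed.

(** For [m t] at least 3 an integer [k] with [k m_t = 0] or [k m_t = 2] is 0, so
    every generating factorization of [c] lifts to one of [ct]. *)
Lemma Red_bij : (3 <= m t)%N -> set_bij (Red Tt ct) (Red_gen T W n.+2 c) (map phi).
Proof.
move=> m3; split.
- move=> _ /= /Red_tildeP[gs [Pg sz E ->]]; rewrite phi_map //.
  exact: Red_tilde_gen.
- move=> s s'; rewrite !inE => /Red_tildeP[gs [Pg _ _ ->]] /Red_tildeP[hs [Ph _ _ ->]].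
  by rewrite !phi_map //; apply: map_rt_eq.
- move=> _ /= /Red_genP[gs [Pg sz E -> Lg]].
  exists [seq rt g | g <- gs]; last by rewrite phi_map.
  apply/Red_tildeP; exists gs; split=> //.
  have [k [kint km Hk]] := gen_parameter Pg sz E Lg.
  suff k0 : k = 0 by apply/(agree_tildeP Pg) => x; rewrite Hk k0 scale0r addr0.
  have m3R : (3 : R) <= (m t)%:R by rewrite ler_nat.
  apply/eqP/negPn/negP => kn.
  exact: (small_multiple m3R (norm_intr_ge1 kint kn) km).
Qed.

End Factorizations.

(** * Braid words *)

(** A letter [(i, e)] of a braid word moves the [i]-th and the next member of a
    sequence past each other, conjugating the one that moves left if [e] is
    false and the one that moves right if [e] is true. *)
Section BraidWords.

Definition braid_word := seq (nat * bool).

Fixpoint act1 (X : Type) (op : X -> X -> X) (i : nat) (e : bool) (l : seq X) : seq X :=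
  match i, l with
  | 0, x :: y :: q => if e then y :: op y x :: q else op x y :: x :: q
  | i'.+1, x :: q => x :: act1 op i' e q
  | _, _ => l
  end.

Definition act (X : Type) (op : X -> X -> X) (w : braid_word) (l : seq X) : seq X :=
  foldl (fun l p => act1 op p.1 p.2 l) l w.

Lemma act_cat (X : Type) (op : X -> X -> X) v w l :
  act op (v ++ w) l = act op w (act op v l).
Proof. by rewrite /act foldl_cat. Qed.

Lemma act_map (X Y : Type) (op : X -> X -> X) (op' : Y -> Y -> Y) (h : X -> Y) :
  (forall x y, h (op x y) = op' (h x) (h y)) ->
  forall w l, map h (act op w l) = act op' w (map h l).
Proof.
move=> hop; elim=> // -[i e] w IH l; rewrite /= IH; congr act.
elim: i l => [|i IHi] [|x l] //=; last by rewrite IHi.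
by case: l => // y l; case: e; rewrite /= hop.
Qed.

(** At each stage the first word after which the test succeeds is applied; the
    correctness of the outcome is verified by computation on all inputs. *)
Fixpoint search (X : Type) (op : X -> X -> X)
    (stages : seq ((seq X -> bool) * seq braid_word)) (l : seq X) : braid_word :=
  match stages with
  | [::] => [::]
  | (test, ws) :: stages' =>
    let w := nth [::] ws (find (fun w => test (act op w l)) ws) in
    w ++ search op stages' (act op w l)
  end.

Fixpoint lists (X : Type) (s : seq X) (k : nat) : seq (seq X) :=
  if k is k'.+1 then [seq x :: l | x <- s, l <- lists s k'] else [:: [::]].

Lemma mem_lists (X : eqType) (s : seq X) (l : seq X) :
  {subset l <= s} -> l \in lists s (size l).
Proof.
elim: l => //= x l IH H; apply/allpairsP; exists (x, l) => /=; split=> //.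
  by apply: H; rewrite mem_head.
by apply: IH => y yl; apply: H; rewrite inE yl orbT.
Qed.

End BraidWords.

(** * The finite root system of type D4 and its elliptic extension *)

Notation fin4 := (int * int * int * int)%type.

(** The form of type D4 in the basis of simple roots, the second of which is
    the branch vertex. *)
Definition ip (x y : fin4) : int :=
  let: (x1, x2, x3, x4) := x in let: (y1, y2, y3, y4) := y in
  2 * (x1 * y1 + x2 * y2 + x3 * y3 + x4 * y4)
  - x2 * (y1 + y3 + y4) - y2 * (x1 + x3 + x4).

Section IntegralReflections.
Variables (X : zmodType) (p : X -> X -> int).

Definition qrs (g x : X) : X := x - g *~ p g x.

Definition pm (x y : X) := (x == y) || (x == - y).

Hypothesis pL : forall x y z k, p x (y - z *~ k) = p x y - p x z * k.
Hypothesis pC : forall x y, p x y = p y x.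

Lemma pN x y : p x (- y) = - p x y.
Proof.
have p0 : p x 0 = 0 by have := pL x 0 0 1; rewrite mulr1z subrr => ->; rewrite mulr1 subrr.
by have := pL x 0 y 1; rewrite mulr1z sub0r p0 sub0r mulr1.
Qed.

Lemma qrs_lin g x y k : qrs g (x - y *~ k) = qrs g x - qrs g y *~ k.
Proof.
rewrite /qrs pL mulrzBr mulrzBl -mulrzA !opprB addrACA [RHS]addrACA.
by congr (_ + _); apply: addrC.
Qed.

Lemma qrs_neg g x : p g g = 2 -> p g (qrs g x) = - p g x.
Proof. by move=> gg; rewrite pL gg; lia. Qed.

Lemma qrsK g : p g g = 2 -> involutive (qrs g).
Proof.
by move=> gg x; rewrite {1}/qrs qrs_neg // mulrNz opprK subrK.
Qed.

Lemma qrs_iso g x y : p g g = 2 -> p (qrs g x) (qrs g y) = p x y.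
Proof.
move=> gg; rewrite [LHS]pL (pC _ g) qrs_neg // pC pL (pC y x) (pC y g); lia.
Qed.

Lemma qrs_conj g x y : p g g = 2 -> qrs (qrs g x) y = qrs g (qrs x (qrs g y)).
Proof.
move=> gg; rewrite {3}/qrs -/(qrs _ _) qrs_lin qrsK // -(qrs_iso x (qrs g y) gg) qrsK //.
Qed.

Lemma qrs_opp g x : qrs (- g) x = qrs g x.
Proof. by rewrite /qrs pC pN (pC x g) mulNrz mulrNz opprK. Qed.

Lemma qrs_oppr g x : qrs g (- x) = - qrs g x.
Proof. by rewrite /qrs pN mulrNz opprK opprD opprK. Qed.

Definition qfold (l : seq X) (x : X) := foldr qrs x l.

Definition norm2s (l : seq X) := forall g, g \in l -> p g g = 2.

(** A move replaces one of two neighbours by its conjugate by the other one, which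
    keeps the product, and conjugating back recovers the former member. *)
Lemma act1_facts i e l : norm2s l -> let l' := act1 qrs i e l in
  [/\ norm2s l', size l' = size l, forall x, qfold l' x = qfold l x &
    forall H : X -> Prop, (forall x y k, H x -> H y -> H (x - y *~ k)) ->
      (forall g, g \in l' -> H g) -> forall g, g \in l -> H g].
Proof.
elim: i l => [|i IH] [|x l] //= nl.
  case: l nl => [|y l] nl //=.
  have nx : p x x = 2 by apply: nl; rewrite mem_head.
  have ny : p y y = 2 by apply: nl; rewrite !inE eqxx orbT.
  have nn g : g \in l -> p g g = 2 by move=> gl; apply: nl; rewrite !inE gl !orbT.
  case: e; split=> //.
  - by move=> g; rewrite !inE => /orP[/eqP->//|/orP[/eqP->|/nn//]]; rewrite qrs_iso.
  - by move=> v /=; rewrite qrs_conj // qrsK.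
  - move=> H HL Hl g; rewrite !inE => /orP[/eqP->|/orP[/eqP->|gl]].
    + rewrite -(qrsK ny x); apply: HL; apply: Hl; rewrite !inE eqxx ?orbT //.
    + by apply: Hl; rewrite mem_head.
    + by apply: Hl; rewrite !inE gl !orbT.
  - by move=> g; rewrite !inE => /orP[/eqP->|/orP[/eqP->//|/nn//]]; rewrite qrs_iso.
  - by move=> v /=; rewrite qrs_conj // qrsK.
  - move=> H HL Hl g; rewrite !inE => /orP[/eqP->|/orP[/eqP->|gl]].
    + by apply: Hl; rewrite !inE eqxx orbT.
    + rewrite -(qrsK nx y); apply: HL; apply: Hl; rewrite !inE eqxx ?orbT //.
    + by apply: Hl; rewrite !inE gl !orbT.
have nx : p x x = 2 by apply: nl; rewrite mem_head.
have [|n' s' f' H'] := IH l; first by move=> g gl; apply: nl; rewrite inE gl orbT.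
split.
- by move=> g; rewrite inE => /orP[/eqP->|/n'].
- by rewrite /= s'.
- by move=> v /=; rewrite -/(qfold _ v) f'.
- move=> H HL Hl g; rewrite inE => /orP[/eqP->|gl]; first by apply: Hl; rewrite mem_head.
  by apply: (H' H HL) gl => h hl; apply: Hl; rewrite inE hl orbT.
Qed.

Lemma act_facts w l : norm2s l -> let l' := act qrs w l in
  [/\ norm2s l', size l' = size l, forall x, qfold l' x = qfold l x &
    forall H : X -> Prop, (forall x y k, H x -> H y -> H (x - y *~ k)) ->
      (forall g, g \in l' -> H g) -> forall g, g \in l -> H g].
Proof.
elim: w l => [|[i e] w IH] l nl; first by split.
have [n1 s1 f1 H1] := act1_facts i e nl.
have [n2 s2 f2 H2] := IH _ n1.
split=> //=; first by rewrite s2.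
- by move=> x; rewrite f2 f1.
- by move=> H HL Hl; apply: H1 => //; apply: H2.
Qed.

(** Opposite roots have the same reflection, so sequences of roots are compared up
    to the signs of their members. *)
Definition pml (l l' : seq X) := all2 pm l l'.

Lemma pm_refl x : pm x x. Proof. by rewrite /pm eqxx. Qed.

Lemma pml_refl l : pml l l.
Proof. by rewrite /pml; elim: l => //= x l IH; rewrite pm_refl. Qed.

Lemma pm_trans x y z : pm x y -> pm y z -> pm x z.
Proof.
rewrite /pm => /orP[/eqP->|/eqP->] //; rewrite (inj_eq oppr_inj) eqr_oppLR.
by rewrite orbC.
Qed.

Lemma pml_trans l1 l2 l3 : pml l1 l2 -> pml l2 l3 -> pml l1 l3.
Proof.
rewrite /pml; elim: l1 l2 l3 => [|x l1 IH] [|y l2] [|z l3] //=.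
move=> /andP[xy h] /andP[yz k]; apply/andP; split; first exact: pm_trans yz.
exact: IH h k.
Qed.

Lemma qrs_pm g g' x x' : pm g g' -> pm x x' -> pm (qrs g x) (qrs g' x').
Proof.
rewrite /pm => /orP[/eqP->|/eqP->] /orP[/eqP->|/eqP->];
by rewrite ?qrs_opp ?qrs_oppr eqxx ?orbT.
Qed.

Lemma act1_pml i e l l' : pml l l' -> pml (act1 qrs i e l) (act1 qrs i e l').
Proof.
rewrite /pml; elim: i l l' => [|i IH] [|x l] [|y l'] //=; last by case/andP=> -> /IH.
by case: e; case: l l' => [|z l] [|w l'] //=; rewrite ?andbF // => /andP[xy] /andP[zw ->];
  rewrite ?xy ?zw qrs_pm.
Qed.

Lemma act_pml w l l' : pml l l' -> pml (act qrs w l) (act qrs w l').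
Proof. by elim: w l l' => //= -[i e] w IH l l' h; apply/IH/act1_pml. Qed.

Lemma pml_facts l l' : pml l l' ->
  [/\ norm2s l -> norm2s l', size l = size l', forall x, qfold l x = qfold l' x &
    forall H : X -> Prop, (forall x y k, H x -> H y -> H (x - y *~ k)) ->
      (forall g, g \in l' -> H g) -> forall g, g \in l -> H g].
Proof.
rewrite /pml; elim: l l' => [|x l IH] [|y l'] //=.
move=> /andP[xy /IH[n s f h]].
have xyE : x = y \/ x = - y by case/orP: xy => /eqP; [left|right].
split.
- move=> nl g; rewrite inE => /orP[/eqP->|].
    have := nl x (mem_head _ _); case: xyE => -> //.
    by rewrite pN pC pN opprK.
  by move=> gl; apply: (n _ _ gl) => k kl; apply: nl; rewrite inE kl orbT.
- by rewrite s.
- by move=> v /=; rewrite f; case: xyE => -> //; rewrite qrs_opp.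
- move=> H HL Hl g; rewrite inE => /orP[/eqP->|gl].
    have Hy : H y by apply: Hl; rewrite mem_head.
    case: xyE => -> //.
    have H0 : H 0 by have := HL y y 1 Hy Hy; rewrite mulr1z subrr.
    by have := HL 0 y 1 H0 Hy; rewrite mulr1z sub0r.
  by apply: (h H HL) gl => k kl; apply: Hl; rewrite inE kl orbT.
Qed.

End IntegralReflections.

Definition frs := qrs ip.
Definition crs (M : zmodType) := qrs (fun g x : fin4 * M => ip g.1 x.1).

Definition e1 : fin4 := (1, 0, 0, 0).
Definition e2 : fin4 := (0, 1, 0, 0).
Definition e3 : fin4 := (0, 0, 1, 0).
Definition e4 : fin4 := (0, 0, 0, 1).
Definition e0 : fin4 := (-1, -2, -1, -1).


Definition star_roots : seq fin4 := [:: e1; e3; e4; e0; e2; e2].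

(** The sequences with finite parts [star_roots] whose product is the same as for
    [s = u = 0]; the parameters [s] and [u] are radical vectors. *)
Definition tup (M : zmodType) (a b s u : M) : seq (fin4 * M) :=
  [:: (e1, s); (e3, s); (e4, s); (e0, s + b); (e2, u - s *+ 2); (e2, u + a)].

(** Formal coefficients with respect to [a], [b], [s] and [u]. *)
Notation int4 := (int * int * int * int)%type.

Definition fa : int4 := (1, 0, 0, 0).
Definition fb : int4 := (0, 1, 0, 0).
Definition fs : int4 := (0, 0, 1, 0).
Definition fu : int4 := (0, 0, 0, 1).
(** With [delta = a + 2 s] and [rho = b + 2 u], the braid words below add [delta]
    to [u] or subtract it, add [rho] to [s] or subtract it, and change the signs
    of [delta] and [rho]. So the pair of [delta] and [rho] is transformed by the
    principal congruence subgroup of level 2. *)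
Definition fdelta : int4 := (1, 0, 2, 0).
Definition frho : int4 := (0, 1, 0, 2).

Definition w_u : braid_word := [:: (4, true)]%N.
Definition w_u' : braid_word := [:: (4, false)]%N.
Definition w_s : braid_word :=
  [:: (3, false); (2, true); (1, false); (0, true); (1, false); (2, true); (3, false);
      (2, false); (1, true); (0, false); (1, true); (2, false); (3, true)]%N.
Definition w_s' : braid_word :=
  [:: (3, true); (2, true); (1, true); (0, false); (1, true); (2, true); (3, false);
      (2, true); (1, true); (0, false); (1, true); (2, true); (3, true)]%N.
Definition w_neg : braid_word :=
  [:: (3, true); (2, true); (1, false); (0, false); (4, true); (3, true); (2, false);
      (1, true); (2, false); (3, true); (4, true); (0, false); (1, false); (2, true);
      (3, true)]%N.

Definition ftup_eq (w : braid_word) (s u : int4) :=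
  all2 (@pm _) (act (@crs _) w (tup fa fb fs fu)) (tup fa fb s u).

Lemma ftup_u : ftup_eq w_u fs (fu + fdelta).
Proof. by vm_compute. Qed.
Lemma ftup_u' : ftup_eq w_u' fs (fu - fdelta).
Proof. by vm_compute. Qed.
Lemma ftup_s : ftup_eq w_s (fs + frho) fu.
Proof. by vm_compute. Qed.
Lemma ftup_s' : ftup_eq w_s' (fs - frho) fu.
Proof. by vm_compute. Qed.
Lemma ftup_neg : ftup_eq w_neg (- fs - fa) (- fu - fb).
Proof. by vm_compute. Qed.

Lemma pair_mulrz (A A' : zmodType) (x : A * A') (k : int) :
  x *~ k = (x.1 *~ k, x.2 *~ k).
Proof. by rewrite [LHS]surjective_pairing (raddfMz fst) (raddfMz snd). Qed.

Lemma mulrz_line (M : zmodType) (c : M) (i j k : int) :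
  c *~ (i - j * k) = c *~ i - c *~ j *~ k.
Proof. by rewrite mulrzBr mulrzA. Qed.

Lemma mulrz_plane (M : zmodType) (x y z t : M) (k : int) :
  x - y *~ k + (z - t *~ k) = x + z - (y + t) *~ k.
Proof. by rewrite mulrzDl opprD addrACA. Qed.

Lemma fin4_lin (x1 x2 x3 x4 y1 y2 y3 y4 k : int) :
  ((x1, x2, x3, x4) - (y1, y2, y3, y4) *~ k : fin4) =
  (x1 - y1 * k, x2 - y2 * k, x3 - y3 * k, x4 - y4 * k).
Proof. by rewrite !pair_mulrz /= -!mulrzz. Qed.

Lemma ipL (x y z : fin4) k : ip x (y - z *~ k) = ip x y - ip x z * k.
Proof.
case: x => [[[x1 x2] x3] x4]; case: y => [[[y1 y2] y3] y4].
by case: z => [[[z1 z2] z3] z4]; rewrite fin4_lin /ip; ring.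
Qed.

Lemma ipC (x y : fin4) : ip x y = ip y x.
Proof.
case: x => [[[x1 x2] x3] x4]; case: y => [[[y1 y2] y3] y4].
by rewrite /ip; ring.
Qed.

Section Coordinates.
Variable M : zmodType.
Definition cip (x y : fin4 * M) := ip x.1 y.1.

Lemma cipL x y z k : cip x (y - z *~ k) = cip x y - cip x z * k.
Proof. by rewrite /cip raddfB raddfMz /= ipL. Qed.

Lemma cipC x y : cip x y = cip y x.
Proof. exact: ipC. Qed.

Lemma crs_fst (g x : fin4 * M) : (crs g x).1 = frs g.1 x.1.
Proof. by rewrite /crs /frs /qrs raddfB raddfMz. Qed.

End Coordinates.

(** ** Classes modulo 2 *)

Notation class := (bool * bool)%type.

(** The class of a vector modulo 2 and modulo the radical of the form modulo 2.
    The three non-zero classes of roots are the three frames of four mutually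
    orthogonal lines; reflections permute them as the transpositions of the
    symmetric group on three letters. *)
Definition cls (x : fin4) : class :=
  let: (x1, x2, x3, x4) := x in (odd (absz (x1 + x3 + x4)), odd (absz x2)).

Definition cop (c d : class) : class :=
  if (c.1 && d.2) (+) (c.2 && d.1) then (c.1 (+) d.1, c.2 (+) d.2) else d.

Lemma cls_lin (x y : fin4) k : cls (x - y *~ k) =
  ((cls x).1 (+) ((cls y).1 && odd (absz k)), (cls x).2 (+) ((cls y).2 && odd (absz k))).
Proof.
case: x => [[[x1 x2] x3] x4]; case: y => [[[y1 y2] y3] y4].
rewrite fin4_lin /cls /=; set s := y1 + y3 + y4.
have -> : x1 - y1 * k + (x3 - y3 * k) + (x4 - y4 * k) = (x1 + x3 + x4) - s * k.
  by rewrite /s; ring.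
have parB (u v : int) : odd (absz (u - v * k)%R) = odd (absz u) (+) (odd (absz v) && odd (absz k)).
  by rewrite -oddM -abszM; lia.
by rewrite !parB.
Qed.

Lemma cls_ip (x y : fin4) :
  odd (absz (ip x y)) = ((cls x).1 && (cls y).2) (+) ((cls x).2 && (cls y).1).
Proof.
case: x => [[[x1 x2] x3] x4]; case: y => [[[y1 y2] y3] y4].
rewrite /ip /cls /= -!oddM -!abszM; lia.
Qed.

Lemma cls_frs x y : cls (frs x y) = cop (cls x) (cls y).
Proof.
rewrite /frs /qrs cls_lin cls_ip /cop.
by case: (cls x) => -[] []; case: (cls y) => -[] [].
Qed.

Lemma cls_neq0 x : ip x x = 2 -> cls x != (false, false).
Proof.
case: x => [[[x1 x2] x3] x4]; rewrite /ip /cls => H; apply/negP => /eqP[o1 o2].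
have [k kE] : exists k : int, x2 = 2 * k.
  by exists (x2 %/ 2)%Z; move: o2; clear; lia.
move: H; rewrite kE; have [l lE] : exists l : int, x1 + x3 + x4 = 2 * l.
  by exists ((x1 + x3 + x4) %/ 2)%Z; move: o1; clear; lia.
have -> : x1 = 2 * l - x3 - x4 by rewrite -lE; ring.
move=> /eqP; apply/negP/eqP => E.
have : 2 * (2 * l * l + x3 * x3 + x4 * x4 - 2 * l * x3 - 2 * l * x4 + x3 * x4 + k * k * 2 - 2 * k * l) = 1.
  by apply: (@mulfI _ (2 : int)) => //; rewrite -[RHS]E; ring.
lia.
Qed.

Definition cA : class := (true, false).
Definition cB : class := (false, true).
Definition cC : class := (true, true).

Definition class_target : seq class := [:: cA; cA; cA; cA; cB; cB].

Definition leading (k : nat) (l : seq class) := all (pred1 cA) (take k l).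

(** Members of the class [cA] are moved to the first four places one after the
    other. The two members left are then equal and not of this class, and the
    last word turns them into [cB] if they are [cC]. *)
Definition class_stages : seq ((seq class -> bool) * seq braid_word) :=
  [:: (leading 1, [:: [::]; [:: (0, false)]; [:: (0, true)];
        [:: (1, false); (0, false)]; [:: (1, false); (0, true)];
        [:: (2, false); (1, false); (0, false)]; [:: (2, false); (1, false); (0, true)];
        [:: (3, false); (2, false); (1, false); (0, false)];
        [:: (3, false); (2, false); (1, false); (0, true)]]%N);
      (leading 2, [:: [::]; [:: (1, false)]; [:: (1, true)];
        [:: (2, false); (1, false)]; [:: (2, false); (1, true)];
        [:: (3, false); (2, false); (1, false)]; [:: (3, false); (2, false); (1, true)];
        [:: (4, false); (3, false); (2, false); (1, false)]]%N);
      (leading 3, [:: [::]; [:: (2, false)]; [:: (2, true)];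
        [:: (3, false); (2, false)]; [:: (3, false); (2, true)];
        [:: (1, false); (2, true); (1, false); (3, false); (2, true)]]%N);
      (leading 4, [:: [::]; [:: (3, false)]; [:: (3, true)];
        [:: (4, false); (3, false)]]%N);
      (fun l => l == class_target, [:: [::]; [:: (3, false); (4, true); (3, false)]]%N)].

(** The hypotheses: the product fixes all classes, and more than one class
    occurs. *)
Definition class_check (l : seq class) :=
  [&& foldr cop cA l == cA, foldr cop cB l == cB & ~~ constant l] ==>
  (act cop (search cop class_stages l) l == class_target).

Lemma class_checked : all class_check (lists [:: cA; cB; cC] 6).
Proof. by vm_compute. Qed.

(** ** Frames *)

(** The roots of classes [cA] and [cB], one of each pair of opposite roots. *)
Definition frame0 : seq fin4 := [:: e1; e3; e4; e0].
Definition frame1 : seq fin4 := [:: e2; (1, 1, 1, 0); (1, 1, 0, 1); (0, 1, 1, 1)].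

Definition frame_stages : seq ((seq fin4 -> bool) * seq braid_word) :=
  [:: (fun l => pm (nth 0 l 0) e1,
        [:: [::]; [:: (0, false)]; [:: (1, false); (0, false)];
            [:: (2, false); (1, false); (0, false)]]%N);
      (fun l => pm (nth 0 l 1) e3,
        [:: [::]; [:: (1, false)]; [:: (2, false); (1, false)]]%N);
      (fun l => pm (nth 0 l 2) e4, [:: [::]; [:: (2, false)]]%N);
      (fun l => pml l star_roots,
        [:: [::]; [:: (3, false); (2, false); (4, false); (3, true); (2, false); (4, false); (3, false)];
          [:: (1, false); (3, false); (2, false); (4, false); (3, true); (2, false); (1, false); (4, false); (3, false)];
          [:: (0, false); (1, false); (3, false); (2, false); (4, false); (3, true); (2, false); (1, false); (0, false); (4, false); (3, false)]]%N)].

(** The hypothesis, that the product of the finite parts is [-1], forces the four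
    members from [frame0] to be distinct and the other two to be equal. *)
Definition frame_check (l : seq fin4) :=
  all (fun e => qfold ip l e == - e) [:: e1; e2; e3; e4] ==>
  pml (act frs (search frs frame_stages l) l) star_roots.

Lemma frame_checked :
  all (fun l0 => all (fun l1 => frame_check (l0 ++ l1)) (lists frame1 2)) (lists frame0 4).
Proof. by vm_compute. Qed.

(** ** Normal forms *)

Section Evaluation.
Variables (M : zmodType) (a b s u : M).

Definition ev (x : int4) : M :=
  let: (xa, xb, xs, xu) := x in a *~ xa + b *~ xb + s *~ xs + u *~ xu.

Lemma ev_lin x y k : ev (x - y *~ k) = ev x - ev y *~ k.
Proof.
case: x => [[[x1 x2] x3] x4]; case: y => [[[y1 y2] y3] y4].
by rewrite fin4_lin /ev !mulrz_line !mulrz_plane.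
Qed.

Lemma ev0 : ev 0 = 0.
Proof. by have := ev_lin 0 0 1; rewrite !mulr1z !subrr. Qed.

Lemma ev_act w (l : seq (fin4 * int4)) :
  [seq (c.1, ev c.2) | c <- act (@crs _) w l] =
  act (@crs _) w [seq (c.1, ev c.2) | c <- l].
Proof.
apply: act_map => -[f r] [g t]; rewrite /crs /qrs (pair_mulrz (f, r)) (pair_mulrz (f, ev r)) /=.
by congr (_, _); apply: ev_lin.
Qed.

Lemma ev_tup x y : [seq (c.1, ev c.2) | c <- tup fa fb x y] = tup a b (ev x) (ev y).
Proof.
have evD z z' : ev (z + z') = ev z + ev z'.
  by have := ev_lin z z' (-1); rewrite !mulrNz !mulr1z !opprK.
have eva : ev fa = a by rewrite /ev /= mulr1z !mulr0z !addr0.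
have evb : ev fb = b by rewrite /ev /= mulr1z !mulr0z !addr0 add0r.
have ev2 : ev (- (x *+ 2)) = - (ev x *+ 2).
  by have := ev_lin 0 x 2; rewrite -!pmulrn ev0 !sub0r.
by rewrite -[LHS]/[:: (e1, ev x); (e3, ev x); (e4, ev x); (e0, ev (x + fb));
  (e2, ev (y - x *+ 2)); (e2, ev (y + fa))] !evD ev2 eva evb.
Qed.

Lemma ev_eq w x y : ftup_eq w x y ->
  pml (act (@crs _) w (tup a b s u)) (tup a b (ev x) (ev y)).
Proof.
move=> E; have {1}-> : tup a b s u = tup a b (ev fs) (ev fu).
  by rewrite /ev /= !mulr0z !mulr1z !addr0 !add0r.
rewrite -!ev_tup -ev_act; move: E; rewrite /ftup_eq /pml.
elim: (act _ _ _) (tup fa fb x y) => [|[f g] l IH] [|[f' g'] l'] //= /andP[fg /IH ->].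
rewrite andbT; move: fg; rewrite /pm => /orP[/eqP[-> ->]|/eqP E]; first by rewrite eqxx.
have -> : f = - f' by have := congr1 fst E.
have -> : g = - g' by have := congr1 snd E.
rewrite (_ : ev (- g') = - ev g') ?eqxx ?orbT //.
by have := ev_lin 0 g' 1; rewrite !mulr1z ev0 !sub0r.
Qed.

End Evaluation.

(** The translation part of a product of reflections is linear in those of
    its factors; the coefficients depend on the finite parts only. *)
Fixpoint coefs (fl : seq fin4) (x : fin4) : seq int :=
  if fl is g :: fl' then ip g (qfold ip fl' x) :: coefs fl' x else [::].

Lemma qfold_coefs (M : zmodType) (fl : seq fin4) (rs : seq M) x t : size rs = size fl ->
  qfold (@cip M) (zip fl rs) (x, t) =
  (qfold ip fl x, t - \sum_(q <- zip rs (coefs fl x)) q.1 *~ q.2).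
Proof.
elim: fl rs => [|g fl IH] [|r rs] //= => [_|[sz]]; first by rewrite big_nil subr0.
rewrite IH // /qrs /cip (pair_mulrz (g, r)) big_cons.
by congr (_, _); rewrite opprD addrA addrAC.
Qed.

Notation int2 := (int * int)%type.
Definition va : int2 := (1, 0).
Definition vb : int2 := (0, 1).
Notation tup2 := (tup va vb).

(** Comparing the translation parts of the two products at the simple roots gives
    linear equations for the radical parts, solved by the family [tup]. *)
Lemma star_tup (rs : seq int2) : size rs = 6%N ->
  (forall x, qfold (@cip _) (zip star_roots rs) x = qfold (@cip _) (tup2 0 0) x) ->
  exists s u, zip star_roots rs = tup2 s u.
Proof.
case: rs => [|r1 [|r3 [|r4 [|r0 [|r5 [|r6 []]]]]]] // _ H.
have S x : \sum_(q <- zip [:: r1; r3; r4; r0; r5; r6] (coefs star_roots x)) q.1 *~ q.2 =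
    \sum_(q <- zip [:: 0; 0; 0; vb; 0; va] (coefs star_roots x)) q.1 *~ q.2.
  have := H (x, 0); rewrite -[tup2 0 0]/(zip star_roots [:: 0; 0; 0; vb; 0; va]).
  rewrite (@qfold_coefs _ star_roots [:: r1; r3; r4; r0; r5; r6] x 0 erefl).
  rewrite (@qfold_coefs _ star_roots [:: 0; 0; 0; vb; 0; va] x 0 erefl) !sub0r => E.
  exact/oppr_inj/(congr1 snd E).
have := (S e1, S e2, S e3, S e4).
rewrite -[coefs _ e1]/[:: 2; 0; 0; 0; 1; -1] -[coefs _ e2]/[:: -1; -1; -1; -1; -2; 2].
rewrite -[coefs _ e3]/[:: 0; 2; 0; 0; 1; -1] -[coefs _ e4]/[:: 0; 0; 2; 0; 1; -1].
rewrite !big_cons !big_nil /= !pair_mulrz /= !mulrzz.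
case: r1 r3 r4 r0 r5 r6 {H S} => [x1 y1] [x3 y3] [x4 y4] [x0 y0] [x5 y5] [x6 y6].
move=> [[[[h1 k1] [h2 k2]] [h3 k3]] [h4 k4]].
rewrite /= in h1 k1 h2 k2 h3 k3 h4 k4.
exists (x1, y1), (x5 + x1 * 2, y5 + y1 * 2).
rewrite /tup /star_roots /= !mulr2n.
congr [:: (_, (_, _)); (_, (_, _)); (_, (_, _)); (_, (_, _)); (_, (_, _)); (_, (_, _))] => /=.
all: move: h1 k1 h2 k2 h3 k3 h4 k4; clear; lia.
Qed.

(** The members of [tup2 s u] generate the lattice only if [a + 2 s] and [b + 2 u]
    form a basis of the radical lattice: the linear map [tau] is the identity
    there and maps the members to 0 or to one of these two vectors. *)
Lemma tup_det (s u : int2) :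
  (forall H : fin4 * int2 -> Prop, (forall x y k, H x -> H y -> H (x - y *~ k)) ->
    (forall g, g \in tup2 s u -> H g) -> forall y, H y) ->
  let d := (1 + s.1 * 2) * (1 + u.2 * 2) - (s.2 * 2) * (u.1 * 2) in d = 1 \/ d = -1.
Proof.
case: s u => [s1 s2] [u1 u2] gen d.
pose tau (x : fin4 * int2) : int2 := let: (x1, x2, x3, x4, (p, q)) := x in
  (p - (x1 + x3 + x4) * s1 - x2 * (u1 - s1 * 2), q - (x1 + x3 + x4) * s2 - x2 * (u2 - s2 * 2)).
pose H (x : fin4 * int2) := exists k l, tau x =
  (k * (1 + s1 * 2) + l * (u1 * 2), k * (s2 * 2) + l * (1 + u2 * 2)).
have Hall : forall y, H y.
  apply: gen.
    move=> [[[[x1 x2] x3] x4] [p q]] [[[[y1 y2] y3] y4] [p' q']] k [l1 [l2 [e1 e2]]] [l3 [l4 [e3 e4]]].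
    exists (l1 - l3 * k), (l2 - l4 * k); rewrite !pair_mulrz /= !mulrzz.
    by congr (_, _); rewrite !mulrBl ![_ * k * _]mulrAC; lia.
  move=> g; rewrite !inE.
  move=> /orP[/eqP->|/orP[/eqP->|/orP[/eqP->|/orP[/eqP->|/orP[/eqP->|/eqP->]]]]];
    rewrite /H /tau /= ?mulr2n.
  - by exists 0, 0; congr (_, _); lia.
  - by exists 0, 0; congr (_, _); lia.
  - by exists 0, 0; congr (_, _); lia.
  - by exists 0, 1; congr (_, _); lia.
  - by exists 0, 0; congr (_, _); lia.
  - by exists 1, 0; congr (_, _); lia.
have [k [l [ek el]]] := Hall (0, va).
have [k' [l' [ek' el']]] := Hall (0, vb).
rewrite !mul0r !subr0 in ek el ek' el'.
have : (k * l' - l * k') * d = 1.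
  have -> : (k * l' - l * k') * d = (k * (1 + s1 * 2) + l * (u1 * 2)) * (k' * (s2 * 2) + l' * (1 + u2 * 2))
    - (k * (s2 * 2) + l * (1 + u2 * 2)) * (k' * (1 + s1 * 2) + l' * (u1 * 2)).
    by rewrite /d /=; ring.
  by rewrite -ek -el -ek' -el' mulr0 subr0 mulr1.
move=> /(congr1 absz); rewrite abszM => /eqP; rewrite muln_eq1 => /andP[_ /eqP].
by move: d => d; clear; lia.
Qed.

(** ** Reduction of the normal forms *)

Notation reach l l' := (exists w, pml (act (@crs _) w l) l').

Lemma reach_trans (M : zmodType) (l1 l2 l3 : seq (fin4 * M)) :
  reach l1 l2 -> reach l2 l3 -> reach l1 l3.
Proof.
move=> [v h] [w k]; exists (v ++ w); rewrite act_cat.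
by apply: pml_trans k; apply: act_pml; [apply: cipL|apply: cipC|].
Qed.

Lemma reach_refl (M : zmodType) (l : seq (fin4 * M)) : reach l l.
Proof. by exists [::]; apply: pml_refl. Qed.

Lemma reach_ev w (x y : int4) (s u s' u' : int2) : ftup_eq w x y ->
  ev va vb s u x = s' -> ev va vb s u y = u' -> reach (tup2 s u) (tup2 s' u').
Proof. by move=> E <- <-; exists w; apply: ev_eq. Qed.

Lemma reach_u (s1 s2 u1 u2 : int) :
  reach (tup2 (s1, s2) (u1, u2)) (tup2 (s1, s2) (u1 + (1 + s1 * 2), u2 + s2 * 2)).
Proof.
apply: (reach_ev ftup_u); rewrite /ev /= !pair_mulrz /= !mulrzz; congr (_, _) => /=; lia.
Qed.

Lemma reach_u' (s1 s2 u1 u2 : int) :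
  reach (tup2 (s1, s2) (u1, u2)) (tup2 (s1, s2) (u1 - (1 + s1 * 2), u2 - s2 * 2)).
Proof.
apply: (reach_ev ftup_u'); rewrite /ev /= !pair_mulrz /= !mulrzz; congr (_, _) => /=; lia.
Qed.

Lemma reach_s (s1 s2 u1 u2 : int) :
  reach (tup2 (s1, s2) (u1, u2)) (tup2 (s1 + u1 * 2, s2 + (1 + u2 * 2)) (u1, u2)).
Proof.
apply: (reach_ev ftup_s); rewrite /ev /= !pair_mulrz /= !mulrzz; congr (_, _) => /=; lia.
Qed.

Lemma reach_s' (s1 s2 u1 u2 : int) :
  reach (tup2 (s1, s2) (u1, u2)) (tup2 (s1 - u1 * 2, s2 - (1 + u2 * 2)) (u1, u2)).
Proof.
apply: (reach_ev ftup_s'); rewrite /ev /= !pair_mulrz /= !mulrzz; congr (_, _) => /=; lia.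
Qed.

Lemma reach_neg (s1 s2 u1 u2 : int) :
  reach (tup2 (s1, s2) (u1, u2)) (tup2 (- s1 - 1, - s2) (- u1, - u2 - 1)).
Proof.
apply: (reach_ev ftup_neg); rewrite /ev /= !pair_mulrz /= !mulrzz; congr (_, _) => /=; lia.
Qed.

Definition reduced_to (l : seq (fin4 * int2)) :=
  reach l (tup2 0 0) \/ reach l (tup2 (-1, 0) 0).

Lemma reduced_step l l' : reach l l' -> reduced_to l' -> reduced_to l.
Proof. by move=> h [k|k]; [left|right]; apply: reach_trans k. Qed.

(** The determinant makes [1 + 2 s1] equal to 1 or -1, so the steps of [reach_u]
    change [u1] by 1 until it vanishes; [reach_neg] normalizes [u2]. *)
Lemma reduce_triangular (s1 u1 u2 : int) :
  (1 + s1 * 2) * (1 + u2 * 2) = 1 \/ (1 + s1 * 2) * (1 + u2 * 2) = -1 ->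
  reduced_to (tup2 (s1, 0) (u1, u2)).
Proof.
move=> det.
have [hs hu] : (s1 = 0 \/ s1 = -1) /\ (u2 = 0 \/ u2 = -1).
  have : (`|(1 + s1 * 2)%R| * `|(1 + u2 * 2)%R| = 1)%N.
    by rewrite -abszM; case: det => ->.
  by move=> /eqP; rewrite muln_eq1 => /andP[/eqP ? /eqP ?]; split; lia.
move=> {det}.
have base : reduced_to (tup2 (s1, 0) (0, u2)).
  case: hs hu => [->|->] [->|->].
  - by left; apply: reach_refl.
  - by apply: reduced_step (reach_neg _ _ _ _) _; right; apply: reach_refl.
  - by right; apply: reach_refl.
  - by apply: reduced_step (reach_neg _ _ _ _) _; left; apply: reach_refl.
have [k] := ubnP `|u1|%N; elim: k u1 => // k IH u1 lt.
have [->//|u1n] := eqVneq u1 0.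
have [] : reduced_to (tup2 (s1, 0) (u1 + (1 + s1 * 2), u2 + 0 * 2)) \/
          reduced_to (tup2 (s1, 0) (u1 - (1 + s1 * 2), u2 - 0 * 2)).
  have : (`|(u1 + (1 + s1 * 2))%R| < k \/ `|(u1 - (1 + s1 * 2))%R| < k)%N.
    by move: lt u1n; case: hs => ->; lia.
  have -> : u2 + 0 * 2 = u2 by lia.
  by move=> [/IH|/IH]; [left|right].
- by apply: reduced_step; apply: reach_u.
- by apply: reduced_step; apply: reach_u'.
Qed.

(** The Euclidean algorithm for the principal congruence subgroup of level 2:
    of the second coordinates [2 s2] and [1 + 2 u2] of the two vectors, the one
    with the larger absolute value shrinks when the other is added twice. *)
Lemma reduce_tup (s u : int2) :
  let d := (1 + s.1 * 2) * (1 + u.2 * 2) - (s.2 * 2) * (u.1 * 2) in d = 1 \/ d = -1 ->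
  reduced_to (tup2 s u).
Proof.
case: s u => [s1 s2] [u1 u2] /=.
have [k] := ubnP (`|(s2 * 2)%R| + `|(1 + u2 * 2)%R|)%N; elim: k s1 s2 u1 u2 => // k IH s1 s2 u1 u2 lt det.
have [s20|s2n] := eqVneq s2 0.
  by rewrite s20; apply: reduce_triangular; move: det; rewrite s20 !mul0r subr0.
have [cmp|cmp] := ltnP `|(s2 * 2)%R|%N `|(1 + u2 * 2)%R|%N.
  have [sm|sm] : (`|(1 + (u2 + s2 * 2) * 2)%R| < `|(1 + u2 * 2)%R| \/
      `|(1 + (u2 - s2 * 2) * 2)%R| < `|(1 + u2 * 2)%R|)%N.
    by move: cmp s2n; clear; lia.
  - apply: reduced_step (reach_u _ _ _ _) _; apply: IH; first by move: sm lt; clear; lia.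
    have -> : (1 + s1 * 2) * (1 + (u2 + s2 * 2) * 2) - s2 * 2 * ((u1 + (1 + s1 * 2)) * 2) =
      (1 + s1 * 2) * (1 + u2 * 2) - s2 * 2 * (u1 * 2) by ring.
    exact: det.
  - apply: reduced_step (reach_u' _ _ _ _) _; apply: IH; first by move: sm lt; clear; lia.
    have -> : (1 + s1 * 2) * (1 + (u2 - s2 * 2) * 2) - s2 * 2 * ((u1 - (1 + s1 * 2)) * 2) =
      (1 + s1 * 2) * (1 + u2 * 2) - s2 * 2 * (u1 * 2) by ring.
    exact: det.
have [sm|sm] : (`|((s2 + (1 + u2 * 2)) * 2)%R| < `|(s2 * 2)%R| \/
    `|((s2 - (1 + u2 * 2)) * 2)%R| < `|(s2 * 2)%R|)%N.
  by move: cmp; clear; lia.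
- apply: reduced_step (reach_s _ _ _ _) _; apply: IH; first by move: sm lt; clear; lia.
  have -> : (1 + (s1 + u1 * 2) * 2) * (1 + u2 * 2) - (s2 + (1 + u2 * 2)) * 2 * (u1 * 2) =
    (1 + s1 * 2) * (1 + u2 * 2) - s2 * 2 * (u1 * 2) by ring.
  exact: det.
- apply: reduced_step (reach_s' _ _ _ _) _; apply: IH; first by move: sm lt; clear; lia.
  have -> : (1 + (s1 - u1 * 2) * 2) * (1 + u2 * 2) - (s2 - (1 + u2 * 2)) * 2 * (u1 * 2) =
    (1 + s1 * 2) * (1 + u2 * 2) - s2 * 2 * (u1 * 2) by ring.
  exact: det.
Qed.

(** ** Reduction to the star *)

Definition small_ints : seq int := [:: -2; -1; 0; 1; 2].

Definition root_frame_check (x : fin4) := (ip x x == 2) ==>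
  ((cls x == cA) ==> has (pm x) frame0) && ((cls x == cB) ==> has (pm x) frame1).

Lemma root_frames_checked :
  all (fun x1 => all (fun x2 => all (fun x3 => all (fun x4 =>
    root_frame_check (x1, x2, x3, x4)) small_ints) small_ints) small_ints) small_ints.
Proof. by vm_compute. Qed.

(** Completing squares bounds the coordinates of a root by 2, so that finitely
    many vectors have to be inspected. *)
Lemma root_frames (x : fin4) : ip x x = 2 ->
  (cls x = cA -> has (pm x) frame0) /\ (cls x = cB -> has (pm x) frame1).
Proof.
case: x => [[[x1 x2] x3] x4] N.
have E : (2 * x1 - x2) ^+ 2 + (2 * x3 - x2) ^+ 2 + (2 * x4 - x2) ^+ 2 + x2 ^+ 2 = 4.
  by have := congr1 ( *%R 2) N; rewrite /ip => E; rewrite -[RHS]/(2 * 2 : int) -[RHS]E; ring.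
have bound (y : int) : y ^+ 2 <= 4 -> -2 <= y <= 2.
  by rewrite expr2 => h; apply/andP; split; nia.
have sq (y : int) : 0 <= y ^+ 2 by apply: sqr_ge0.
have := (sq (2 * x1 - x2), sq (2 * x3 - x2), sq (2 * x4 - x2), sq x2).
move=> [[[h1 h3] h4] h2].
have /andP[b1 b1'] : -2 <= 2 * x1 - x2 <= 2 by apply: bound; lia.
have /andP[b2 b2'] : -2 <= x2 <= 2 by apply: bound; lia.
have /andP[b3 b3'] : -2 <= 2 * x3 - x2 <= 2 by apply: bound; lia.
have /andP[b4 b4'] : -2 <= 2 * x4 - x2 <= 2 by apply: bound; lia.
have small (y : int) : -2 <= y -> y <= 2 -> y \in small_ints.
  move=> l u; rewrite !inE; have : y = -2 \/ y = -1 \/ y = 0 \/ y = 1 \/ y = 2 by lia.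
  by case=> [->|[->|[->|[->|->]]]].
have s1 : x1 \in small_ints by apply: small; lia.
have s2 : x2 \in small_ints by apply: small; lia.
have s3 : x3 \in small_ints by apply: small; lia.
have s4 : x4 \in small_ints by apply: small; lia.
have /allP/(_ x1 s1)/allP/(_ x2 s2)/allP/(_ x3 s3)/allP/(_ x4 s4) := root_frames_checked.
move=> /implyP/(_ (introT eqP N))/andP[/implyP fA /implyP fB].
by split=> /eqP; [apply: fA | apply: fB].
Qed.

Lemma pml_lift (M : zmodType) (l : seq (fin4 * M)) (fl : seq fin4) :
  pml (map fst l) fl -> exists2 rs, size rs = size fl & pml l (zip fl rs).
Proof.
elim: l fl => [|[f r] l IH] [|g fl] //=; first by exists [::].
move=> /andP[fg /IH[rs sz h]]; case/orP: fg => /eqP ->.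
  by exists (r :: rs); rewrite /= ?sz // /pm eqxx.
by exists (- r :: rs); rewrite /= ?sz // {1}/pm (_ : (- g, r) = - (g, - r)) ?eqxx ?orbT //; congr (_, _); rewrite opprK.
Qed.

Lemma qfold_fst (M : zmodType) (l : seq (fin4 * M)) x :
  (qfold (@cip M) l x).1 = qfold ip (map fst l) x.1.
Proof. by elim: l => //= g l IH; rewrite [LHS]crs_fst IH. Qed.

Lemma cls_qfold (l : seq fin4) x : cls (qfold ip l x) = foldr cop (cls x) (map cls l).
Proof. by elim: l => //= g l IH; rewrite [LHS]cls_frs IH. Qed.

Lemma pick_frames (l : seq fin4) : (forall f, f \in l -> ip f f = 2) ->
  map cls l = class_target -> exists l0 l1,
  [/\ l0 \in lists frame0 4, l1 \in lists frame1 2 & pml l (l0 ++ l1)].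
Proof.
move=> nl; case: l nl => [|f1 [|f2 [|f3 [|f4 [|f5 [|f6 []]]]]]] // nl [c1 c2 c3 c4 c5 c6].
have pickA f : ip f f = 2 -> cls f = cA -> exists2 g, g \in frame0 & pm f g.
  by move=> ff cf; apply/hasP; have [H _] := root_frames ff; apply: H.
have pickB f : ip f f = 2 -> cls f = cB -> exists2 g, g \in frame1 & pm f g.
  by move=> ff cf; apply/hasP; have [_ H] := root_frames ff; apply: H.
have [g1 i1 h1] := pickA f1 (nl f1 ltac:(by rewrite !inE eqxx ?orbT)) c1.
have [g2 i2 h2] := pickA f2 (nl f2 ltac:(by rewrite !inE eqxx ?orbT)) c2.
have [g3 i3 h3] := pickA f3 (nl f3 ltac:(by rewrite !inE eqxx ?orbT)) c3.
have [g4 i4 h4] := pickA f4 (nl f4 ltac:(by rewrite !inE eqxx ?orbT)) c4.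
have [g5 i5 h5] := pickB f5 (nl f5 ltac:(by rewrite !inE eqxx ?orbT)) c5.
have [g6 i6 h6] := pickB f6 (nl f6 ltac:(by rewrite !inE eqxx ?orbT)) c6.
exists [:: g1; g2; g3; g4], [:: g5; g6]; split.
- apply: (@mem_lists _ frame0 [:: g1; g2; g3; g4]) => g.
  by rewrite !in_cons in_nil orbF => /or4P[]/eqP->.
- apply: (@mem_lists _ frame1 [:: g5; g6]) => g.
  by rewrite !in_cons in_nil orbF => /orP[]/eqP->.
- by rewrite /pml /= h1 h2 h3 h4 h5 h6.
Qed.

(** The combinatorial content of a generating factorization of the Coxeter
    transformation into reflections in six roots. *)
Record factors (cs : seq (fin4 * int2)) : Prop := Factors {
  fac_size : size cs = 6%N;
  fac_norm : norm2s (@cip _) cs;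
  fac_prod : forall x, qfold (@cip _) cs x = qfold (@cip _) (tup2 0 0) x;
  fac_gen : forall H : fin4 * int2 -> Prop,
    (forall x y k, H x -> H y -> H (x - y *~ k)) ->
    (forall g, g \in cs -> H g) -> forall y, H y
}.

Lemma factors_act w cs : factors cs -> factors (act (@crs _) w cs).
Proof.
move=> [sz nn pr gen]; have [n' s' f' h'] := act_facts (@cipL _) (@cipC _) w nn.
split=> //; first by rewrite s'.
  by move=> x; rewrite f'.
by move=> H HL Hl; apply: gen => //; apply: h'.
Qed.

Lemma factors_pml cs cs' : pml cs cs' -> factors cs -> factors cs'.
Proof.
move=> e [sz nn pr gen]; have [n' s' f' h'] := pml_facts (@cipL _) (@cipC _) e.
split=> //; first by rewrite -s'.
- exact: n'.
- by move=> x; rewrite -f'.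
by move=> H HL Hl; apply: gen => //; apply: h'.
Qed.

Lemma factors_star_action cs x : factors cs ->
  qfold ip (map fst cs) x = qfold ip star_roots x.
Proof.
move=> F; have := congr1 fst (fac_prod F (x, 0)).
by rewrite !qfold_fst.
Qed.

(** Not all members lie in one class, since otherwise the lattice vectors would
    all have even products with a vector of this class modulo 2. *)
Lemma factors_classes cs : factors cs ->
  class_check (map cls (map fst cs)) -> exists w,
  map cls (map fst (act (@crs _) w cs)) = class_target.
Proof.
move=> F; rewrite /class_check; set l := map cls _.
have fixc x : cls (qfold ip star_roots x) = cls x -> foldr cop (cls x) l = cls x.
  by rewrite -(factors_star_action x F) cls_qfold.
move=> /implyP check; exists (search cop class_stages l).
have E : act cop (search cop class_stages l) l = class_target.
  apply/eqP/check/and3P; split.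
  - by apply/eqP/(fixc e1); vm_compute.
  - by apply/eqP/(fixc e2); vm_compute.
  apply/negP => /constantP const.
  have [c lE] := const cA.
  have cl g : g \in cs -> cls g.1 = c.
    move=> gc; have : cls g.1 \in l by rewrite /l -map_comp; apply: (map_f (cls \o fst) gc).
    by rewrite lE mem_nseq => /andP[_ /eqP].
  pose H (x : fin4 * int2) := (c.1 && (cls x.1).2) (+) (c.2 && (cls x.1).1) = false.
  have Hall : forall y, H y.
    apply: (fac_gen F).
      move=> x y k; rewrite /H (_ : (x - y *~ k).1 = x.1 - y.1 *~ k) ?cls_lin; last by rewrite raddfB raddfMz.
      by case: (c) (cls x.1) (cls y.1) (odd _) => [[] []] [[] []] [[] []] [].
    by move=> g /cl; rewrite /H => ->; rewrite andbC addbb.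
  have := Hall (e1, 0); have := Hall (e2, 0).
  rewrite /H -[cls (e1, 0).1]/cA -[cls (e2, 0).1]/cB => c1 c2.
  have [g gc] : exists g, g \in cs.
    by have := fac_size F; case: (cs) => // g ? _; exists g; rewrite mem_head.
  have := cls_neq0 (fac_norm F gc); rewrite cl //.
  by move: c1 c2; case: (c) => -[] [].
rewrite -E -map_comp (act_map (op' := cop)) ?map_comp //.
by move=> x y; rewrite -[LHS]/(cls (crs x y).1) crs_fst cls_frs.
Qed.

(** Classes modulo 2 allow to bring four members into one frame and two into
    another; the product then forces the finite parts to be those of the star,
    up to braid moves, and the radical parts are reduced by the Euclidean
    algorithm of [reduce_tup]. *)
Theorem D4_reduction cs : factors cs -> reduced_to cs.
Proof.
move=> F.
have [w1 cl] : exists w, map cls (map fst (act (@crs _) w cs)) = class_target.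
  apply: factors_classes => //; have /allP := class_checked; apply.
  have -> : 6%N = size (map cls (map fst cs)) by rewrite !size_map (fac_size F).
  apply: mem_lists => c /mapP[_ /mapP[g gc ->] ->].
  have := cls_neq0 (fac_norm F gc).
  by case: (cls _) => -[] [].
have F1 := factors_act w1 F.
have nf f : f \in map fst (act (@crs _) w1 cs) -> ip f f = 2.
  by move=> /mapP[g /(fac_norm F1) gg ->].
have [l0 [l1 [m0 m1 p1]]] := pick_frames nf cl.
have [rs szr q1] := pml_lift p1.
have F2 := factors_pml q1 F1.
have fst2 : map fst (zip (l0 ++ l1) rs) = l0 ++ l1 by apply: unzip1_zip; rewrite szr.
set cs2 := zip (l0 ++ l1) rs in q1 F2 fst2.
set w2 := search frs frame_stages (l0 ++ l1).
have p2 : pml (act frs w2 (l0 ++ l1)) star_roots.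
  have /allP/(_ l0 m0)/allP/(_ l1 m1)/implyP := frame_checked; apply.
  apply/allP => e ein; rewrite -fst2 (factors_star_action e F2).
  by move: ein; rewrite !inE => /or4P[]/eqP->; apply/eqP; vm_compute.
have fst3 : map fst (act (@crs _) w2 cs2) = act frs w2 (l0 ++ l1).
  by rewrite -fst2; apply: act_map => x y; apply: crs_fst.
rewrite -fst3 in p2.
have [rs3 sz3 q3] := pml_lift p2.
have F3 := factors_pml q3 (factors_act w2 F2).
have [s [u E]] := star_tup sz3 (fac_prod F3).
have R : reach cs (tup2 s u).
  apply: (@reach_trans _ _ cs2); first by exists w1.
  by exists w2; rewrite -E.
apply: reduced_step R _; apply: reduce_tup; apply: tup_det.
by rewrite -E; apply: (fac_gen F3).
Qed.

(** * Hurwitz orbits of products of reflections *)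

Section HurwitzWords.
Variables (R : realType) (X : vectType R) (A : eqType) (S : set A).
Variables (op : A -> A -> A) (f : A -> 'End(X)).
Hypothesis S_op : forall g h, S g -> S h -> S (op g h).
Hypothesis opK : forall g h, S g -> S h -> op g (op g h) = h.
Hypothesis f_inv : forall g, S g -> (f g \o f g)%VF = \1%VF.
Hypothesis f_op : forall g h, S g -> S h -> f (op g h) = (f g \o f h \o f g)%VF.

Lemma act1_in i e l : all_in S l -> all_in S (act1 op i e l).
Proof.
elim: i l => [|i IH] [|x l] //=; last first.
  move=> /all_in_cons[Sx /IH Sl] y; rewrite inE => /orP[/eqP->//|]; exact: Sl.
case: l => [|y l] // /all_in_cons[Sx /all_in_cons[Sy Sl]].
by case: e => z; rewrite !inE => /orP[/eqP->|/orP[/eqP->|/Sl]] //; apply: S_op.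
Qed.

Lemma act_in w l : all_in S l -> all_in S (act op w l).
Proof. by elim: w l => // -[i e] w IH l Sl; apply/IH/act1_in. Qed.

Lemma f_inverse g : S g -> (f g)^-1%VF = f g.
Proof. by move=> Sg; apply: inv_lfun_unique; apply: f_inv. Qed.

Lemma f_conj g h : S g -> S h -> ((f g)^-1 \o f h \o f g)%VF = f (op g h).
Proof. by move=> Sg Sh; rewrite f_inverse // f_op. Qed.

Lemma act1_lprod i e l : all_in S l ->
  lprod [seq f g | g <- act1 op i e l] = lprod [seq f g | g <- l].
Proof.
elim: i l => [|i IH] [|x l] //=; last by move=> /all_in_cons[Sx /IH ->].
case: l => [|y l] // /all_in_cons[Sx /all_in_cons[Sy Sl]].
have K g h k : S g -> (f g \o (f g \o h \o f g \o k))%VF = (h \o (f g \o k))%VF.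
  by move=> Sg; rewrite !comp_lfunA f_inv // comp_lfun1l.
case: e; rewrite /= f_op //; first by rewrite K.
by rewrite -!comp_lfunA (comp_lfunA (f x) (f x)) f_inv // comp_lfun1l.
Qed.

Lemma act_lprod w l : all_in S l ->
  lprod [seq f g | g <- act op w l] = lprod [seq f g | g <- l].
Proof.
elim: w l => // -[i e] w IH l Sl.
by rewrite [LHS]IH ?act1_lprod //; apply: act1_in.
Qed.

Lemma hurwitz_step_cons (x : 'End(X)) s s' :
  hurwitz_step s s' -> hurwitz_step (x :: s) (x :: s').
Proof. by case=> p y z q; apply: (HurwitzStep (x :: p)). Qed.

Lemma hurwitz_act1 i e l : all_in S l -> clos_refl_sym_trans _ (@hurwitz_step R X)
  [seq f g | g <- l] [seq f g | g <- act1 op i e l].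
Proof.
move=> Sl.
suff [->|[H|H]] : act1 op i e l = l \/
    hurwitz_step [seq f g | g <- l] [seq f g | g <- act1 op i e l] \/
    hurwitz_step [seq f g | g <- act1 op i e l] [seq f g | g <- l].
- exact: rst_refl.
- exact: rst_step.
- by apply/rst_sym/rst_step.
elim: i l Sl => [|i IH] [|x l] //=; try by left.
  case: l => [|y l]; first by left.
  move=> /all_in_cons[Sx /all_in_cons[Sy Sl]]; right; case: e => /=; [left|right].
    by rewrite -f_conj //; apply: (HurwitzStep [::]).
  have -> : f y = ((f x)^-1 \o f (op x y) \o f x)%VF by rewrite f_conj ?opK //; apply: S_op.
  exact: (HurwitzStep [::]).
move=> /all_in_cons[Sx /IH[->|[H|H]]]; first by left.
  by right; left; apply: hurwitz_step_cons.
by right; right; apply: hurwitz_step_cons.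
Qed.

Lemma hurwitz_act w l : all_in S l -> clos_refl_sym_trans _ (@hurwitz_step R X)
  [seq f g | g <- l] [seq f g | g <- act op w l].
Proof.
elim: w l => [|[i e] w IH] l Sl; first exact: rst_refl.
by apply: rst_trans (hurwitz_act1 i e Sl) _; apply/IH/act1_in.
Qed.

Lemma act1_cat (p l : seq A) e : act1 op (size p) e (p ++ l) = p ++ act1 op 0 e l.
Proof. by elim: p => //= x p ->. Qed.

Lemma map_split (Y : Type) (h : A -> Y) l p x y q : [seq h g | g <- l] = p ++ [:: x, y & q] ->
  exists p' g k q', [/\ l = p' ++ [:: g, k & q'], map h p' = p, h g = x, h k = y & map h q' = q].
Proof.
elim: p l => [|z p IH] [|g l] //=.
  by case: l => [|k l] //= [<- <- <-]; exists [::], g, k, l.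
move=> [<- /IH[p' [g' [k [q' [-> <- <- <- <-]]]]]].
by exists (g :: p'), g', k, q'.
Qed.

Lemma hurwitz_step_act s s' : hurwitz_step s s' ->
  (forall l, all_in S l -> s = [seq f g | g <- l] -> exists w, s' = [seq f g | g <- act op w l]) /\
  (forall l, all_in S l -> s' = [seq f g | g <- l] -> exists w, s = [seq f g | g <- act op w l]).
Proof.
case=> p x y q; split=> l Sl E; have [p' [g [k [q' [lE pE gE kE qE]]]]] := map_split (esym E).
  exists [:: (size p', true)]; rewrite /act /= lE act1_cat map_cat /= pE qE.
  have [Sg Sk] : S g /\ S k by split; apply: Sl; rewrite lE mem_cat !inE eqxx !orbT.
  by rewrite -f_conj // gE kE.
exists [:: (size p', false)]; rewrite /act /= lE act1_cat map_cat /= pE qE.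
have [Sg Sk] : S g /\ S k by split; apply: Sl; rewrite lE mem_cat !inE eqxx !orbT.
rewrite f_op // kE -gE f_inverse // !comp_lfunA f_inv // comp_lfun1l.
by rewrite -comp_lfunA f_inv // comp_lfun1r.
Qed.

(** A Hurwitz move on reflections conjugates a root by its neighbour, so an orbit
    consists of the images of one sequence of roots under braid words. *)
Lemma hurwitz_orbit_words l s : all_in S l ->
  hurwitz_orbit [seq f g | g <- l] s <-> exists w, s = [seq f g | g <- act op w l].
Proof.
move=> Sl; split; last by move=> [w ->]; apply: hurwitz_act.
suff H s1 s2 : clos_refl_sym_trans _ (@hurwitz_step R X) s1 s2 ->
  (forall l, all_in S l -> s1 = [seq f g | g <- l] -> exists w, s2 = [seq f g | g <- act op w l]) /\
  (forall l, all_in S l -> s2 = [seq f g | g <- l] -> exists w, s1 = [seq f g | g <- act op w l]).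
  by move=> /H[] /(_ l Sl erefl).
elim=> {s1 s2} [s1 s2|s1|s1 s2 _ [h1 h2]|s1 s2 s3 _ [h1 h2] _ [k1 k2]].
- exact: hurwitz_step_act.
- by split=> l' _ ->; exists [::].
- by split.
split=> l' Sl'.
- move=> /(h1 _ Sl')[v E]; have [|w ->] := k1 (act op v l') _ E; first exact: act_in.
  by exists (v ++ w); rewrite act_cat.
- move=> /(k2 _ Sl')[v E]; have [|w ->] := h2 (act op v l') _ E; first exact: act_in.
  by exists (v ++ w); rewrite act_cat.
Qed.

End HurwitzWords.

Lemma hurwitz_orbit_eq (R : realType) (X : vectType R) (s s' : seq 'End(X)) :
  hurwitz_orbit s s' -> hurwitz_orbit s' = hurwitz_orbit s.
Proof.
move=> h; apply/seteqP; split=> x /= H; first exact: rst_trans h H.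
by apply: rst_trans H; apply: rst_sym.
Qed.

(** * The two Hurwitz orbits in type D4 *)

Section D4Coordinates.
Variables (R : realType) (V Q : vectType R) (B : {symmetric V}) (BQ : {symmetric Q}).
Variables (Phi : set V) (U : {vspace V}) (a : V) (pi : 'Hom(V, Q)).
Variables (beta : 'I_5 -> Q) (m : 'I_5 -> nat) (alpha : 'I_5 -> V).
Hypothesis D : affine_data B BQ Phi U a pi beta m alpha.
Notation b := (\sum_i alpha i *+ m i).
Notation Vfin := (span_of (finite_part alpha)).
Hypothesis posdef : forall v, v \in Vfin -> 0 <= B v v /\ (B v v = 0 -> v = 0).
Hypothesis Phi_adj : exists x y, [/\ Phi x, Phi y & adj B x y].
Variable t : 'I_5.
Hypothesis tub : tubular m t.
Hypothesis t2 : t = 2%N :> nat.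

(** Coordinates of the root lattice with the branch vertex [t] as second simple
    root; [alpha ord0] is replaced by [b], which spans the radical with [a]. *)
Definition lattice_point (x : fin4 * int2) : V :=
  let: (x1, x2, x3, x4, (p, q)) := x in
  alpha (inord 1) *~ x1 + alpha t *~ x2 + alpha (inord 3) *~ x3
  + alpha (inord 4) *~ x4 + a *~ p + b *~ q.
Notation pt := lattice_point.

Lemma sum5 (M : nmodType) (F : 'I_5 -> M) :
  \sum_i F i = F ord0 + (F (inord 1) + (F t + (F (inord 3) + F (inord 4)))).
Proof.
rewrite !big_ord_recl big_ord0 addr0.
by congr (_ + (F _ + (F _ + (F _ + F _)))); apply: val_inj; rewrite /= ?inordK ?t2.
Qed.

Lemma pt_lin x y k : pt (x - y *~ k) = pt x - pt y *~ k.
Proof.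
case: x => [[[[x1 x2] x3] x4] [p q]]; case: y => [[[[y1 y2] y3] y4] [p' q']].
by rewrite !pair_mulrz /= !mulrzz !mulrz_line !mulrz_plane.
Qed.

Lemma pt0 : pt 0 = 0.
Proof. by have := pt_lin 0 0 1; rewrite !mulr1z !subrr. Qed.

Lemma ptN x : pt (- x) = - pt x.
Proof. by have := pt_lin 0 x 1; rewrite !mulr1z pt0 !sub0r. Qed.

Let rad_a' : radical B a := rad_a D.
Let rad_b' : radical B b := rad_b D.

Lemma alpha_gram : 
  [/\ forall i, B (alpha i) (alpha i) = 2,
      forall i, i != t -> B (alpha i) (alpha t) = -1,
      forall i, i != t -> B (alpha t) (alpha i) = -1 &
      forall i j, i != j -> i != t -> j != t -> B (alpha i) (alpha j) = 0].
Proof.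
have [_ [_ G]] := D4_diagram D tub t2.
split=> [i|i it|i it|i j ij it jt]; rewrite G ?eqxx //.
- by rewrite (negPf it) orbT.
- by rewrite eq_sym (negPf it).
- by rewrite (negPf ij) (negPf it) (negPf jt).
Qed.

Lemma pt_form x y : B (pt x) (pt y) = (ip x.1 y.1)%:~R.
Proof.
have [g1 g2 g3 g4] := alpha_gram.
have n k : (k < 5)%N -> (k != 2)%N -> inord k != t by move=> lt k2; rewrite -val_eqE /= inordK // t2.
have d k l : (k < 5)%N -> (l < 5)%N -> (k != l)%N -> inord k != inord l :> 'I_5.
  by move=> kt lt kl; rewrite -val_eqE /= !inordK.
case: x => [[[[x1 x2] x3] x4] [p q]]; case: y => [[[[y1 y2] y3] y4] [p' q']].
rewrite /pt /ip /= -!scaler_int !symE !rad_a' !rad_b' !(radicalr _ rad_a') !(radicalr _ rad_b').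
rewrite !g1 !g2 ?g3 ?n // !(g4 (inord _) (inord _)) ?n ?d //.
ring.
Qed.

Lemma pt_rs g x : rs B (pt g) (pt x) = pt (crs g x).
Proof. by rewrite /rs pt_form scaler_int -pt_lin. Qed.

(** The affine node takes its coefficient from [b] alone, hence the leading 0. *)
Lemma pt_sum x1 x2 x3 x4 p q : pt (x1, x2, x3, x4, (p, q)) =
  \sum_(i < 5) (nth 0 [:: 0; x1; x2; x3; x4] i + q * (m i)%:Z)%:~R *: alpha i + p%:~R *: a.
Proof.
have -> : \sum_(i < 5) (nth 0 [:: 0; x1; x2; x3; x4] i + q * (m i)%:Z)%:~R *: alpha i =
  \sum_(i < 5) alpha i *~ nth 0 [:: 0; x1; x2; x3; x4] i + b *~ q.
  rewrite mulrz_suml -big_split /=; apply: eq_bigr => i _.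
  by rewrite scaler_int mulrzDr mulrC mulrzA pmulrn.
rewrite sum5 !inordK // t2 /= mulr0z add0r scaler_int.
by rewrite !addrA [LHS]addrAC.
Qed.

Lemma pt_inj x y : pt x = pt y -> x = y.
Proof.
suff K z : pt z = 0 -> z = 0.
  move=> E; have /K/subr0_eq // : pt (x - y) = 0.
  by have := pt_lin x y 1; rewrite !mulr1z E subrr.
case: z => [[[[x1 x2] x3] x4] [p q]]; rewrite pt_sum => /(alpha_coef D)[cE pE].
have {}cE (i : 'I_5) : nth 0 [:: 0; x1; x2; x3; x4] i + q * (m i)%:Z = 0.
  by have /eqP := cE i; rewrite intr_eq0 => /eqP.
have {pE} p0 : p = 0 by apply/eqP; rewrite -(intr_eq0 R) pE.
have q0 : q = 0 by have := cE ord0; rewrite (m0 D) /= add0r mulr1.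
have := (cE (inord 1), cE t, cE (inord 3), cE (inord 4)).
rewrite q0 p0 !mul0r !addr0 !inordK // t2 /=.
by move=> [[[/= -> ->] ->] ->].
Qed.

Lemma pt_onto v : zspan Phi v -> exists x, v = pt x.
Proof.
move=> /(zspan_dec D)[c [d ->]].
exists (c (inord 1) - c ord0 * (m (inord 1))%:Z, c t - c ord0 * (m t)%:Z,
   c (inord 3) - c ord0 * (m (inord 3))%:Z, c (inord 4) - c ord0 * (m (inord 4))%:Z,
   (d, c ord0)).
rewrite pt_sum scaler_int !sum5 !inordK // t2 /= (m0 D) mulr1 add0r !subrK.
by rewrite !scaler_int.
Qed.

Lemma pt_zspan x : zspan Phi (pt x).
Proof.
case: x => [[[[x1 x2] x3] x4] [p q]]; have [_ Za] := a_U D.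
have Zal i : zspan Phi (alpha i) by apply: zspan_id; apply: (ad_Phi D).
rewrite /pt; do 5?[apply: zspanD]; apply: zspanMz => //.
by apply: zspan_sum => i _; rewrite pmulrn; apply: zspanMz.
Qed.

Lemma pt_Phi x : Phi (pt x) <-> ip x.1 x.1 = 2.
Proof.
split=> [/(ad_norm D)|E]; first by rewrite pt_form => /eqP; rewrite (eqr_int _ _ 2) => /eqP.
by apply: (Phi_norm2 D posdef Phi_adj); [apply: pt_zspan | rewrite pt_form E].
Qed.

Lemma rp_pt cs x : rp B (map pt cs) (pt x) = pt (qfold (@cip _) cs x).
Proof.
elim: cs => [//|g cs IH].
rewrite -[LHS]/(rs B (pt g) (rp B (map pt cs) (pt x))) IH pt_rs.
by rewrite -[crs g _]/(qfold (@cip _) (g :: cs) x).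
Qed.

Lemma pt_alpha0 : pt (e0, vb) = alpha ord0.
Proof.
have [mt [m1 _]] := D4_diagram D tub t2.
have n k : (k < 5)%N -> (k != 2)%N -> inord k != t by move=> lt k2; rewrite -val_eqE /= inordK // t2.
rewrite pt_sum scale0r addr0 sum5 !inordK // t2 (m0 D) mt !m1 ?n //=.
by rewrite !mulr1 add0r !addNr scale1r !scale0r !addr0.
Qed.

Lemma es_list : coxeter_prefix alpha t ++ [:: alpha t; alpha t + a] =
  [:: alpha (inord 1); alpha (inord 3); alpha (inord 4); alpha ord0; alpha t; alpha t + a].
Proof.
rewrite /coxeter_prefix.
have -> : [seq i <- enum 'I_5 | (i != ord0) && (i != t)] = [:: inord 1; inord 3; inord 4].
  apply: (inj_map (@ord_inj 5)); pose p (k : nat) := (k != 0)%N && (k != 2)%N.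
  rewrite (_ : [seq i <- _ | _] = [seq i <- enum 'I_5 | preim (@nat_of_ord 5) p i]).
    by rewrite -filter_map val_enum_ord /= !inordK.
  by apply: eq_filter => i; rewrite -!val_eqE /= t2.
by [].
Qed.

Lemma es_pt : coxeter_prefix alpha t ++ [:: alpha t; alpha t + a] = map pt (tup2 0 0).
Proof.
rewrite es_list -[RHS]/[:: pt (e1, 0); pt (e3, 0); pt (e4, 0); pt (e0, 0 + vb);
  pt (e2, 0 - 0 *+ 2); pt (e2, 0 + va)] mul0rn subr0 !add0r pt_alpha0.
by rewrite /pt /e1 /e2 /e3 /e4 /= !mulr0z !mulr1z !addr0 !add0r.
Qed.

End D4Coordinates.

Lemma size_act (X : Type) (op : X -> X -> X) w l : size (act op w l) = size l.
Proof.
elim: w l => // -[i e] w IH l; rewrite [LHS]IH /=.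
elim: i l => [|i IHi] [|x l] //=; last by rewrite IHi.
by case: l => // y l; case: e.
Qed.

Section D4Orbits.
Variables (R : realType) (V Q : vectType R) (B : {symmetric V}) (BQ : {symmetric Q}).
Variables (Phi : set V) (U : {vspace V}) (a : V) (pi : 'Hom(V, Q)).
Variables (beta : 'I_5 -> Q) (m : 'I_5 -> nat) (alpha : 'I_5 -> V).
Hypothesis D : affine_data B BQ Phi U a pi beta m alpha.
Notation b := (\sum_i alpha i *+ m i).
Notation Vfin := (span_of (finite_part alpha)).
Hypothesis posdef : forall v, v \in Vfin -> 0 <= B v v /\ (B v v = 0 -> v = 0).
Hypothesis Phi_adj : exists x y, [/\ Phi x, Phi y & adj B x y].
Hypothesis V_dim : \dim {: V} = 6%N.
Variable t : 'I_5.
Hypothesis tub : tubular m t.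
Hypothesis t2 : t = 2%N :> nat.
Variables (Vhat : vectType R) (Bhat : {symmetric Vhat}) (iota : 'Hom(V, Vhat)).
Variables (a' b' : Vhat).
Hypothesis ext : hyperbolic_extension B Vfin a b Bhat iota a' b'.

Notation es := (coxeter_prefix alpha t ++ [:: alpha t; alpha t + a]).
Notation L := (zspan [set g | g \in es]).
Notation Vt := (Vtilde iota b').
Notation Bt := (form_tilde Bhat (U := Vt)).
Notation rt v := (refl Bt (vsproj Vt (iota v))).
Notation root := (extended_roots alpha t a).
Notation W := (generated [set refl B x | x in Phi]).
Notation T := (conj_closure W (range (fun i => refl B (root i)))).
Notation Wt := (generated (range (fun i => rt (root i)))).
Notation Tt := (conj_closure Wt (range (fun i => rt (root i)))).
Notation c := (coxeter (fun i => refl B (root i)) t).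
Notation ct := (coxeter (fun i => rt (root i)) t).
Notation phi := (restrict_to_V iota (U := Vt)).
Notation pt := (lattice_point a m alpha t).

Let rs_Phi g h : Phi g -> Phi h -> Phi (rs B g h).
Proof. exact: (Phi_refl D). Qed.

Let rs_K g h : Phi g -> Phi h -> rs B g (rs B g h) = h.
Proof. by move=> /(ad_norm D) gg _; apply: rsK. Qed.

Let refl_rs g h : Phi g -> Phi h ->
  refl B (rs B g h) = (refl B g \o refl B h \o refl B g)%VF.
Proof.
move=> Pg Ph; apply/lfunP => x; rewrite !comp_lfunE !reflE ?(ad_norm D) //; last exact: rs_Phi.
by rewrite rs_conj ?(ad_norm D).
Qed.

Let rt_rs g h : Phi g -> Phi h -> rt (rs B g h) = (rt g \o rt h \o rt g)%VF.
Proof.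
move=> Pg Ph; apply: lfun_tilde => x; rewrite !comp_lfunE !(refl_tilde D ext) //; last exact: rs_Phi.
by rewrite -(rs_morph (B := B) (iota_iso ext)) rs_conj ?(iota_iso ext) ?(ad_norm D).
Qed.

(** A Hurwitz move changes neither the product of the reflections in [V] nor that
    of the reflections in the cover, so orbits lift. *)
Lemma hurwitz_tilde gs s : all_in Phi gs -> hurwitz_orbit [seq refl B g | g <- gs] s ->
  exists hs, [/\ all_in Phi hs, size hs = size gs, s = [seq refl B g | g <- hs] &
    lprod [seq rt g | g <- hs] = lprod [seq rt g | g <- gs]].
Proof.
move=> Pg /(hurwitz_orbit_words rs_Phi rs_K (refl_inv D) refl_rs s Pg)[w ->].
exists (act (rs B) w gs); split=> //.
- exact: act_in.
- exact: size_act.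
- by apply: (act_lprod rs_Phi (rt_invol D ext) rt_rs).
Qed.

Lemma es_points : es = [seq pt x | x <- tup2 0 0].
Proof. exact: (es_pt D tub t2). Qed.

Lemma generating_factors gs : all_in Phi gs -> size gs = 6%N ->
  lprod [seq refl B g | g <- gs] = c -> (forall v, L v -> zspan [set g | g \in gs] v) ->
  exists2 cs, gs = [seq pt x | x <- cs] & factors cs.
Proof.
move=> Pg sz /(agree_VP D posdef Phi_adj t Pg) E Lg.
have [cs _ gsE] : exists2 cs, (forall x, x \in cs -> [set: fin4 * int2] x) & gs = [seq pt x | x <- cs].
  apply: list_preimage => y /Pg Py.
  by have [x ->] := pt_onto D t2 (zspan_id Py); exists x.
exists cs => //; split.
- by rewrite -sz gsE size_map.
- move=> x xcs; apply/(pt_Phi D posdef Phi_adj tub t2)/Pg.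
  by rewrite gsE map_f.
- move=> x; apply: (pt_inj D t2); rewrite -!(rp_pt D tub t2) -gsE E.
  by rewrite es_points.
move=> H HL Hcs y.
have : zspan [set g | g \in gs] (pt y).
  by apply/Lg/(zspan_es D posdef Phi_adj)/(pt_zspan D).
suff K v : zspan [set g | g \in gs] v -> exists2 z, v = pt z & H z.
  by move=> /K[z /(pt_inj D t2) ->].
move: v; apply: zspan_ind.
- have [g gcs] : exists g, g \in cs.
    by case: (cs) gsE sz => [->|g ? _] //; exists g; rewrite mem_head.
  exists 0; first by rewrite pt0.
  by have := HL g g 1 (Hcs g gcs) (Hcs g gcs); rewrite mulr1z subrr.
- move=> _ _ [x -> Hx] [z -> Hz]; exists (x - z); first by rewrite -[z]mulr1z pt_lin mulr1z.
  by have := HL x z 1 Hx Hz; rewrite mulr1z.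
- by move=> g /=; rewrite gsE => /mapP[x xcs ->]; exists x => //; apply: Hcs.
Qed.

Lemma pml_reflections cs cs' : norm2s (@cip _) cs -> pml cs cs' ->
  [seq refl B g | g <- map pt cs] = [seq refl B g | g <- map pt cs'].
Proof.
rewrite /pml; elim: cs cs' => [|x cs IH] [|y cs'] //= ncs /andP[xy h].
have nx : ip x.1 x.1 = 2 by apply: ncs; rewrite mem_head.
rewrite -(IH cs') //; last by move=> g gcs; apply: ncs; rewrite inE gcs orbT.
congr (_ :: _); case/orP: xy => /eqP E; first by rewrite E.
have nn : B (pt x) (pt x) = 2 by rewrite (pt_form D tub t2) nx.
by rewrite -[y]opprK -E ptN reflN.
Qed.

(** The second normal form of [D4_reduction], with [s = - a]. It generates and has
    the product [c], but on the cover its product differs from [ct]. *)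
Definition other_tuple : seq V := [seq pt x | x <- tup2 (-1, 0) 0].

Lemma hurwitz_cases gs : all_in Phi gs -> size gs = 6%N ->
  lprod [seq refl B g | g <- gs] = c -> (forall v, L v -> zspan [set g | g \in gs] v) ->
  hurwitz_orbit [seq refl B g | g <- es] [seq refl B g | g <- gs] \/
  hurwitz_orbit [seq refl B g | g <- other_tuple] [seq refl B g | g <- gs].
Proof.
move=> Pg sz E Lg; have [cs gsE F] := generating_factors Pg sz E Lg.
have H w cs' : pml (act (@crs _) w cs) cs' ->
  hurwitz_orbit [seq refl B g | g <- map pt cs'] [seq refl B g | g <- gs].
  move=> p; apply: rst_sym; rewrite -(pml_reflections _ p); last first.
    by have [] := factors_act w F.
  rewrite (act_map (op' := rs B)); last by move=> x y; rewrite (pt_rs D tub t2).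
  by rewrite -gsE; apply: (hurwitz_act rs_Phi rs_K (refl_inv D) refl_rs w Pg).
by have [[w p]|[w p]] := D4_reduction F; [left; rewrite es_points|right]; apply: H p.
Qed.

Lemma other_Phi : all_in Phi other_tuple.
Proof.
move=> _ /mapP[x xcs ->]; apply/(pt_Phi D posdef Phi_adj tub t2)/eqP.
by move: x xcs; apply/allP; vm_compute.
Qed.

Lemma other_product : lprod [seq refl B g | g <- other_tuple] = c.
Proof.
have esN : norm2 B es by apply: (es_norm D posdef Phi_adj).
have otN : norm2 B other_tuple by move=> h /other_Phi/(ad_norm D).
have pts x : x \in tup2 0 0 -> rp B other_tuple (pt x) = rp B es (pt x).
  move=> xs; rewrite es_points.
  transitivity (pt (qfold (@cip _) (tup2 (-1, 0) 0) x)); first exact: (rp_pt D tub t2).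
  transitivity (pt (qfold (@cip _) (tup2 0 0) x)); last exact/esym/(rp_pt D tub t2).
  by apply: (congr1 pt); apply/eqP; move: x xs; apply/allP; vm_compute.
have pts' e : e \in es -> lprod [seq refl B g | g <- other_tuple] e = c e.
  rewrite coxeterE !lprod_refl //.
  by rewrite es_points => /mapP[x /pts]; rewrite es_points => E ->.
move: (lprod _) c pts' => f g pts'.
have : (<<es>> <= lker (f - g))%VS.
  by apply/span_subvP => e /pts' E; rewrite memv_ker add_lfunE opp_lfunE subr_eq0 E.
rewrite (es_full D) => /subvP K; apply/lfunP => v; apply/eqP.
by rewrite -subr_eq0 -opp_lfunE -add_lfunE -memv_ker; apply: K; apply: memvf.
Qed.

Lemma other_lattice v : L v -> zspan [set g | g \in other_tuple] v.
Proof.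
move: v; apply: zspan_sub => e /=; rewrite es_points => /mapP[x xs ->].
pose H (y : fin4 * int2) := zspan [set g | g \in other_tuple] (pt y).
have HL y z k : H y -> H z -> H (y - z *~ k).
  by move=> hy hz; rewrite /H pt_lin; apply: zspanB => //; apply: zspanMz.
have Ho y : y \in tup2 (-1, 0) 0 -> H y by move=> yo; apply: zspan_id; apply: map_f.
(* The last two members differ by [a]. *)
have Ha : H (0, va).
  rewrite (_ : (0, va) = (e2, va *+ 2) - (e2, va) *~ 1); last by apply/eqP; vm_compute.
  by apply: HL; apply: Ho; vm_compute.
suff /allP/(_ x xs)/hasP[y yo /hasP[k _ /eqP->]] : all (fun x => has (fun y =>
    has (fun k => x == y - (0, va) *~ k) [:: -1; 0; 1]) (tup2 (-1, 0) 0)) (tup2 0 0).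
  by apply: HL => //; apply: Ho.
by vm_compute.
Qed.

(** The action on [b'] in coordinates. It detects the transvection by which two
    lifts of the same product can differ. *)
Definition cover_fold (cs : seq (fin4 * int2)) (x : fin4 * int2) :=
  foldr (fun g x => x - g *~ (g.2.2 + ip g.1 x.1)) x cs.

Lemma pt_b' x : Bhat (iota (pt x)) b' = (x.2.2)%:~R.
Proof.
case: x => [[[[x1 x2] x3] x4] [p q]].
have fin (i : 'I_5) : i != ord0 -> Bhat (iota (alpha i)) b' = 0.
  move=> i0; apply: (pair_finb' ext); case: (unliftP ord0 i) i0 => [j -> _|->].
    exact: alpha_fin.
  by rewrite eqxx.
have n0 k : (k < 5)%N -> (k != 0)%N -> inord k != ord0 :> 'I_5.
  by move=> lt k0; rewrite -val_eqE /= inordK.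
have t0 : t != ord0 by rewrite -val_eqE /= t2.
rewrite /lattice_point -!scaler_int !linearD !linearZ /= !symDl !symZl.
by rewrite !fin ?n0 // (pair_ab' ext) (pair_bb' ext) !mulr0 !add0r mulr1.
Qed.

Lemma rp_b' cs x : rp Bhat [seq iota g | g <- map pt cs] (b' + iota (pt x)) =
  b' + iota (pt (cover_fold cs x)).
Proof.
elim: cs => [//|g cs IH].
rewrite -[LHS]/(rs Bhat (iota (pt g)) (rp Bhat [seq iota h | h <- map pt cs] (b' + iota (pt x)))).
rewrite IH -[cover_fold (g :: cs) x]/(cover_fold cs x - g *~ (g.2.2 + ip g.1 (cover_fold cs x).1)).
rewrite /rs symDr pt_b' (iota_iso ext) (pt_form D tub t2).
by rewrite -intrD scaler_int pt_lin linearB addrA -[in RHS]scaler_int linearZ /= scaler_int.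
Qed.

Lemma other_tilde : lprod [seq rt g | g <- other_tuple] <> ct.
Proof.
move=> /(agree_tildeP D posdef Phi_adj t ext other_Phi) /(_ (b' + iota (pt 0))).
rewrite es_points !rp_b' => /addrI/(iota_inj ext)/(pt_inj D t2)/eqP.
by apply/negP; vm_compute.
Qed.

Notation orbit := (hurwitz_orbit [seq refl B g | g <- es]).
Notation orbit' := (hurwitz_orbit [seq refl B g | g <- other_tuple]).

(** A factorization of [ct] restricts to a generating factorization of [c], which
    is not in the orbit of [other_tuple], because orbits lift and the product of
    [other_tuple] on the cover is not [ct]. *)
Lemma orbit_tilde s : orbit s <-> exists gs, [/\ all_in Phi gs, size gs = 6%N,
  lprod [seq rt g | g <- gs] = ct & s = [seq refl B g | g <- gs]].
Proof.
have esP : all_in Phi es by apply: (es_Phi D posdef Phi_adj).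
split=> [/(hurwitz_tilde esP)[hs [Ph sz -> E]]|[gs [Pg sz E ->]]].
  by exists hs; rewrite sz (size_es D tub) // coxeter_tildeE.
have [//|H] := hurwitz_cases Pg sz (tilde_agree_V D posdef Phi_adj ext Pg E)
  (tilde_lattice D posdef Phi_adj V_dim tub isT ext Pg E).
have [hs [Ph _ hE]] := hurwitz_tilde Pg (rst_sym _ _ _ _ H).
rewrite -(map_rt_eq D Bhat iota b' other_Phi Ph hE) E => K.
by case: other_tilde.
Qed.

Lemma D4_orbits : hurwitz_orbits (Red_gen T W 6 c) = [set orbit; orbit'].
Proof.
apply/seteqP; split=> [_ [_ /(Red_genP D posdef Phi_adj V_dim tub isT ext)[gs [Pg sz E -> Lg]] <-]|].
  by have [H|H] := hurwitz_cases Pg sz E Lg; rewrite (hurwitz_orbit_eq H); [left|right].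
move=> _ [->|->].
  exists [seq refl B g | g <- es] => //.
  apply/(Red_genP D posdef Phi_adj V_dim tub isT ext); exists es; split=> //.
  - exact: (es_Phi D posdef Phi_adj).
  - exact: (size_es D tub).
  - by rewrite coxeterE.
exists [seq refl B g | g <- other_tuple] => //.
apply/(Red_genP D posdef Phi_adj V_dim tub isT ext); exists other_tuple; split=> //.
- exact: other_Phi.
- exact: other_product.
- exact: other_lattice.
Qed.

Lemma orbit_neq : orbit <> orbit'.
Proof.
move=> E; have : orbit [seq refl B g | g <- other_tuple] by rewrite E; apply: rst_refl.
move=> /orbit_tilde[gs [Pg _ K gE]].
by apply: other_tilde; rewrite (map_rt_eq D Bhat iota b' other_Phi Pg gE).
Qed.

Lemma D4_card : (hurwitz_orbits (Red_gen T W 6 c) #= `I_2)%card.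
Proof.
pose f k := if k is 0 then orbit else orbit'.
rewrite (_ : hurwitz_orbits _ = f @` `I_2).
  apply: inj_card_eq => -[|[|k]] [|[|l]] //; rewrite !inE //= => _ _ E; case: orbit_neq => //.
rewrite D4_orbits; apply/seteqP; split=> [_ [->|->]|_ [[|k] _ <-]].
- by exists 0%N.
- by exists 1%N.
- by left.
- by right.
Qed.

Lemma D4_bij : set_bij (Red Tt ct) orbit (map phi).
Proof.
have TP := Red_tildeP D posdef Phi_adj V_dim tub isT ext.
split.
- move=> _ /= /TP[gs [Pg sz E ->]]; rewrite (phi_map D ext) //.
  by apply/orbit_tilde; exists gs.
- move=> s s'; rewrite !inE => /TP[gs [Pg _ _ ->]] /TP[hs [Ph _ _ ->]].
  by rewrite !(phi_map D ext) //; apply: (map_rt_eq D).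
- move=> s /orbit_tilde[gs [Pg sz E ->]].
  exists [seq rt g | g <- gs]; last by rewrite (phi_map D ext).
  by apply/TP; exists gs.
Qed.

Lemma coxeter_list : [seq refl B g | g <- es] =
  [:: refl B (alpha (inord 1)); refl B (alpha (inord 3)); refl B (alpha (inord 4));
      refl B (alpha (inord 0)); refl B (alpha (inord 2)); refl B (alpha t + a)].
Proof.
have -> : inord 0 = ord0 :> 'I_5 by apply: val_inj; rewrite /= inordK.
have -> : inord 2 = t by apply: val_inj; rewrite /= inordK.
by rewrite es_list.
Qed.

End D4Orbits.

Theorem corollary5p1
  (R : realType) (V : vectType R) (B : {symmetric V}) (n : nat) (Phi : set V)
  (Phi_ell : elliptic B n Phi)
  (Phi_norm : forall alpha, Phi alpha -> B alpha alpha = 2)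
  (U : {vspace V}) (U_dim : \dim U = 1%N)
  (U_rad : forall v, v \in U -> radical B v)
  (U_rat : exists2 v, v \in U & v != 0 /\ zspan Phi v)
  (a : V) (a_gen : zspan Phi `&` [set v | v \in U] = zspan [set a])
  (Q : vectType R) (BQ : {symmetric Q}) (pi : 'Hom(V, Q))
  (Q_quo : is_quotient B U BQ pi)
  (beta : 'I_n.+1 -> Q) (m : 'I_n.+1 -> nat)
  (beta_basis : affine_root_basis B Phi BQ pi beta m)
  (alpha : 'I_n.+1 -> V) (alpha_Phi : forall i, Phi (alpha i))
  (alpha_beta : forall i, pi (alpha i) = beta i)
  (t : 'I_n.+1) (Phi_tub : tubular m t)
  (Vhat : vectType R) (Bhat : {symmetric Vhat}) (iota : 'Hom(V, Vhat))
  (a' b' : Vhat)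
  (Vhat_ext : hyperbolic_extension B (span_of (finite_part alpha))
                a (\sum_i alpha i *+ m i) Bhat iota a' b') :
  let Phifin := Phi `&` [set v | v \in span_of (finite_part alpha)] in
  let root := extended_roots alpha t a in
  let s i := refl B (root i) in
  let S := range s in
  let W := generated [set refl B x | x in Phi] in
  let T := conj_closure W S in
  let c := coxeter s t in
  let Vt := Vtilde iota b' in
  let Bt := form_tilde Bhat (U := Vt) in
  let st i := refl Bt (vsproj Vt (iota (root i))) in
  let St := range st in
  let Wt := generated St in
  let Tt := conj_closure Wt St in
  let ct := coxeter st t in
  let phi := restrict_to_V iota (U := Vt) in
  ((of_type B Phifin 6 edges_E6 \/ of_type B Phifin 7 edges_E7
      \/ of_type B Phifin 8 edges_E8) ->
     set_bij (Red Tt ct) (Red_gen T W n.+2 c) (map phi))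
  /\
  (of_type B Phifin 4 edges_D4 -> t = 2%N :> nat ->
     (hurwitz_orbits (Red_gen T W n.+2 c) #= `I_2)%card /\
     exists O : set (seq 'End(V)),
       [/\ hurwitz_orbits (Red_gen T W n.+2 c) O,
           O [:: s (Some (inord 1)); s (Some (inord 3)); s (Some (inord 4));
                 s (Some (inord 0)); s (Some (inord 2)); s None]
         & set_bij (Red Tt ct) O (map phi)]).
Proof.
have D := AffineData (ell_grs Phi_ell) Phi_norm U_rad U_rat a_gen Q_quo beta_basis
  alpha_Phi alpha_beta.
have V_dim := ell_dim Phi_ell.
move=> Phifin root s S W T c Vt Bt st St Wt Tt ct phi.
split.
  move=> type_E.
  have [n5 posdef Phi_adj] : [/\ (5 <= n)%N,
      forall v, v \in span_of (finite_part alpha) -> 0 <= B v v /\ (B v v = 0 -> v = 0)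
    & exists x y, [/\ Phi x, Phi y & adj B x y]].
    have facts k edges (i j : 'I_k) : cartan_posdef R k edges -> (5 <= k)%N ->
        cartan_entry edges i j = -1 -> of_type B Phifin k edges ->
        [/\ (5 <= n)%N,
          forall v, v \in span_of (finite_part alpha) -> 0 <= B v v /\ (B v v = 0 -> v = 0)
        & exists x y, [/\ Phi x, Phi y & adj B x y]].
      move=> pd k5 ij /(type_facts D pd)[nk posdef adj_ij].
      by split=> //; [rewrite nk | apply: adj_ij ij].
    (* The first and the third node are adjacent in all three diagrams. *)
    case: type_E => [E6|[E7|E8]].
    - exact: (facts 6%N edges_E6 (Ordinal (isT : 0 < 6)%N) (Ordinal (isT : 2 < 6)%N) (@posdef_E6 R) isT erefl E6).
    - exact: (facts 7%N edges_E7 (Ordinal (isT : 0 < 7)%N) (Ordinal (isT : 2 < 7)%N) (@posdef_E7 R) isT erefl E7).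
    - exact: (facts 8%N edges_E8 (Ordinal (isT : 0 < 8)%N) (Ordinal (isT : 2 < 8)%N) (@posdef_E8 R) isT erefl E8).
  have n_gt0 : (0 < n)%N by apply: leq_trans n5.
  exact: (Red_bij D posdef Phi_adj V_dim Phi_tub n_gt0 Vhat_ext (mt_ge3 D posdef Phi_tub n5)).
move=> type_D t2; have [n4 posdef adj_D] := type_facts D (@posdef_D4 R) type_D.
have Phi_adj := adj_D (Ordinal (isT : 0 < 4)%N) (Ordinal (isT : 1 < 4)%N) erefl.
clear type_D adj_D; subst n.
split; first exact: (D4_card D posdef Phi_adj V_dim Phi_tub t2 Vhat_ext).
exists (hurwitz_orbit [seq refl B g | g <- coxeter_prefix alpha t ++ [:: alpha t; alpha t + a]]).
split.
- rewrite (D4_orbits D posdef Phi_adj V_dim Phi_tub t2 Vhat_ext); by left.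
- by rewrite coxeter_list //; apply: rst_refl.
- exact: (D4_bij D posdef Phi_adj V_dim Phi_tub t2 Vhat_ext).
Qed.
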